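(* Consider the randomly horizontally directed lattice $\mathbb{Z}^2_{\varepsilon}$ with randomness decaying in power $\beta$ (defined in the context), and the simple random walk $(M_n)_{n\ge 0}$ on it started at $(0,0)$. 1. If $\beta<1$, then for almost every realisation of the environment $(\lambda_y,\rho_y)_{y\in\mathbb{Z}}$ the simple random walk is transient, i.e. $\sum_{n\ge 0}\mathbb{P}_{(0,0)}(M_n=(0,0)\mid \varepsilon)<\infty$. 2. If $\beta>1$, then for almost every realisation of the environment $(\lambda_y,\rho_y)_{y\in\mathbb{Z}}$ the simple random walk is recurrent, i.e. $\sum_{n\ge 0}\mathbb{P}_{(0,0)}(M_n=(0,0)\mid \varepsilon)=\infty$.
   Context: Directed lattice: given a sequence $\varepsilon=(\varepsilon_y)_{y\in\mathbb{Z}}\in\{-1,1\}^{\mathbb{Z}}$, $\mathbb{Z}^2_{\varepsilon}$ is the directed graph on vertex set $\mathbb{Z}^2$ in which, from a vertex $u=(u_1,u_2)$, the allowed (directed) edges go to $(u_1,u_2+1)$, to $(u_1,u_2-1)$ (vertical edges, usable in both directions), and to $(u_1+\varepsilon_{u_2},u_2)$ (the horizontal edge at level $u_2$ is one-way, in direction $\varepsilon_{u_2}$). The simple random walk on $\mathbb{Z}^2_\varepsilon$ is the Markov chain $(M_n)$ on $\mathbb{Z}^2$ with $P(u,v)=1/3$ if $(u,v)$ is an allowed edge and $0$ otherwise. Randomly horizontally directed lattice with randomness decaying in power $\beta$: let $Q\ge 2$ be an even integer and $f:\mathbb{Z}\to\{-1,1\}$ a $Q$-periodic function with $\sum_{y=1}^Q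 f(y)=0$; let $(\rho_y)_{y\in\mathbb{Z}}$ be i.i.d. uniform on $\{-1,1\}$; let $(\lambda_y)_{y\in\mathbb{Z}}$ be independent $\{0,1\}$-valued random variables, independent of $(\rho_y)$, with $\mathbb{P}(\lambda_y=1)=c|y|^{-\beta}$ for all sufficiently large $|y|$, for some constant $c>0$. Set $\varepsilon_y=(1-\lambda_y)f(y)+\lambda_y\rho_y$. The walk is run in the fixed (quenched) environment $\varepsilon$. *)

(* Defs.v *)
From Stdlib Require Import Reals ZArith Arith.
Open Scope R_scope.

(* An environment realisation is a pair (lam, rho) : (Z -> bool) * (Z -> bool);
   lam y = true  <->  lambda_y = 1 ;   rho y = true  <->  rho_y = +1. *)

Definition sgn (b : bool) : Z := if b then 1%Z else (-1)%Z.

Definition env_eps (f : Z -> Z) (lam rho : Z -> bool) (y : Z) : Z :=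
  if lam y then sgn (rho y) else f y.

Fixpoint step_prob (eps : Z -> Z) (n : nat) (u v : Z * Z) : R :=
  match n with
  | O => if (Z.eqb (fst u) (fst v) && Z.eqb (snd u) (snd v))%bool then 1 else 0
  | S m =>
      (1/3) * ( step_prob eps m (fst u, (snd u + 1)%Z) v
              + step_prob eps m (fst u, (snd u - 1)%Z) v
              + step_prob eps m ((fst u + eps (snd u))%Z, snd u) v )
  end.

Definition return_prob (eps : Z -> Z) (n : nat) : R :=
  step_prob eps n (0%Z, 0%Z) (0%Z, 0%Z).

Definition transient (eps : Z -> Z) : Prop :=
  exists l : R, Un_cv (fun N => sum_f_R0 (return_prob eps) N) l.

Definition recurrent (eps : Z -> Z) : Prop :=
  cv_infty (fun N => sum_f_R0 (return_prob eps) N).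

(* Law: lam_y independent Bernoulli(p y), rho_y i.i.d. uniform on {-1,1},
   all independent. Null sets are described via the outer measure generated by
   window cylinder sets. *)

Definition cylinder : Type := (nat * (Z -> bool) * (Z -> bool))%type.

Definition in_cyl (C : cylinder) (lam rho : Z -> bool) : Prop :=
  let '(N, a, r) := C in
  forall y : Z, (- Z.of_nat N <= y <= Z.of_nat N)%Z -> lam y = a y /\ rho y = r y.

Definition site_prob (p : Z -> R) (a r : Z -> bool) (y : Z) : R :=
  (if a y then p y else 1 - p y) * (1/2).

Fixpoint window_prod (p : Z -> R) (a r : Z -> bool) (N : nat) (k : nat) : R :=
  match k with
  | O => site_prob p a r (- Z.of_nat N)%Z
  | S j => window_prod p a r N j * site_prob p a r (- Z.of_nat N + Z.of_nat (S j))%Z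
  end.

Definition cyl_prob (p : Z -> R) (C : cylinder) : R :=
  let '(N, a, r) := C in window_prod p a r N (2 * N).

Definition env_null (p : Z -> R) (S : (Z -> bool) -> (Z -> bool) -> Prop) : Prop :=
  forall delta : R, 0 < delta ->
    exists cyl : nat -> cylinder,
      (forall lam rho, S lam rho -> exists k, in_cyl (cyl k) lam rho) /\
      (forall n, sum_f_R0 (fun k => cyl_prob p (cyl k)) n <= delta).

Definition almost_surely (p : Z -> R) (P : (Z -> bool) -> (Z -> bool) -> Prop) : Prop :=
  env_null p (fun lam rho => ~ P lam rho).

Fixpoint Zsum_1_to (f : Z -> Z) (n : nat) : Z :=
  match n with
  | O => 0%Z
  | S m => (Zsum_1_to f m + f (Z.of_nat (S m)))%Z
  end.

(* Main.v *)
Require Import Defs.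
From Stdlib Require Import Reals ZArith Arith Lra Lia Psatz List Permutation Classical ClassicalEpsilon.
Import ListNotations.
Open Scope R_scope.

(** Recurrence: when [beta > 1], Borel-Cantelli leaves only finitely many flipped lines, so [eps] has a
    bounded antiderivative [Phi].  The counting measure is invariant and the antisymmetric part of the
    walk is the divergence of the bounded stream function [Phi], so the Green function satisfies a sector
    condition and is bounded below by the inverse energy of a logarithmic cutoff, as for the simple
    random walk on Z^2.

    Transience: when [beta < 1], Fourier transform in the horizontal direction turns the walk into a
    Schroedinger-type equation on Z with potential [(1 - cos th) + i eps_y sin th].  Testing it against a
    tent on the block [2^k, 2^(k+1)], at frequencies [th ~ (2 g)^(-k)] with [g = 2^((1 - beta)/2)], bounds
    the Green function at the origin by [C k^8 2^k], provided that the sum of [eps] against the tent is at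
    least [g^k / k^3] and its partial sums on the block are at most [2 k g^k].  Both hold for all large
    [k] almost surely, by a Fejer-kernel anticoncentration bound and by exponential moments.  The bounds
    sum over [k] because the frequencies at scale [k] have measure [(2 g)^(-k)] and [g > 1]. *)

(** * Finite sums *)

(** The scales are forced by the noise. A block of length [2^k] contains about
    [2^k * 2^(-beta k) = g^(2k)] randomised lines, so sums of [eps] over it fluctuate at order
    [g^k], which grows exactly when [beta < 1]. At frequency [th] the environment acts on the tent
    with strength about [th * g^k], while the Dirichlet energy of the tent is about [2^(-k)]; the
    two balance at [th] near [(2 g)^(-k)]. Pairing the equation with the mode itself cannot see the
    environment, because the imaginary potential cancels there; hence the separate test function.
    The powers of [k] are the price of summable failure probabilities. Limits and integrals are
    avoided: Green functions are discounted by [s < 1] and truncated at time [m], so they have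
    finite support and solve their equations up to a remainder of order [s^(m+1)], and the integral
    over frequencies becomes the finite Fourier sum of the walk wrapped on a cycle of length [2J+1],
    which dominates the return probability. *)

Lemma pow_le_one x n : 0 <= x <= 1 -> 0 <= x ^ n <= 1.
Proof.
  intros Hx. induction n as [|n IH]; cbn [pow]; [lra|].
  split; [apply Rmult_le_pos; lra|]. rewrite <- (Rmult_1_l 1). apply Rmult_le_compat; lra.
Qed.

Definition lsum {T : Type} (l : list T) (g : T -> R) : R :=
  fold_right (fun x s => g x + s) 0 l.

Lemma lsum_cons {T} x (l : list T) g : lsum (x :: l) g = g x + lsum l g.
Proof. reflexivity. Qed.

Lemma lsum_ext {T} (l : list T) g h :
  (forall x, In x l -> g x = h x) -> lsum l g = lsum l h.
Proof.
  induction l as [|x l IH]; simpl; intros H; [easy|].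
  rewrite H, IH; auto.
Qed.

Lemma lsum_plus {T} (l : list T) g h :
  lsum l (fun x => g x + h x) = lsum l g + lsum l h.
Proof. induction l as [|x l IH]; simpl; [lra|]. rewrite IH; lra. Qed.

Lemma lsum_scal {T} (l : list T) c g :
  lsum l (fun x => c * g x) = c * lsum l g.
Proof. induction l as [|x l IH]; simpl; [lra|]. rewrite IH; lra. Qed.

Lemma lsum_minus {T} (l : list T) g h :
  lsum l (fun x => g x - h x) = lsum l g - lsum l h.
Proof. induction l as [|x l IH]; simpl; [lra|]. rewrite IH; lra. Qed.

Lemma lsum_le {T} (l : list T) g h :
  (forall x, In x l -> g x <= h x) -> lsum l g <= lsum l h.
Proof.
  induction l as [|x l IH]; simpl; intros H; [lra|].
  apply Rplus_le_compat; auto.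
Qed.

Lemma lsum_const {T} (l : list T) c : lsum l (fun _ => c) = INR (length l) * c.
Proof.
  induction l as [|x l IH]; [simpl; lra|].
  cbn [lsum fold_right length]. fold (lsum l (fun _ => c)). rewrite IH, S_INR; lra.
Qed.

Lemma lsum_zero {T} (l : list T) : lsum l (fun _ => 0) = 0.
Proof. rewrite lsum_const; lra. Qed.

Lemma lsum_nonneg {T} (l : list T) g : (forall x, In x l -> 0 <= g x) -> 0 <= lsum l g.
Proof. intros H. rewrite <- (lsum_zero l). now apply lsum_le. Qed.

Lemma lsum_abs {T} (l : list T) g : Rabs (lsum l g) <= lsum l (fun x => Rabs (g x)).
Proof.
  induction l as [|x l IH]; simpl; [rewrite Rabs_R0; lra|].
  eapply Rle_trans; [apply Rabs_triang|]. apply Rplus_le_compat_l, IH.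
Qed.

Lemma lsum_swap {T U} (l : list T) (k : list U) g :
  lsum l (fun x => lsum k (fun y => g x y)) = lsum k (fun y => lsum l (fun x => g x y)).
Proof.
  induction l as [|x l IH]; simpl; [now rewrite lsum_zero|].
  now rewrite IH, lsum_plus.
Qed.

Lemma lsum_app {T} (l k : list T) g : lsum (l ++ k) g = lsum l g + lsum k g.
Proof. induction l as [|x l IH]; simpl; [lra|]. rewrite IH; lra. Qed.

Lemma lsum_map {T U} (h : T -> U) (l : list T) g :
  lsum (map h l) g = lsum l (fun x => g (h x)).
Proof. induction l as [|x l IH]; simpl; [easy|]. now rewrite IH. Qed.

Lemma lsum_in {T} (l : list T) g x :
  (forall y, In y l -> 0 <= g y) -> In x l -> g x <= lsum l g.
Proof.
  induction l as [|z l IH]; simpl; intros H Hx; [easy|].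
  destruct Hx as [->|Hx].
  - assert (0 <= lsum l g) by (apply lsum_nonneg; auto). lra.
  - specialize (IH (fun y hy => H y (or_intror hy)) Hx).
    specialize (H z (or_introl eq_refl)). lra.
Qed.

Lemma cauchy_schwarz_one {T} (l : list T) g :
  (lsum l g)^2 <= INR (length l) * lsum l (fun x => (g x)^2).
Proof.
  induction l as [|x l IH]; [simpl; lra|].
  cbn [lsum fold_right length]. fold (lsum l g). fold (lsum l (fun x => (g x)^2)).
  rewrite S_INR.
  assert (Hn : 0 <= INR (length l)) by apply pos_INR.
  set (n := INR (length l)) in *. set (s := lsum l g) in *.
  set (q := lsum l (fun x => (g x)^2)) in *.
  assert (Hq : 0 <= q) by (apply lsum_nonneg; intros; apply pow2_ge_0).
  assert (2 * g x * s <= n * (g x)^2 + q).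
  (* For [n > 0] the claim follows from [0 <= (n * g x - s)^2] and [s^2 <= n * q] after division by
     [n]; the empty tail needs its own case. *)
  { destruct (Req_dec n 0) as [Hn0|Hn0].
    - rewrite Hn0 in *. assert (s = 0) by nra. rewrite H. lra.
    - assert (0 < n) by lra.
      assert (0 <= (n * g x - s)^2) by apply pow2_ge_0.
      assert (0 <= n * (n * (g x)^2 + q - 2 * g x * s)) by nra.
      apply Rnot_lt_le; intro. nra. }
  nra.
Qed.

(** * Sums over symmetric windows of integers *)

(** The window grows outwards by its two end sites, so passing from [L] to [L + 1] is definitional.
    The windows of [cyl_prob] run from left to right instead; [cyl_prob_zl] reconciles the two
    orders. *)
Fixpoint zl (L : nat) : list Z :=
  match L with
  | O => [0%Z]
  | S n => Z.of_nat (S n) :: (- Z.of_nat (S n))%Z :: zl n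
  end.

Definition zs (L : nat) (g : Z -> R) : R := lsum (zl L) g.

Lemma in_zl L y : In y (zl L) <-> (- Z.of_nat L <= y <= Z.of_nat L)%Z.
Proof.
  induction L as [|L IH]; [simpl; lia|].
  cbn [zl In]. rewrite IH. lia.
Qed.

Lemma nodup_zl L : NoDup (zl L).
Proof.
  induction L as [|L IH]; cbn [zl].
  - repeat constructor; simpl; tauto.
  - constructor; [|constructor; [|easy]]; cbn [In]; rewrite in_zl; lia.
Qed.

Lemma length_zl L : length (zl L) = (2 * L + 1)%nat.
Proof. induction L as [|L IH]; cbn [zl length]; lia. Qed.

Lemma zs_S L g :
  zs (S L) g = g (Z.of_nat (S L)) + (g (- Z.of_nat (S L))%Z + zs L g).
Proof. reflexivity. Qed.

Lemma zs_tele L h :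
  zs L (fun y => h (y + 1)%Z - h y) = h (Z.of_nat L + 1)%Z - h (- Z.of_nat L)%Z.
Proof.
  induction L as [|L IH]; [unfold zs; simpl; lra|].
  rewrite zs_S, IH.
  replace (- Z.of_nat (S L) + 1)%Z with (- Z.of_nat L)%Z by lia.
  replace (Z.of_nat L + 1)%Z with (Z.of_nat (S L)) by lia. lra.
Qed.

Lemma zs_extend L L' g : (L <= L')%nat ->
  (forall y, (Z.of_nat L < Z.abs y)%Z -> g y = 0) -> zs L' g = zs L g.
Proof.
  intros HL Hg. induction HL as [|L' HL IH]; [easy|].
  rewrite zs_S, !Hg, IH by lia. lra.
Qed.

Lemma lsum_pick l z g : NoDup l -> In z l ->
  lsum l (fun y => if Z.eqb y z then g y else 0) = g z.
Proof.
  induction l as [|y l IH]; intros Hd Hin; [easy|].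
  inversion_clear Hd as [|? ? Hy Hl]. cbn [lsum fold_right].
  fold (lsum l (fun y => if Z.eqb y z then g y else 0)).
  destruct (Z.eqb_spec y z) as [->|Hyz].
  - rewrite (lsum_ext l _ (fun _ => 0)); [rewrite lsum_zero; lra|].
    intros x Hx. destruct (Z.eqb_spec x z) as [->|]; easy.
  - destruct Hin as [|Hin]; [easy|]. rewrite IH; auto. lra.
Qed.

Lemma zs_pick L z g : (- Z.of_nat L <= z <= Z.of_nat L)%Z ->
  zs L (fun y => if Z.eqb y z then g y else 0) = g z.
Proof. intros Hz. apply lsum_pick; [apply nodup_zl|now apply in_zl]. Qed.

(** * Recurrence under a bounded stream function *)

Definition zs2 (L : nat) (g : Z -> Z -> R) : R := zs L (fun x => zs L (g x)).

Lemma zs2_ext L g h : (forall x y, g x y = h x y) -> zs2 L g = zs2 L h.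
Proof. intros H. apply lsum_ext; intros; apply lsum_ext; intros; apply H. Qed.

Lemma zs2_plus L g h : zs2 L (fun x y => g x y + h x y) = zs2 L g + zs2 L h.
Proof.
  unfold zs2, zs. rewrite <- lsum_plus. apply lsum_ext; intros. apply lsum_plus.
Qed.

Lemma zs2_scal L c g : zs2 L (fun x y => c * g x y) = c * zs2 L g.
Proof.
  unfold zs2, zs. rewrite <- lsum_scal. apply lsum_ext; intros. apply lsum_scal.
Qed.

Lemma zs2_le L g h : (forall x y, g x y <= h x y) -> zs2 L g <= zs2 L h.
Proof. intros H. apply lsum_le; intros; apply lsum_le; intros; apply H. Qed.

Lemma zs2_nonneg L g : (forall x y, 0 <= g x y) -> 0 <= zs2 L g.
Proof. intros H. apply lsum_nonneg; intros; apply lsum_nonneg; intros; apply H. Qed.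

(** The inequality is not strict: the function already vanishes at distance [K], which kills both
    boundary values, at [K + 1] and at [- K], of a telescoping sum over the window of radius [K]. *)
Definition supp2 (K : nat) (g : Z -> Z -> R) : Prop :=
  forall x y, (Z.of_nat K <= Z.abs x \/ Z.of_nat K <= Z.abs y)%Z -> g x y = 0.

(** Summation by parts in both directions at once: a discrete divergence of compactly supported
    fields has zero sum. The identities for the walk below amount to exhibiting [h1] and [h2]. *)
Lemma zs2_tele L F G h1 h2 :
  (forall x y, F x y = G x y + (h1 (x + 1)%Z y - h1 x y) + (h2 x (y + 1)%Z - h2 x y)) ->
  supp2 L h1 -> supp2 L h2 -> zs2 L F = zs2 L G.
Proof.
  intros HF H1 H2.
  rewrite (zs2_ext L F _ HF), !zs2_plus.
  assert (E1 : zs2 L (fun x y => h1 (x + 1)%Z y - h1 x y) = 0).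
  { unfold zs2, zs. rewrite lsum_swap.
    erewrite lsum_ext; [apply lsum_zero|]. intros y _. cbv beta.
    fold (zs L (fun x => h1 (x + 1)%Z y - h1 x y)).
    rewrite (zs_tele L (fun x => h1 x y)), !H1 by lia. lra. }
  assert (E2 : zs2 L (fun x y => h2 x (y + 1)%Z - h2 x y) = 0).
  { unfold zs2, zs at 1. erewrite lsum_ext; [apply lsum_zero|]. intros x _.
    cbv beta. rewrite (zs_tele L (h2 x)), !H2 by lia. lra. }
  rewrite E1, E2; lra.
Qed.

Definition dx (g : Z -> Z -> R) (x y : Z) : R := g (x + 1)%Z y - g x y.
Definition dy (g : Z -> Z -> R) (x y : Z) : R := g x (y + 1)%Z - g x y.

Definition walk_op (eps : Z -> Z) (g : Z -> Z -> R) (x y : Z) : R :=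
  1/3 * (g x (y + 1)%Z + g x (y - 1)%Z + g (x + eps y)%Z y).

(** Quadratic form of [1 - s P] for the walk operator [P]. A vertical edge is crossed with
    probability 1/3 in both directions, a horizontal one in only one, so its symmetrised conductance
    is halved. *)
Definition energy2 (L : nat) (s : R) (g : Z -> Z -> R) : R :=
  (1 - s) * zs2 L (fun x y => (g x y)^2)
  + s / 3 * (zs2 L (fun x y => (dy g x y)^2) + /2 * zs2 L (fun x y => (dx g x y)^2)).

Section Quenched.

Variable eps : Z -> Z.
Hypothesis Heps : forall y, eps y = 1%Z \/ eps y = (-1)%Z.

Lemma walk_op_split g x y :
  walk_op eps g x y = 1/3 * (g x (y + 1)%Z + g x (y - 1)%Z
    + (/2 * (g (x + 1)%Z y + g (x - 1)%Z y)
       + IZR (eps y) / 2 * (g (x + 1)%Z y - g (x - 1)%Z y))).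
Proof.
  unfold walk_op. destruct (Heps y) as [-> | ->]; [|change (x + -1)%Z with (x - 1)%Z]; lra.
Qed.

(** [eps] is constant along a line, so the antisymmetric part contributes [IZR (eps y)] times a
    telescoping difference of [u x y * u (x - 1) y] and drops out, whatever the environment. *)
Lemma energy2_eq L s u : supp2 (L - 1) u -> (1 <= L)%nat ->
  zs2 L (fun x y => u x y * (u x y - s * walk_op eps u x y)) = energy2 L s u.
Proof.
  intros Hu HL. unfold energy2.
  rewrite <- !zs2_scal, <- zs2_plus, <- !zs2_scal, <- zs2_plus.
  apply zs2_tele with
    (h1 := fun x y => s / 6 * (u x y * u (x - 1)%Z y - (u x y)^2
                               - IZR (eps y) * (u x y * u (x - 1)%Z y)))
    (h2 := fun x y => s / 3 * (u x y * u x (y - 1)%Z - (u x y)^2)).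
  - intros x y. rewrite walk_op_split. unfold dx, dy.
    replace (x + 1 - 1)%Z with x by lia. replace (y + 1 - 1)%Z with y by lia.
    field.
  - intros x y H. rewrite (Hu x y), ?(Hu (x-1)%Z y) by lia. lra.
  - intros x y H. rewrite (Hu x y), ?(Hu x (y-1)%Z) by lia. lra.
Qed.

Variable Phi : Z -> R.
Variable C : R.
Hypothesis HPhi : forall y, Phi y - Phi (y - 1)%Z = IZR (eps y).
Hypothesis HC : forall y, Rabs (Phi y) <= C.

Lemma zs2_shift L F F' : supp2 (L - 1) F -> (1 <= L)%nat ->
  ((forall x y, F' x y = F (x + 1)%Z y) \/ (forall x y, F' x y = F (x - 1)%Z y)
   \/ (forall x y, F' x y = F x (y + 1)%Z)) -> zs2 L F' = zs2 L F.
Proof.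
  intros HF HL [H|[H|H]].
  - apply zs2_tele with (h1 := F) (h2 := fun _ _ => 0).
    + intros x y. rewrite H. lra.
    + intros x y Hxy. apply HF. lia.
    + easy.
  - apply zs2_tele with (h1 := fun x y => - F (x - 1)%Z y) (h2 := fun _ _ => 0).
    + intros x y. rewrite H. replace (x + 1 - 1)%Z with x by lia. lra.
    + intros x y Hxy. rewrite HF by lia. lra.
    + easy.
  - apply zs2_tele with (h1 := fun _ _ => 0) (h2 := F).
    + intros x y. rewrite H. lra.
    + easy.
    + intros x y Hxy. apply HF. lia.
Qed.

Lemma amgm a b lam : 0 < lam -> a * b <= lam * a^2 + / lam / 4 * b^2.
Proof.
  intros Hl. assert (0 <= lam * (a - b / (2 * lam))^2) by
    (apply Rmult_le_pos; [lra|apply pow2_ge_0]).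
  replace (lam * (a - b / (2 * lam))^2) with (lam * a^2 + / lam / 4 * b^2 - a * b) in H
    by (field; lra). lra.
Qed.

(* [eps] is the divergence of the stream function [Phi], so summation by parts turns the
   antisymmetric part of the walk into products of gradients: the sector condition. *)
Lemma sector_bound L s lam u phi :
  supp2 (L - 3) u -> supp2 (L - 3) phi -> (3 <= L)%nat -> 0 <= s <= 1 -> 0 < lam ->
  zs2 L (fun x y => phi x y * (u x y - s * walk_op eps u x y))
  <= 2 * lam * energy2 L s u
     + / lam * ((1 - s) * zs2 L (fun x y => (phi x y)^2)
        + (1 + C^2) * (zs2 L (fun x y => (dy phi x y)^2) + zs2 L (fun x y => (dx phi x y)^2))).
Proof.
  intros Hu Hp HL Hs Hlam.
  (* Writing [eps] as a difference of [Phi] and summing by parts in [y] gives [Phi] times [dy phi]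
     times a central difference of [u], and [Phi * phi] times a central difference of [dy u]. A
     second summation by parts, in [x], moves this last difference onto [phi]. Apart from the
     killing term, every product then pairs a gradient of [phi] with a gradient of [u]. *)
  rewrite (zs2_tele L _ (fun x y => (1 - s) * (phi x y * u x y)
     + s / 3 * (dy phi x y * dy u x y + /2 * (dx phi x y * dx u x y)
       + Phi y / 2 * ((phi x (y+1)%Z - phi x y) * (u (x+1)%Z (y+1)%Z - u (x-1)%Z (y+1)%Z))
       + Phi y / 2 * ((phi (x-1)%Z y - phi (x+1)%Z y) * (u x (y+1)%Z - u x y))))
    (fun x y => s / 3 * (phi x y * u (x-1)%Z y - phi x y * u x y) / 2
       + s / 3 * (Phi y / 2 * (phi (x-1)%Z y * (u x (y+1)%Z - u x y) + phi x y * (u (x-1)%Z (y+1)%Z - u (x-1)%Z y))))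
    (fun x y => s / 3 * (phi x y * u x (y-1)%Z - phi x y * u x y
       - Phi (y-1)%Z / 2 * (phi x y * (u (x+1)%Z y - u (x-1)%Z y))))).
  2:{ intros x y. rewrite walk_op_split, <- HPhi. unfold dx, dy.
    replace (x + 1 - 1)%Z with x by lia. replace (y + 1 - 1)%Z with y by lia.
    field. }
  2:{ intros x y H. rewrite !(Hp x y), !(Hp (x-1)%Z y) by lia. lra. }
  2:{ intros x y H. rewrite !(Hp x y) by lia. lra. }
  set (a := fun x y => (dx u x y)^2). set (b := fun x y => (dx phi x y)^2).
  assert (Ha : supp2 (L - 1) a).
  { intros x y H. unfold a, dx. rewrite (Hu x y), (Hu (x+1)%Z y) by lia. lra. }
  assert (Hb : supp2 (L - 1) b).
  { intros x y H. unfold b, dx. rewrite (Hp x y), (Hp (x+1)%Z y) by lia. lra. }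
  assert (Sa1 : zs2 L (fun x y => a x (y+1)%Z) = zs2 L a)
    by (apply (zs2_shift L a); [easy|lia|auto]).
  assert (Sa2 : zs2 L (fun x y => a (x-1)%Z (y+1)%Z) = zs2 L a).
  { rewrite <- (zs2_shift L a (fun x y => a (x-1)%Z y)); [|easy|lia|auto].
    apply zs2_shift; [|lia|auto].
    intros x y H. unfold a, dx. rewrite (Hu (x-1)%Z y), (Hu (x-1+1)%Z y) by lia. lra. }
  assert (Sb : zs2 L (fun x y => b (x-1)%Z y) = zs2 L b)
    by (apply (zs2_shift L b); [easy|lia|auto]).
  assert (HC0 : 0 <= C) by (specialize (HC 0); pose proof (Rabs_pos (Phi 0)); lra).
  set (il := / lam) in *.
  assert (Hil : 0 < il) by now apply Rinv_0_lt_compat.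
  (* The Young weights make the gradients of [u] add up to exactly [2 * lam] times their share of
     the energy: [dy u] receives [2 * lam], and [dx u] receives [lam / 2 + lam / 4 + lam / 4]. The
     two quarters come from weight [lam / 8] on a central difference, split into two unit
     differences. *)
  apply Rle_trans with (zs2 L (fun x y =>
    (1 - s) * (lam * (u x y)^2 + il / 4 * (phi x y)^2)
    + s / 3 * (2 * lam * (dy u x y)^2 + (il / 4 + il * C^2 / 2) * (dy phi x y)^2
        + lam / 2 * a x y + il / 8 * b x y + lam / 4 * a x (y+1)%Z + lam / 4 * a (x-1)%Z (y+1)%Z
        + il * C^2 / 8 * b x y + il * C^2 / 8 * b (x-1)%Z y))).
  - apply zs2_le. intros x y. unfold a, b, dx.
    replace (x - 1 + 1)%Z with x by lia. fold (dx u x y) (dx phi x y).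
    apply Rplus_le_compat; apply Rmult_le_compat_l; try lra.
    + pose proof (amgm (u x y) (phi x y) lam Hlam). fold il in H. lra.
    + assert (HP : (Phi y)^2 <= C^2).
      { rewrite <- (pow2_abs (Phi y)). apply pow_incr. split; [apply Rabs_pos|apply HC]. }
      pose proof (amgm (dy u x y) (dy phi x y) lam Hlam) as E1.
      pose proof (amgm (dx u x y) (dx phi x y) lam Hlam) as E2.
      assert (Hlam8 : 0 < lam / 8) by lra.
      pose proof (amgm (u (x+1)%Z (y+1)%Z - u (x-1)%Z (y+1)%Z) (Phi y / 2 * dy phi x y) _ Hlam8) as E3.
      pose proof (amgm (dy u x y) (Phi y / 2 * (phi (x-1)%Z y - phi (x+1)%Z y)) lam Hlam) as E4.
      replace (/ (lam / 8) / 4) with (2 * il) in E3 by (unfold il; field; lra).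
      fold il in E1, E2, E4.
      fold (dy phi x y) (dy u x y).
      set (X := u (x+1)%Z (y+1)%Z) in *. set (Y := u (x-1)%Z (y+1)%Z) in *.
      set (Zc := u x (y+1)%Z).
      assert (E5 : (X - Y)^2 <= 2 * ((X - Zc)^2 + (Zc - Y)^2)).
      { pose proof (pow2_ge_0 (X - Zc - (Zc - Y))). lra. }
      set (p1 := phi (x-1)%Z y) in *. set (p2 := phi (x+1)%Z y) in *. set (p0 := phi x y).
      assert (E6 : (p1 - p2)^2 <= 2 * ((p2 - p0)^2 + (p0 - p1)^2)).
      { pose proof (pow2_ge_0 (p2 - p0 - (p0 - p1))). lra. }
      assert (E7 : (Phi y / 2 * dy phi x y)^2 <= C^2 / 4 * (dy phi x y)^2).
      { rewrite Rpow_mult_distr. apply Rmult_le_compat_r; [apply pow2_ge_0|lra]. }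
      assert (E8 : (Phi y / 2 * (p1 - p2))^2 <= C^2 / 2 * ((p2 - p0)^2 + (p0 - p1)^2)).
      { rewrite Rpow_mult_distr.
        replace (C^2 / 2 * ((p2 - p0)^2 + (p0 - p1)^2)) with (C^2/4 * (2 * ((p2 - p0)^2 + (p0 - p1)^2))) by lra.
        apply Rmult_le_compat; [apply pow2_ge_0|apply pow2_ge_0|lra|lra]. }
      unfold dx in E2 |- *. fold p2 p0 in E2 |- *.
      apply (Rmult_le_compat_l (2 * il)) in E7; [|lra].
      apply (Rmult_le_compat_l (il / 4)) in E8; [|lra].
      apply (Rmult_le_compat_l (lam / 8)) in E5; [|lra].
      lra.
  - unfold energy2. fold a b.
    rewrite !zs2_plus, !zs2_scal, !zs2_plus, !zs2_scal.
    repeat (rewrite !zs2_plus || rewrite !zs2_scal).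
    rewrite Sa1, Sa2, Sb.
    assert (N1 : 0 <= zs2 L (fun x y => (u x y)^2)) by (apply zs2_nonneg; intros; apply pow2_ge_0).
    assert (N2 : 0 <= zs2 L (fun x y => (phi x y)^2)) by (apply zs2_nonneg; intros; apply pow2_ge_0).
    assert (N3 : 0 <= zs2 L (fun x y => (dy u x y)^2)) by (apply zs2_nonneg; intros; apply pow2_ge_0).
    assert (N4 : 0 <= zs2 L (fun x y => (dy phi x y)^2)) by (apply zs2_nonneg; intros; apply pow2_ge_0).
    assert (N5 : 0 <= zs2 L a) by (apply zs2_nonneg; intros; apply pow2_ge_0).
    assert (N6 : 0 <= zs2 L b) by (apply zs2_nonneg; intros; apply pow2_ge_0).
    set (U := zs2 L (fun x y => (u x y)^2)) in *. set (P := zs2 L (fun x y => (phi x y)^2)) in *.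
    set (DU := zs2 L (fun x y => (dy u x y)^2)) in *. set (DP := zs2 L (fun x y => (dy phi x y)^2)) in *.
    set (XU := zs2 L a) in *. set (XP := zs2 L b) in *.
    assert (M1 : 0 <= (1 - s) * lam * U) by (apply Rmult_le_pos; [apply Rmult_le_pos|]; lra).
    assert (M2 : 0 <= (1 - s) * il * P) by (apply Rmult_le_pos; [apply Rmult_le_pos|]; lra).
    assert (HC2 : 0 <= C^2) by apply pow2_ge_0.
    assert (M3 : s / 3 * ((il / 4 + il * C^2 / 2) * DP + il / 8 * XP + il * C^2 / 4 * XP)
                 <= il * (1 + C^2) * (DP + XP)).
    { apply Rle_trans with (1 * ((il / 4 + il * C^2 / 2) * DP + il / 8 * XP + il * C^2 / 4 * XP)).
      - assert (0 <= il * C^2) by (apply Rmult_le_pos; lra).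
        apply Rmult_le_compat_r; [|lra].
        assert (0 <= (il / 4 + il * C^2 / 2) * DP) by (apply Rmult_le_pos; lra).
        assert (0 <= il / 8 * XP) by (apply Rmult_le_pos; lra).
        assert (0 <= il * C^2 / 4 * XP) by (apply Rmult_le_pos; lra). lra.
      - assert (0 <= il * C^2) by (apply Rmult_le_pos; lra).
        assert (0 <= il * C^2 * DP) by (apply Rmult_le_pos; lra).
        assert (0 <= il * C^2 * XP) by (apply Rmult_le_pos; lra).
        assert (0 <= il * DP) by (apply Rmult_le_pos; lra).
        assert (0 <= il * XP) by (apply Rmult_le_pos; lra). lra. }
    lra.
Qed.
End Quenched.

(** * Harmonic numbers and the logarithmic cutoff *)

Fixpoint harm (n : nat) : R :=
  match n with O => 0 | S k => harm k + / INR (S k) end.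

Lemma harm_ln n : ln (INR (S n)) <= harm n.
Proof.
  induction n as [|n IH]; [simpl; rewrite ln_1; lra|].
  cbn [harm]. assert (Hn : 0 < INR (S n)) by (apply lt_0_INR; lia).
  replace (INR (S (S n))) with (INR (S n) * (1 + / INR (S n)))
    by (rewrite (S_INR (S n)); field; lra).
  assert (Hi : 0 < / INR (S n)) by now apply Rinv_0_lt_compat.
  rewrite ln_mult by lra.
  assert (ln (1 + / INR (S n)) <= / INR (S n)); [|lra].
  rewrite <- (ln_exp (/ INR (S n))) at 2.
  destruct (exp_ineq1_le (/ INR (S n))) as [H|H].
  - left. apply ln_increasing; lra.
  - rewrite H. lra.
Qed.

Lemma harm_unbounded B : exists n, B <= harm n /\ (1 <= n)%nat.
Proof.
  destruct (INR_unbounded (exp B)) as [n Hn]. exists (S n). split; [|lia].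
  eapply Rle_trans; [|apply harm_ln].
  rewrite <- (ln_exp B). left. apply ln_increasing; [apply exp_pos|].
  rewrite !S_INR; lra.
Qed.

Lemma harm_pos n : 0 <= harm n.
Proof.
  induction n as [|n IH]; simpl harm; [lra|].
  assert (0 < / INR (S n)) by (apply Rinv_0_lt_compat, lt_0_INR; lia). simpl in *; lra.
Qed.

Lemma harm_mono n m : (n <= m)%nat -> harm n <= harm m.
Proof.
  induction 1 as [|m Hm IH]; [lra|]. cbn [harm].
  assert (0 < / INR (S m)) by (apply Rinv_0_lt_compat, lt_0_INR; lia). lra.
Qed.

(** Each step uses [/ (t + 1)^2 <= / t - / (t + 1)] on both sides; the centre costs at most [/ a]
    because [1 <= a]. The subtracted term carries the induction. *)
Lemma sum_inv_sq a L : 1 <= a ->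
  zs L (fun y => / (a + IZR (Z.abs y))^2) <= 3 / a - 2 / (a + INR L).
Proof.
  intros Ha. induction L as [|L IH].
  - unfold zs; simpl.
    assert (/ (a * a) <= / a) by (apply Rinv_le_contravar; nra).
    rewrite Rplus_0_r, Rmult_1_r, Rplus_0_r. unfold Rdiv. lra.
  - rewrite zs_S.
    replace (IZR (Z.abs (- Z.of_nat (S L)))) with (INR (S L)) by (rewrite INR_IZR_INZ; f_equal; lia).
    replace (IZR (Z.abs (Z.of_nat (S L)))) with (INR (S L)) by (rewrite INR_IZR_INZ; f_equal; lia).
    pose proof (pos_INR L). rewrite S_INR in *. set (t := a + INR L) in *.
    replace (a + (INR L + 1)) with (t + 1) by (unfold t; lra).
    assert (/ (t + 1)^2 <= / t - / (t + 1)).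
    { replace (/ t - / (t + 1)) with (/ (t * (t + 1))) by (field; unfold t; lra).
      apply Rinv_le_contravar; unfold t in *; nra. }
    unfold Rdiv in *. lra.
Qed.

Lemma sum_inv_harm n : zs n (fun x => / (1 + IZR (Z.abs x))) <= 1 + 2 * harm n.
Proof.
  induction n as [|n IH]; [unfold zs; simpl; rewrite !Rplus_0_r, Rinv_1; lra|].
  rewrite zs_S. cbn [harm].
  replace (IZR (Z.abs (- Z.of_nat (S n)))) with (INR (S n)) by (rewrite INR_IZR_INZ; f_equal; lia).
  replace (IZR (Z.abs (Z.of_nat (S n)))) with (INR (S n)) by (rewrite INR_IZR_INZ; f_equal; lia).
  assert (0 < INR (S n)) by (apply lt_0_INR; lia).
  assert (/ (1 + INR (S n)) <= / INR (S n)) by (apply Rinv_le_contravar; lra). lra.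
Qed.

Definition l1norm (x y : Z) : nat := Z.to_nat (Z.abs x + Z.abs y).

(** Discrete analogue of [1 - log |z| / log R], equal to 1 at the origin. Its energy is of order
    [/ harm R0], which vanishes as [R0] grows: a point of the planar lattice has zero capacity. *)
Definition log_cutoff (R0 : nat) (x y : Z) : R :=
  Rmax 0 (1 - harm (l1norm x y) / harm R0).

(** Used with [k] one more than the norm of the base point. If the neighbour is nearer to the
    origin, the increment of [harm] is [/ INR (k - 1)], and the factor 2 absorbs the shift. *)
Lemma harm_step n m k : (n <= S m)%nat -> (m <= S n)%nat ->
  (k <= 2 * S n)%nat -> (k <= 2 * S m)%nat -> (0 < k)%nat ->
  Rabs (harm n - harm m) <= 2 / INR k.
Proof.
  intros H1 H2 H3 H4 Hk.
  assert (Hkk : 0 < INR k) by now apply lt_0_INR.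
  assert (Hq : forall j, (k <= 2 * S j)%nat -> 0 < / INR (S j) <= 2 / INR k).
  { intros j Hj. assert (0 < INR (S j)) by (apply lt_0_INR; lia).
    split; [now apply Rinv_0_lt_compat|].
    replace (/ INR (S j)) with (2 / (2 * INR (S j))) by (field; lra).
    apply Rmult_le_compat_l; [lra|]. apply Rinv_le_contravar; [easy|].
    change 2 with (INR 2). rewrite <- mult_INR. now apply le_INR. }
  assert (H0 : 0 < 2 / INR k) by (apply Rdiv_lt_0_compat; lra).
  assert (C3 : n = m \/ n = S m \/ m = S n) by lia.
  destruct C3 as [->|[->| ->]].
  - rewrite Rminus_diag, Rabs_R0. lra.
  - cbn [harm]. specialize (Hq m H4). apply Rabs_le. lra.
  - cbn [harm]. specialize (Hq n H3). apply Rabs_le. lra.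
Qed.

Lemma log_cutoff_step R0 x y x' y' : 0 < harm R0 ->
  (Z.abs (x' - x) + Z.abs (y' - y) <= 1)%Z ->
  (log_cutoff R0 x' y' - log_cutoff R0 x y)^2
  <= 4 / (harm R0)^2 * / (1 + IZR (Z.abs x) + IZR (Z.abs y))^2.
Proof.
  intros HR Hd.
  set (k := S (l1norm x y)).
  assert (Hk : INR k = 1 + IZR (Z.abs x) + IZR (Z.abs y)).
  { unfold k, l1norm. rewrite S_INR, INR_IZR_INZ, Z2Nat.id, plus_IZR by lia. lra. }
  rewrite <- Hk. assert (Hk0 : 0 < INR k) by (apply lt_0_INR; lia).
  assert (Hs := harm_step (l1norm x' y') (l1norm x y) k).
  assert (E : Rabs (harm (l1norm x' y') - harm (l1norm x y)) <= 2 / INR k)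
    by (apply Hs; unfold k, l1norm; lia).
  assert (F : Rabs (log_cutoff R0 x' y' - log_cutoff R0 x y) <= 2 / INR k / harm R0).
  { eapply Rle_trans with (Rabs ((harm (l1norm x' y') - harm (l1norm x y)) / harm R0)).
    - unfold log_cutoff.
      set (p := harm (l1norm x' y') / harm R0). set (q := harm (l1norm x y) / harm R0).
      replace ((harm (l1norm x' y') - harm (l1norm x y)) / harm R0) with (p - q)
        by (unfold p, q; field; lra).
      unfold Rmax. destruct (Rle_dec 0 (1 - p)), (Rle_dec 0 (1 - q));
        unfold Rabs; repeat destruct Rcase_abs; lra.
    - unfold Rdiv at 1. rewrite Rabs_mult, (Rabs_pos_eq (/ harm R0)).
      + apply Rmult_le_compat_r; [left; now apply Rinv_0_lt_compat|easy].
      + left; now apply Rinv_0_lt_compat. }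
  rewrite <- pow2_abs.
  replace (4 / (harm R0)^2 * / (INR k)^2) with ((2 / INR k / harm R0)^2) by (field; lra).
  apply pow_incr. split; [apply Rabs_pos|easy].
Qed.

Lemma log_cutoff_supp R0 : 0 < harm R0 -> supp2 R0 (log_cutoff R0).
Proof.
  intros HR x y H. unfold log_cutoff. rewrite Rmax_left; [easy|].
  assert (harm R0 <= harm (l1norm x y)) by (apply harm_mono; unfold l1norm; lia).
  assert (1 <= harm (l1norm x y) / harm R0) 
    by (rewrite <- (Rdiv_diag (harm R0)) by lra; apply Rmult_le_compat_r;
        [left; now apply Rinv_0_lt_compat|easy]). lra.
Qed.

Lemma log_cutoff_range R0 x y : 0 < harm R0 -> 0 <= log_cutoff R0 x y <= 1.
Proof.
  intros HR. unfold log_cutoff. split; [apply Rmax_l|]. apply Rmax_lub; [lra|].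
  assert (0 <= harm (l1norm x y) / harm R0); [|lra].
  apply Rle_mult_inv_pos; [apply harm_pos|easy].
Qed.

(** Summing the inverse squares over [y] leaves [3 / (1 + |x|)], and the harmonic sum over [x] is at
    most [1 + 2 * harm R0 <= 3 * harm R0]. Hence [36 = 4 * 3 * 3], and one power of [harm R0]
    survives. *)
Lemma zs2_step_bound R0 L F : 1 <= harm R0 -> (R0 <= L)%nat ->
  (forall x y, F x y <= 4 / (harm R0)^2 * / (1 + IZR (Z.abs x) + IZR (Z.abs y))^2) ->
  (forall x y, (Z.of_nat R0 < Z.abs x)%Z -> F x y = 0) ->
  zs2 L F <= 36 / harm R0.
Proof.
  intros HR HL HF HF0.
  set (c := 4 / (harm R0)^2).
  assert (Hc : 0 < c) by (apply Rdiv_lt_0_compat; [lra|apply pow_lt; lra]).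
  unfold zs2. rewrite (zs_extend R0 L); [|easy|].
  2:{ intros x Hx. unfold zs. rewrite <- (lsum_zero (zl L)). apply lsum_ext. intros; now apply HF0. }
  apply Rle_trans with (zs R0 (fun x => 3 * c * / (1 + IZR (Z.abs x)))).
  - apply lsum_le. intros x _.
    apply Rle_trans with (c * zs L (fun y => / (1 + IZR (Z.abs x) + IZR (Z.abs y))^2)).
    + unfold zs. rewrite <- lsum_scal. apply lsum_le. intros y _. apply HF.
    + assert (Hx : 0 <= IZR (Z.abs x)) by (apply IZR_le; lia).
      pose proof (sum_inv_sq (1 + IZR (Z.abs x)) L ltac:(lra)) as E.
      assert (0 <= 2 / (1 + IZR (Z.abs x) + INR L)).
      { pose proof (pos_INR L). apply Rle_mult_inv_pos; lra. }
      apply Rle_trans with (c * (3 / (1 + IZR (Z.abs x)))).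
      * apply Rmult_le_compat_l; lra.
      * unfold Rdiv. lra.
  - unfold zs at 1. rewrite lsum_scal. fold (zs R0 (fun x => / (1 + IZR (Z.abs x)))).
    pose proof (sum_inv_harm R0) as E.
    apply Rle_trans with (3 * c * (3 * harm R0)).
    + apply Rmult_le_compat_l; lra.
    + unfold c. right. field. lra.
Qed.

Lemma log_cutoff_energy R0 L : 1 <= harm R0 -> (R0 + 1 <= L)%nat ->
  zs2 L (fun x y => (dy (log_cutoff R0) x y)^2) + zs2 L (fun x y => (dx (log_cutoff R0) x y)^2)
  <= 72 / harm R0.
Proof.
  intros HR HL.
  assert (HS := log_cutoff_supp R0 ltac:(lra)).
  assert (E1 : zs2 L (fun x y => (dy (log_cutoff R0) x y)^2) <= 36 / harm R0).
  { apply zs2_step_bound; [easy|lia| |].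
    - intros x y. apply log_cutoff_step; [lra|lia].
    - intros x y H. unfold dy. rewrite !HS by lia. lra. }
  assert (E2 : zs2 L (fun x y => (dx (log_cutoff R0) x y)^2) <= 36 / harm R0).
  { apply zs2_step_bound; [easy|lia| |].
    - intros x y. apply log_cutoff_step; [lra|lia].
    - intros x y H. unfold dx. rewrite !HS by lia. lra. }
  lra.
Qed.

(** * The truncated discounted Green function of the planar walk *)

Definition hit_prob (eps : Z -> Z) (n : nat) (x y : Z) : R :=
  step_prob eps n (x, y) (0%Z, 0%Z).

Definition partial_green (eps : Z -> Z) (s : R) (m : nat) (x y : Z) : R :=
  sum_f_R0 (fun n => s ^ n * hit_prob eps n x y) m.

Lemma hit_prob_S eps n x y :
  hit_prob eps (S n) x y = walk_op eps (hit_prob eps n) x y.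
Proof. reflexivity. Qed.

Lemma hit_prob_range eps n x y : 0 <= hit_prob eps n x y <= 1.
Proof.
  revert x y. induction n as [|n IH]; intros x y.
  - unfold hit_prob; cbn. destruct (_ && _)%bool; lra.
  - rewrite hit_prob_S. unfold walk_op.
    pose proof (IH x (y + 1)%Z). pose proof (IH x (y - 1)%Z). pose proof (IH (x + eps y)%Z y). lra.
Qed.

Lemma hit_prob_supp eps n : (forall y, eps y = 1%Z \/ eps y = (-1)%Z) ->
  supp2 (S n) (hit_prob eps n).
Proof.
  intros Heps. induction n as [|n IH]; intros x y H.
  - unfold hit_prob; cbn. destruct (Z.eqb_spec x 0), (Z.eqb_spec y 0); cbn; try easy. lia.
  - rewrite hit_prob_S. unfold walk_op.
    pose proof (Heps y) as He. rewrite !IH; try lra; lia.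
Qed.

Lemma partial_green_supp eps s m : (forall y, eps y = 1%Z \/ eps y = (-1)%Z) ->
  supp2 (S m) (partial_green eps s m).
Proof.
  intros Heps x y H. unfold partial_green.
  rewrite <- (sum_eq (fun _ => 0)); [rewrite sum_cte; lra|].
  intros i Hi. rewrite hit_prob_supp by (easy || lia). lra.
Qed.

Lemma partial_green_eq eps s m x y :
  partial_green eps s m x y - s * walk_op eps (partial_green eps s m) x y
  = hit_prob eps 0 x y - s ^ S m * hit_prob eps (S m) x y.
Proof.
  induction m as [|m IH].
  - unfold partial_green. rewrite hit_prob_S. unfold walk_op. simpl. lra.
  - rewrite (hit_prob_S _ (S m)). unfold walk_op in *. unfold partial_green in *.
    cbn [sum_f_R0]. cbn [pow] in *. lra.
Qed.

Lemma zs2_supp K L g : supp2 (S K) g -> (K <= L)%nat -> zs2 L g = zs2 K g.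
Proof.
  intros H HL. unfold zs2. rewrite (zs_extend K L); [|easy|].
  - apply lsum_ext. intros x _. apply zs_extend; [easy|]. intros y Hy. apply H. lia.
  - intros x Hx. unfold zs. rewrite <- (lsum_zero (zl L)). apply lsum_ext. intros; apply H; lia.
Qed.

Lemma zs2_pick L g :
  zs2 L (fun x y => g x y * (if (Z.eqb x 0 && Z.eqb y 0)%bool then 1 else 0)) = g 0%Z 0%Z.
Proof.
  rewrite <- (zs_pick L 0 (fun x => g x 0%Z)) by lia.
  apply lsum_ext. intros x _. destruct (Z.eqb_spec x 0) as [->|Hx]; cbn [andb].
  - rewrite <- (zs_pick L 0 (fun y => g 0%Z y)) by lia. apply lsum_ext. intros y _.
    destruct (Z.eqb y 0); lra.
  - transitivity (lsum (zl L) (fun _ => 0)); [|apply lsum_zero].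
    apply lsum_ext. intros y _. simpl. lra.
Qed.

Lemma return_prob_nonneg eps n : 0 <= return_prob eps n.
Proof. apply (hit_prob_range eps n 0 0). Qed.

Lemma return_sum_mono eps n m : (n <= m)%nat ->
  sum_f_R0 (return_prob eps) n <= sum_f_R0 (return_prob eps) m.
Proof.
  induction 1 as [|m Hm IH]; [lra|]. cbn [sum_f_R0].
  pose proof (return_prob_nonneg eps (S m)). lra.
Qed.

(** By contradiction: if the expected number of returns stays at most [B], the energy of the
    truncated Green function [u] is at most [u 0 0 <= B]. Testing its equation against the cutoff
    [phi] gives at least 3/4, whereas the sector bound with [lam = / (8 * B)] gives at most 1/4 +
    1/8 + 1/8. The parameters are chosen in the order [R0], [s], [m], each depending on the previous
    ones. *)
Lemma recurrent_of_bounded_stream (eps : Z -> Z) (Phi : Z -> R) (C : R) :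
  (forall y, eps y = 1%Z \/ eps y = (-1)%Z) ->
  (forall y, Phi y - Phi (y - 1)%Z = IZR (eps y)) ->
  (forall y, Rabs (Phi y) <= C) -> recurrent eps.
Proof.
  intros Heps HPhi HC B0.
  set (B := Rmax 1 B0). assert (HB1 : 1 <= B) by apply Rmax_l.
  assert (HB0 : B0 <= B) by apply Rmax_r.
  assert (HC2 : 0 <= C^2) by apply pow2_ge_0.
  (* Makes [8 * B * (1 + C^2)] times the cutoff energy [72 / harm R0] at most 1/8. *)
  set (HH := 8 * B * (1 + C^2) * 72 * 8).
  assert (HH0 : 0 < HH).
  { unfold HH. repeat apply Rmult_lt_0_compat; lra. }
  destruct (harm_unbounded (Rmax 1 HH)) as [R0 [HR _]].
  assert (HR1 : 1 <= harm R0) by (eapply Rle_trans; [apply Rmax_l|exact HR]).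
  assert (HR2 : HH <= harm R0) by (eapply Rle_trans; [apply Rmax_r|exact HR]).
  set (phi := log_cutoff R0).
  assert (Hsp : supp2 R0 phi) by (apply log_cutoff_supp; lra).
  assert (Hrg : forall x y, 0 <= phi x y <= 1) by (intros; apply log_cutoff_range; lra).
  assert (Hphi0 : phi 0%Z 0%Z = 1).
  { unfold phi, log_cutoff. simpl. unfold Rdiv. rewrite Rmult_0_l, Rmax_right; lra. }
  set (P := zs2 R0 (fun x y => (phi x y)^2)). set (P1 := zs2 R0 phi).
  assert (HP : 0 <= P) by (apply zs2_nonneg; intros; apply pow2_ge_0).
  assert (HP1 : 0 <= P1) by (apply zs2_nonneg; intros; apply Hrg).
  (* With [1 - s = d] the killing term [8 * B * (1 - s) * P] is at most 1/8. *)
  set (d := / (64 * B * (P + 1))).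
  assert (Hden : 64 <= 64 * B * (P + 1)) by nra.
  assert (Hd : 0 < d <= 1/64).
  { unfold d. split; [apply Rinv_0_lt_compat; lra|].
    replace (1/64) with (/64) by lra. apply Rinv_le_contravar; lra. }
  set (s := 1 - d).
  (* The truncation remainder will cost at most [s ^ S m * P1 <= 1/4] in the test against [phi]. *)
  destruct (pow_lt_1_zero s) with (y := / (4 * (P1 + 1))) as [m Hm].
  { unfold s. rewrite Rabs_pos_eq; lra. }
  { apply Rinv_0_lt_compat; lra. }
  exists m. intros n Hn.
  apply Rlt_le_trans with (sum_f_R0 (return_prob eps) m); [|now apply return_sum_mono].
  apply Rnot_le_lt. intro Hle.
  set (u := partial_green eps s m). set (L := (m + R0 + 5)%nat).
  assert (Hu : supp2 (S m) u) by now apply partial_green_supp.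
  assert (Hu3 : supp2 (L - 3) u) by (intros x y H; apply Hu; unfold L in *; lia).
  assert (Hp3 : supp2 (L - 3) phi) by (intros x y H; apply Hsp; unfold L in *; lia).
  assert (Hu0 : 0 <= u 0%Z 0%Z <= B).
  { unfold u, partial_green. split.
    - apply cond_pos_sum. intros k. apply Rmult_le_pos; [apply pow_le; unfold s; lra|apply hit_prob_range].
    - apply Rle_trans with (sum_f_R0 (return_prob eps) m); [|lra].
      apply sum_Rle. intros k _. change (hit_prob eps k 0 0) with (return_prob eps k).
      pose proof (return_prob_nonneg eps k).
      assert (s ^ k <= 1) by (rewrite <- (pow1 k); apply pow_incr; unfold s; lra).
      nra. }
  assert (Hupos : forall x y, 0 <= u x y).
  { intros x y. apply cond_pos_sum. intros k.
    apply Rmult_le_pos; [apply pow_le; unfold s; lra|apply hit_prob_range]. }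
  assert (Hsm : 0 <= s ^ S m <= / (4 * (P1 + 1))).
  { split; [apply pow_le; unfold s; lra|].
    specialize (Hm (S m) ltac:(lia)). rewrite Rabs_pos_eq in Hm; [lra|]. apply pow_le; unfold s; lra. }
  assert (HE : energy2 L s u <= B).
  { rewrite <- (energy2_eq eps Heps) by (try (intros x y H; apply Hu); unfold L in *; lia).
    apply Rle_trans with (u 0%Z 0%Z); [|lra].
    rewrite <- (zs2_pick L u). apply zs2_le. intros x y.
    unfold u at 2 3. rewrite partial_green_eq.
    apply Rmult_le_compat_l; [apply Hupos|].
    pose proof (hit_prob_range eps (S m) x y).
    assert (0 <= s ^ S m * hit_prob eps (S m) x y) by (apply Rmult_le_pos; lra).
    change (hit_prob eps 0 x y) with (if (Z.eqb x 0 && Z.eqb y 0)%bool then 1 else 0). lra. }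
  assert (HT : 3/4 <= zs2 L (fun x y => phi x y * (u x y - s * walk_op eps u x y))).
  { apply Rle_trans with (zs2 L (fun x y => phi x y * (if (Z.eqb x 0 && Z.eqb y 0)%bool then 1 else 0)
         + - s ^ S m * phi x y)).
    - rewrite zs2_plus, zs2_pick, zs2_scal, Hphi0.
      rewrite (zs2_supp R0 L phi) by (try (intros x y H; apply Hsp); unfold L in *; lia).
      fold P1.
      assert (s ^ S m * P1 <= / (4 * (P1 + 1)) * (P1 + 1)) by (apply Rmult_le_compat; lra).
      replace (/ (4 * (P1 + 1)) * (P1 + 1)) with (1/4) in H by (field; lra). lra.
    - apply zs2_le. intros x y. unfold u at 1 2. rewrite partial_green_eq.
      change (hit_prob eps 0 x y) with (if (Z.eqb x 0 && Z.eqb y 0)%bool then 1 else 0).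
      pose proof (hit_prob_range eps (S m) x y) as Hh. pose proof (Hrg x y).
      assert (0 <= s ^ S m * (phi x y * (1 - hit_prob eps (S m) x y)))
        by (apply Rmult_le_pos; [|apply Rmult_le_pos]; lra).
      lra. }
  assert (Hlam : 0 < / (8 * B)) by (apply Rinv_0_lt_compat; lra).
  pose proof (sector_bound eps Heps Phi C HPhi HC L s (/ (8 * B)) u phi Hu3 Hp3
    ltac:(unfold L; lia) ltac:(unfold s; lra) Hlam) as HB.
  rewrite Rinv_inv in HB.
  rewrite (zs2_supp R0 L (fun x y => (phi x y)^2)) in HB.
  2:{ intros x y H. rewrite Hsp by lia. lra. }
  2:{ unfold L; lia. }
  fold P in HB.
  pose proof (log_cutoff_energy R0 L HR1 ltac:(unfold L; lia)) as HD. fold phi in HD.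
  assert (T1 : 2 * / (8 * B) * energy2 L s u <= 1/4).
  { apply Rle_trans with (2 * / (8 * B) * B).
    - apply Rmult_le_compat_l; lra.
    - right. field. lra. }
  assert (T2 : 8 * B * ((1 - s) * P) <= 1/8).
  { unfold s. replace (1 - (1 - d)) with d by lra.
    apply Rle_trans with (8 * B * (d * (P + 1))).
    - apply Rmult_le_compat_l; [lra|]. apply Rmult_le_compat_l; lra.
    - right. unfold d. field. lra. }
  assert (T3 : 8 * B * ((1 + C^2) * (72 / harm R0)) <= 1/8).
  { apply Rle_trans with (8 * B * ((1 + C^2) * (72 / HH))).
    - apply Rmult_le_compat_l; [lra|]. apply Rmult_le_compat_l; [lra|].
      apply Rmult_le_compat_l; [lra|]. apply Rinv_le_contravar; lra.
    - right. unfold HH. field. lra. }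
  set (D := zs2 L (fun x y => (dy phi x y)^2) + zs2 L (fun x y => (dx phi x y)^2)) in *.
  assert (T4 : 8 * B * ((1 + C^2) * D) <= 8 * B * ((1 + C^2) * (72 / harm R0))).
  { apply Rmult_le_compat_l; [lra|]. apply Rmult_le_compat_l; lra. }
  lra.
Qed.

(** * Expectations over finite windows *)

Definition config : Type := ((Z -> bool) * (Z -> bool))%type.

Definition upd (h : Z -> bool) (y : Z) (v : bool) (z : Z) : bool :=
  if Z.eqb z y then v else h z.

Definition weight (p : Z -> R) (y : Z) (v : bool) : R :=
  (if v then p y else 1 - p y) * (1/2).

Definition mean1 (p : Z -> R) (y : Z) (g : bool -> bool -> R) : R :=
  weight p y true * (g true true + g true false)
  + weight p y false * (g false true + g false false).

(** Sites are integrated out one at a time, and those outside [l] are frozen at [false]. It is the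
    expectation under the product law for functions that depend on the sites of [l] alone. *)
Fixpoint expect (p : Z -> R) (l : list Z) (g : (Z -> bool) -> (Z -> bool) -> R) : R :=
  match l with
  | [] => g (fun _ => false) (fun _ => false)
  | y :: l' => expect p l' (fun a r => mean1 p y (fun v w => g (upd a y v) (upd r y w)))
  end.

Section Law.
Variable p : Z -> R.
Hypothesis Hp : forall y, 0 <= p y <= 1.

Lemma weight_nonneg y v : 0 <= weight p y v.
Proof. unfold weight. specialize (Hp y). destruct v; lra. Qed.

Lemma mean1_le y g h : (forall v w, g v w <= h v w) -> mean1 p y g <= mean1 p y h.
Proof.
  intros H. unfold mean1.
  apply Rplus_le_compat; apply Rmult_le_compat_l; try apply weight_nonneg;
    apply Rplus_le_compat; apply H.
Qed.

Lemma expect_le l g h : (forall a r, g a r <= h a r) -> expect p l g <= expect p l h.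
Proof.
  revert g h. induction l as [|y l IH]; intros g h H; cbn [expect]; [apply H|].
  apply IH. intros a r. apply mean1_le. intros; apply H.
Qed.

Lemma expect_ext l g h : (forall a r, g a r = h a r) -> expect p l g = expect p l h.
Proof. intros H. apply Rle_antisym; apply expect_le; intros; rewrite H; lra. Qed.

Lemma expect_plus l g h :
  expect p l (fun a r => g a r + h a r) = expect p l g + expect p l h.
Proof.
  revert g h. induction l as [|y l IH]; intros g h; cbn [expect]; [easy|].
  rewrite <- IH. apply expect_ext. intros. unfold mean1. lra.
Qed.

Lemma expect_scal l c g : expect p l (fun a r => c * g a r) = c * expect p l g.
Proof.
  revert g. induction l as [|y l IH]; intros g; cbn [expect]; [easy|].
  rewrite <- IH. apply expect_ext. intros. unfold mean1. lra.
Qed.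

Lemma expect_const l c : expect p l (fun _ _ => c) = c.
Proof.
  induction l as [|y l IH]; cbn [expect]; [easy|].
  transitivity (expect p l (fun _ _ => c)); [|exact IH].
  apply expect_ext. intros. unfold mean1, weight. lra.
Qed.

Lemma expect_lsum {T} l (k : list T) g :
  expect p l (fun a r => lsum k (fun i => g i a r)) = lsum k (fun i => expect p l (g i)).
Proof.
  induction k as [|i k IH]; cbn [lsum fold_right].
  - apply expect_const.
  - rewrite (expect_plus l (g i)). f_equal. exact IH.
Qed.

Lemma upd_same h y v : upd h y v y = v.
Proof. unfold upd. now rewrite Z.eqb_refl. Qed.

Lemma upd_other h y v z : z <> y -> upd h y v z = h z.
Proof. unfold upd. now destruct (Z.eqb_spec z y). Qed.

Lemma expect_indep y l g h :
  (forall a r v w, h (upd a y v) (upd r y w) = h a r) ->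
  expect p (y :: l) (fun a r => g (a y) (r y) * h a r) = mean1 p y g * expect p l h.
Proof.
  intros H. cbn [expect]. rewrite <- expect_scal. apply expect_ext. intros a r.
  unfold mean1. rewrite !H, !upd_same. lra.
Qed.

(** * Covering events by cylinders *)

Fixpoint configs (l : list Z) : list config :=
  match l with
  | [] => [(fun _ => false, fun _ => false)]
  | y :: l' => flat_map (fun '(a, r) =>
      [(upd a y true, upd r y true); (upd a y true, upd r y false);
       (upd a y false, upd r y true); (upd a y false, upd r y false)]) (configs l')
  end.

Fixpoint config_prob (l : list Z) (c : config) : R :=
  match l with
  | [] => 1
  | y :: l' => site_prob p (fst c) (snd c) y * config_prob l' c
  end.

Lemma config_prob_nonneg l c : 0 <= config_prob l c.
Proof.
  induction l as [|y l IH]; simpl; [lra|]. apply Rmult_le_pos; [|easy].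
  apply (weight_nonneg y).
Qed.

Lemma config_prob_upd l y a r v w : ~ In y l ->
  config_prob l (upd a y v, upd r y w) = config_prob l (a, r).
Proof.
  induction l as [|x l IH]; intros Hy; [easy|].
  cbn [config_prob In fst snd] in *. rewrite IH by tauto. unfold site_prob. rewrite upd_other by (intro; subst; tauto). easy.
Qed.

(** The bridge from moment bounds to null sets: an expectation becomes a sum over configurations of
    the window, each of which is a cylinder. Distinctness of the sites ensures that no later update
    overwrites an earlier one. *)
Lemma expect_configs l g : NoDup l ->
  expect p l g = lsum (configs l) (fun c => config_prob l c * g (fst c) (snd c)).
Proof.
  revert g. induction l as [|y l IH]; intros g Hd; [cbn; lra|].
  inversion_clear Hd as [|? ? Hy Hl]. cbn [expect configs]. rewrite IH by easy.
  clear IH. induction (configs l) as [|[a r] k IHk]; [easy|].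
  cbn [flat_map]. rewrite lsum_app, <- IHk, lsum_cons.
  match goal with |- _ + ?t = _ => generalize t; intros t0 end.
  cbn [lsum fold_right fst snd config_prob app].
  rewrite !config_prob_upd by easy. unfold mean1, site_prob, weight. cbn [fst snd]. rewrite !upd_same. lra.
Qed.

Lemma configs_cover l lam rho :
  exists a r, In (a, r) (configs l) /\ forall y, In y l -> a y = lam y /\ r y = rho y.
Proof.
  induction l as [|y l [a [r [Hin H]]]].
  - exists (fun _ => false), (fun _ => false). simpl. tauto.
  - exists (upd a y (lam y)), (upd r y (rho y)). split.
    + cbn [configs]. apply in_flat_map. exists (a, r). split; [easy|].
      destruct (lam y), (rho y); simpl; tauto.
    + intros z [<-|Hz]; [now rewrite !upd_same|].
      unfold upd. destruct (Z.eqb_spec z y) as [->|_]; auto.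
Qed.

Lemma config_prob_perm l l' c : Permutation l l' -> config_prob l c = config_prob l' c.
Proof.
  induction 1; cbn [config_prob]; [easy|now f_equal|ring|congruence].
Qed.

Fixpoint window_list (N k : nat) : list Z :=
  match k with
  | O => [(- Z.of_nat N)%Z]
  | S j => (- Z.of_nat N + Z.of_nat (S j))%Z :: window_list N j
  end.

Lemma window_prod_list a r N k : window_prod p a r N k = config_prob (window_list N k) (a, r).
Proof.
  induction k as [|k IH]; cbn [window_prod window_list]; [cbn; lra|].
  rewrite IH. cbn [config_prob fst snd]. lra.
Qed.

Lemma in_window_list N k y :
  In y (window_list N k) <-> (- Z.of_nat N <= y <= - Z.of_nat N + Z.of_nat k)%Z.
Proof.
  induction k as [|k IH]; cbn [window_list In]; [lia|]. rewrite IH. lia.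
Qed.

Lemma nodup_window_list N k : NoDup (window_list N k).
Proof.
  induction k as [|k IH]; cbn [window_list].
  - repeat constructor; simpl; tauto.
  - constructor; [|easy]. rewrite in_window_list. lia.
Qed.

Lemma cyl_prob_zl N a r : cyl_prob p (N, a, r) = config_prob (zl N) (a, r).
Proof.
  unfold cyl_prob. rewrite window_prod_list. apply config_prob_perm.
  apply NoDup_Permutation; [apply nodup_window_list|apply nodup_zl|].
  intros y. rewrite in_window_list, in_zl. lia.
Qed.

Lemma cyl_prob_small N a r : cyl_prob p (N, a, r) <= (1/2)^N.
Proof.
  rewrite cyl_prob_zl. apply Rle_trans with ((1/2)^(length (zl N))).
  - induction (zl N) as [|y l IH]; cbn [config_prob length pow]; [lra|].
    apply Rmult_le_compat; [apply (weight_nonneg y)|apply config_prob_nonneg| |exact IH].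
    unfold site_prob. cbn. specialize (Hp y). destruct (a y); lra.
  - rewrite length_zl. replace (2 * N + 1)%nat with (N + (N + 1))%nat by lia.
    rewrite pow_add. pose proof (pow_le (1/2) N ltac:(lra)).
    pose proof (pow_le_one (1/2) (N+1) ltac:(lra)). nra.
Qed.

Lemma cyl_prob_nonneg C : 0 <= cyl_prob p C.
Proof. destruct C as [[N a] r]. rewrite cyl_prob_zl. apply config_prob_nonneg. Qed.

(** The blocks are concatenated and read off one entry at a time. As no block is empty, the first
    [n + 1] blocks have more than [n] entries, so position [n] is already determined and the default
    [c0] is never read. Partial sums are dominated by sums over whole blocks. *)
Lemma enumerate_blocks {T} (L : nat -> list T) (w : T -> R) (d : R) (c0 : T) :
  (forall c, 0 <= w c) -> (forall k, L k <> []) ->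
  (forall n, sum_f_R0 (fun k => lsum (L k) w) n <= d) ->
  exists cyl : nat -> T,
    (forall k c, In c (L k) -> exists n, cyl n = c) /\
    (forall n, sum_f_R0 (fun k => w (cyl k)) n <= d).
Proof.
  intros Hw HL Hd.
  set (cat := fun n => concat (map L (seq 0 n))).
  assert (Hcat : forall n, cat (S n) = cat n ++ L n).
  { intros n. unfold cat. rewrite seq_S, map_app, concat_app. cbn. now rewrite app_nil_r. }
  assert (Hlen : forall n, (n <= length (cat n))%nat).
  { induction n as [|n IH]; [lia|]. rewrite Hcat, length_app.
    specialize (HL n). destruct (L n); [easy|]. cbn. lia. }
  assert (Hpre : forall n m, (n <= m)%nat -> exists t, cat m = cat n ++ t).
  { induction 1 as [|m Hm [t IH]]; [exists []; now rewrite app_nil_r|].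
    exists (t ++ L m). now rewrite Hcat, IH, app_assoc. }
  set (cyl := fun n => nth n (cat (S n)) c0).
  assert (Hcyl : forall n i, (i < length (cat n))%nat -> cyl i = nth i (cat n) c0).
  { intros n i Hi. unfold cyl. specialize (Hlen (S i)).
    destruct (Nat.le_ge_cases (S i) n) as [Hc|Hc]; destruct (Hpre _ _ Hc) as [t Ht];
      rewrite Ht, app_nth1; auto. }
  exists cyl. split.
  - intros k c Hc.
    assert (Hin : In c (cat (S k))) by (rewrite Hcat; apply in_or_app; auto).
    destruct (In_nth _ _ c0 Hin) as [i [Hi Hn]]. exists i. now rewrite (Hcyl (S k)).
  - intros n. apply Rle_trans with (lsum (cat (S n)) w).
    + assert (forall m, (m < length (cat (S n)))%nat ->
        sum_f_R0 (fun k => w (cyl k)) m = lsum (firstn (S m) (cat (S n))) w).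
      { induction m as [|m IH]; intros Hm.
        - cbn [sum_f_R0]. rewrite (Hcyl (S n)) by easy.
          destruct (cat (S n)) as [|c l]; [cbn in Hm; lia|]. cbn. lra.
        - cbn [sum_f_R0]. rewrite IH by lia. rewrite (Hcyl (S n)) by easy.
          clear - Hm. revert Hm. generalize (S m) as j. intros j Hj.
          replace (firstn (S j) (cat (S n))) with (firstn j (cat (S n)) ++ [nth j (cat (S n)) c0]).
          + rewrite lsum_app. cbn. lra.
          + revert Hj. generalize (cat (S n)) as l. clear. intros l. revert j.
            induction l as [|x l IH]; intros j Hj; [cbn in Hj; lia|].
            destruct j as [|j]; [easy|]. cbn [length] in Hj.
            change (x :: (firstn j l ++ [nth j l c0]) = x :: firstn (S j) l).
            f_equal. apply IH. lia. }
      specialize (Hlen (S n)). rewrite H by lia.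
      rewrite <- (firstn_skipn (S n) (cat (S n))) at 2. rewrite lsum_app.
      pose proof (lsum_nonneg (skipn (S n) (cat (S n))) w ltac:(auto)). lra.
    + assert (E : forall m, lsum (cat (S m)) w = sum_f_R0 (fun k => lsum (L k) w) m).
      { induction m as [|m IH].
        - unfold cat. cbn. now rewrite app_nil_r.
        - rewrite Hcat, lsum_app, IH. easy. }
      rewrite E. apply Hd.
Qed.

Lemma lsum_filter {T} (l : list T) (P : T -> bool) g h :
  (forall c, In c l -> P c = true -> g c <= h c) -> (forall c, 0 <= h c) ->
  lsum (filter P l) g <= lsum l h.
Proof.
  intros H Hh. induction l as [|c l IH]; cbn [filter]; [cbn; lra|].
  assert (lsum (filter P l) g <= lsum l h) by (apply IH; intros; apply H; auto; now right).
  destruct (P c) eqn:E; cbn [lsum fold_right]; fold (lsum l h).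
  - fold (lsum (filter P l) g). specialize (H c (or_introl eq_refl) E). lra.
  - specialize (Hh c). lra.
Qed.

Lemma sum_tail_small (q : nat -> R) B :
  (forall k, 0 <= q k) -> (forall n, sum_f_R0 q n <= B) ->
  forall d, 0 < d -> exists k0, forall n, sum_f_R0 (fun k => q (k0 + k)%nat) n <= d.
Proof.
  intros Hq HB d Hd.
  assert (Hg : Un_growing (sum_f_R0 q)) by (intros n; cbn; specialize (Hq (S n)); lra).
  destruct (growing_cv _ Hg) as [l Hl].
  { exists B. intros x [n ->]. apply HB. }
  destruct (Hl d Hd) as [N HN]. exists (S N). intros n.
  assert (E : sum_f_R0 q (S N + n) = sum_f_R0 q N + sum_f_R0 (fun k => q (S N + k)%nat) n).
  { induction n as [|n IH].
    - rewrite Nat.add_0_r. cbn [sum_f_R0]. now rewrite Nat.add_0_r.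
    - replace (S N + S n)%nat with (S (S N + n)) by lia. cbn [sum_f_R0]. rewrite IH.
      replace (S N + S n)%nat with (S (S N + n)) by lia. lra. }
  pose proof (HN N (Nat.le_refl N)) as H1.
  pose proof (growing_ineq _ l Hg Hl (S N + n)) as H2.
  unfold Rdist in H1. apply Rabs_def2 in H1. lra.
Qed.

Lemma half_sum d n : 0 <= d -> sum_f_R0 (fun k => d * (1/2)^(S k)) n <= d.
Proof.
  intros Hd. assert (sum_f_R0 (fun k => d * (1/2)^(S k)) n = d * (1 - (1/2)^(S n))).
  { induction n as [|n IH]; [cbn; lra|]. cbn [sum_f_R0]. rewrite IH. cbn [pow]. lra. }
  rewrite H. pose proof (pow_le (1/2) (S n) ltac:(lra)). nra.
Qed.

(* Each block of cylinders gets a filler, so that it is nonempty and the blocks can be enumerated; a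
   filler is as unlikely as desired because of the fair coins [rho]. *)
Lemma borel_cantelli (E : nat -> (Z -> bool) -> (Z -> bool) -> Prop) (N : nat -> nat)
  (g : nat -> (Z -> bool) -> (Z -> bool) -> R) (q : nat -> R) (k1 : nat) (B : R)
  (P : (Z -> bool) -> (Z -> bool) -> Prop) :
  (forall k a r a' r', (forall y, In y (zl (N k)) -> a y = a' y /\ r y = r' y) ->
     E k a r -> E k a' r') ->
  (forall k a r, 0 <= g k a r) -> (forall k a r, E k a r -> 1 <= g k a r) ->
  (forall k, (k1 <= k)%nat -> expect p (zl (N k)) (g k) <= q k) ->
  (forall k, 0 <= q k) -> (forall n, sum_f_R0 q n <= B) ->
  (forall lam rho k0, (forall k, (k0 <= k)%nat -> ~ E k lam rho) -> P lam rho) ->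
  almost_surely p P.
Proof.
  intros Hmeas Hg0 Hg1 Hq Hq0 HB HP delta Hdelta.
  (* Half of [delta] pays for the tail of the events, the other half for the fillers. *)
  destruct (sum_tail_small q B Hq0 HB (delta / 2) ltac:(lra)) as [k2 Hk2].
  set (k0 := (k1 + k2)%nat).
  assert (Htail : forall n, sum_f_R0 (fun k => q (k0 + k)%nat) n <= delta / 2).
  { intros n. eapply Rle_trans; [|apply (Hk2 (k1 + n)%nat)].
    assert (Hsh : forall j m, sum_f_R0 (fun k => q (j + k2 + k)%nat) m
               <= sum_f_R0 (fun k => q (k2 + k)%nat) (j + m)).
    { induction j as [|j IH]; intros m; [apply sum_Rle; intros; cbn; lra|].
      eapply Rle_trans; [|replace (S j + m)%nat with (j + S m)%nat by lia; apply IH].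
      rewrite (decomp_sum _ (S m)) by lia. cbn [pred].
      specialize (Hq0 (j + k2 + 0)%nat).
      assert (sum_f_R0 (fun k => q (S j + k2 + k)%nat) m = sum_f_R0 (fun i => q (j + k2 + S i)%nat) m).
      { apply sum_eq. intros. f_equal. lia. }
      lra. }
    apply Hsh. }
  assert (Hfill : forall k, exists M, (1/2)^M <= delta / 2 * (1/2)^(S k)).
  { intros k. destruct (pow_lt_1_zero (1/2) ltac:(rewrite Rabs_pos_eq; lra)
      (delta / 2 * (1/2)^(S k))) as [M HM].
    - apply Rmult_lt_0_compat; [lra|]. apply pow_lt; lra.
    - exists M. specialize (HM M (Nat.le_refl M)). rewrite Rabs_pos_eq in HM; [lra|].
      apply pow_le; lra. }
  set (fil := fun k => proj1_sig (constructive_indefinite_description _ (Hfill k))).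
  assert (Hfil : forall k, (1/2)^(fil k) <= delta / 2 * (1/2)^(S k)).
  { intros k. unfold fil. destruct constructive_indefinite_description as [M HM]. exact HM. }
  set (dec := fun k (c : config) =>
    if excluded_middle_informative (E k (fst c) (snd c)) then true else false).
  set (mk := fun M (c : config) => ((M, fst c, snd c) : cylinder)).
  set (c0 := ((fun _ => false, fun _ => false) : config)).
  set (L := fun k => mk (fil k) c0 ::
     map (mk (N (k0 + k)%nat)) (filter (dec (k0 + k)%nat) (configs (zl (N (k0 + k)%nat))))).
  destruct (enumerate_blocks L (cyl_prob p) delta (mk 0%nat c0)) as [cyl [Hc1 Hc2]].
  - apply cyl_prob_nonneg.
  - easy.
  - intros n.
    apply Rle_trans with (sum_f_R0 (fun k => delta / 2 * (1/2)^(S k) + q (k0 + k)%nat) n).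
    + apply sum_Rle. intros k _. unfold L. cbn [lsum fold_right].
      apply Rplus_le_compat.
      * eapply Rle_trans; [apply cyl_prob_small|apply Hfil].
      * match goal with |- fold_right _ _ ?l <= _ => fold (lsum l (cyl_prob p)) end.
        rewrite lsum_map.
        eapply Rle_trans; [|apply Hq; unfold k0; lia].
        rewrite expect_configs by apply nodup_zl.
        (* Markov's inequality: on a selected configuration [g] is at least 1, so its probability is
           at most its contribution to the expectation of [g]. *)
        apply lsum_filter.
        -- intros [a r] _ Hd. unfold mk. cbn [fst snd]. rewrite cyl_prob_zl.
           unfold dec in Hd. cbn [fst snd] in Hd.
           destruct excluded_middle_informative as [HE|]; [|easy].
           specialize (Hg1 _ _ _ HE). pose proof (config_prob_nonneg (zl (N (k0 + k)%nat)) (a, r)).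
           nra.
        -- intros c. apply Rmult_le_pos; [apply config_prob_nonneg|apply Hg0].
    + rewrite sum_plus. pose proof (half_sum (delta / 2) n ltac:(lra)).
      specialize (Htail n). lra.
  - exists cyl. split; [|exact Hc2].
    intros lam rho Hn.
    assert (Hex : exists k, (k0 <= k)%nat /\ E k lam rho).
    { apply NNPP. intros Hne. apply Hn, (HP _ _ k0). intros k Hk HE. apply Hne. now exists k. }
    destruct Hex as [k [Hk HE]].
    destruct (configs_cover (zl (N k)) lam rho) as [a [r [Hin Hag]]].
    destruct (Hc1 (k - k0)%nat (mk (N k) (a, r))) as [n Hcn].
    { unfold L. replace (k0 + (k - k0))%nat with k by lia. right.
      apply in_map, filter_In. split; [easy|]. unfold dec.
      destruct excluded_middle_informative as [|HnE]; [easy|]. exfalso. apply HnE. cbn.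
      apply (Hmeas k lam rho); [|easy]. intros y Hy. destruct (Hag y Hy); auto. }
    exists n. rewrite Hcn. unfold mk, in_cyl. cbn [fst snd].
    intros y Hy. destruct (Hag y); [now apply in_zl|]. auto.
Qed.
End Law.

(** * Geometric sums, marginals and the flip probabilities on dyadic blocks *)

Lemma geom_bound A b n : 0 <= A -> 0 <= b < 1 -> sum_f_R0 (fun k => A * b ^ k) n <= A / (1 - b).
Proof.
  intros HA Hb.
  assert (E : sum_f_R0 (fun i => b ^ i) n = (1 - b ^ S n) / (1 - b)) by (apply tech3; lra).
  replace (sum_f_R0 (fun k => A * b ^ k) n) with (A * sum_f_R0 (fun i => b ^ i) n)
    by (rewrite scal_sum; apply sum_eq; intros; ring).
  rewrite E. unfold Rdiv. rewrite <- Rmult_assoc. apply Rmult_le_compat_r.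
  - left. apply Rinv_0_lt_compat. lra.
  - pose proof (pow_le b (S n) ltac:(lra)). nra.
Qed.

Lemma marginal p l y g : (forall y, 0 <= p y <= 1) -> NoDup l -> In y l ->
  expect p l (fun a r => g (a y) (r y)) = mean1 p y g.
Proof.
  intros Hp Hd Hy. induction l as [|z l IH]; [easy|].
  inversion_clear Hd as [|? ? Hz Hl].
  destruct (Z.eq_dec z y) as [->|Hzy].
  - rewrite <- (Rmult_1_r (mean1 p y g)), <- (expect_const p Hp l 1).
    rewrite <- (expect_indep p Hp y l g (fun _ _ => 1)) by easy.
    apply expect_ext; [easy|]. intros; lra.
  - destruct Hy as [|Hy]; [easy|]. rewrite <- IH by easy. cbn [expect].
    apply expect_ext; [easy|]. intros a r. unfold mean1.
    rewrite !upd_other by congruence. unfold weight. lra.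
Qed.

Lemma dyadic_decay beta k z : 2 ^ k <= z <= 2 ^ S k ->
  Rpower 2 (- Rabs beta) * (Rpower 2 (- beta)) ^ k <= Rpower z (- beta)
  <= Rpower 2 (Rabs beta) * (Rpower 2 (- beta)) ^ k.
Proof.
  intros [H1 H2].
  assert (H0 : 0 < 2 ^ k) by (apply pow_lt; lra).
  assert (Hk : INR k * ln 2 <= ln z).
  { rewrite <- ln_pow by lra. destruct H1 as [H1|H1]; [left; now apply ln_increasing|rewrite H1; lra]. }
  assert (HSk : ln z <= INR k * ln 2 + ln 2).
  { replace (INR k * ln 2 + ln 2) with (INR (S k) * ln 2) by (rewrite S_INR; lra).
    rewrite <- ln_pow by lra. destruct H2 as [H2|H2]; [left; apply ln_increasing; lra|rewrite H2; lra]. }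
  rewrite <- Rpower_pow by (unfold Rpower; apply exp_pos).
  rewrite Rpower_mult. rewrite <- !Rpower_plus. unfold Rpower.
  assert (Hd : 0 <= ln z - INR k * ln 2 <= ln 2) by lra.
  set (w := ln z - INR k * ln 2) in *.
  replace (ln z) with (INR k * ln 2 + w) by (unfold w; lra).
  assert (Hb : - (Rabs beta * ln 2) <= - beta * w <= Rabs beta * ln 2).
  { assert (Rabs (- beta * w) <= Rabs beta * ln 2).
    { rewrite Rabs_mult, Rabs_Ropp, (Rabs_pos_eq w) by lra.
      apply Rmult_le_compat_l; [apply Rabs_pos|lra]. }
    pose proof (Rle_abs (- beta * w)) as H1a. pose proof (Rle_abs (- (- beta * w))) as H2a. rewrite Rabs_Ropp in H2a. lra. }
  assert (He : forall x y, x <= y -> exp x <= exp y).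
  { intros x y [H|H]; [left; now apply exp_increasing|rewrite H; lra]. }
  split; apply He; lra.
Qed.

Lemma decay_dyadic_bounds p c beta Y0 : 0 < c ->
  (forall y : Z, (Y0 <= Z.abs y)%Z -> p y = c * Rpower (IZR (Z.abs y)) (- beta)) ->
  forall k y, (Z.to_nat Y0 <= k)%nat -> (2 ^ Z.of_nat k <= Z.abs y <= 2 ^ Z.of_nat (S k))%Z ->
    c * Rpower 2 (- Rabs beta) * (Rpower 2 (- beta)) ^ k <= p y
    <= c * Rpower 2 (Rabs beta) * (Rpower 2 (- beta)) ^ k.
Proof.
  intros Hc Hd k y Hk Hy.
  (* Since [2^k >= k], the condition [k >= Y0] puts the whole block where the decay law applies. *)
  assert (Hk2 : (Z.of_nat k <= 2 ^ Z.of_nat k)%Z) by (apply Z.lt_le_incl, Z.pow_gt_lin_r; lia).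
  rewrite Hd by lia.
  assert (H : 2 ^ k <= IZR (Z.abs y) <= 2 ^ S k).
  { split; rewrite pow_IZR; apply IZR_le; lia. }
  pose proof (dyadic_decay beta k _ H) as [E1 E2].
  rewrite !Rmult_assoc. split; apply Rmult_le_compat_l; lra.
Qed.

(** * Recurrence for [beta > 1] *)

Section Periodic.
Variables (Q : nat) (f : Z -> Z).
Hypothesis HQ2 : (2 <= Q)%nat.
Hypothesis Hf : forall y, f y = 1%Z \/ f y = (-1)%Z.
Hypothesis Hper : forall y, f (y + Z.of_nat Q)%Z = f y.
Hypothesis Hsum : Zsum_1_to f Q = 0%Z.

(** A bounded primitive of [f]: since a period sums to zero, the partial sums depend only on the
    residue of [y]. *)
Definition per_prim (y : Z) : R := IZR (Zsum_1_to f (Z.to_nat (y mod Z.of_nat Q))).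

Lemma periodic_mod y : f (y mod Z.of_nat Q)%Z = f y.
Proof.
  assert (Hk : forall (n : nat) z, f (z + Z.of_nat n * Z.of_nat Q)%Z = f z).
  { induction n as [|n IH]; intros z; [f_equal; lia|].
    rewrite <- (IH z), <- (Hper (z + Z.of_nat n * Z.of_nat Q)). f_equal. lia. }
  pose proof (Z.div_mod y (Z.of_nat Q) ltac:(lia)) as E.
  destruct (Z.le_ge_cases 0 (y / Z.of_nat Q)) as [H|H].
  - rewrite <- (Hk (Z.to_nat (y / Z.of_nat Q)) (y mod Z.of_nat Q)%Z). f_equal.
    rewrite Z2Nat.id by lia. lia.
  - rewrite <- (Hk (Z.to_nat (- (y / Z.of_nat Q))) y). f_equal.
    rewrite Z2Nat.id by lia. lia.
Qed.

Lemma per_prim_diff y : per_prim y - per_prim (y - 1)%Z = IZR (f y).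
Proof.
  unfold per_prim. rewrite <- minus_IZR. f_equal. rewrite <- (periodic_mod y).
  pose proof (Z.mod_pos_bound y (Z.of_nat Q) ltac:(lia)) as B1.
  destruct (Z.eq_dec (y mod Z.of_nat Q) 0) as [H0|H0].
  (* At a multiple of [Q] the primitive returns to 0 from the sum up to [Q - 1]; the zero sum over a
     period makes this jump equal to [f Q = f 0]. *)
  - assert (E : ((y - 1) mod Z.of_nat Q = Z.of_nat Q - 1)%Z).
    { symmetry. apply Z.mod_unique with (q := (y / Z.of_nat Q - 1)%Z); [lia|].
      pose proof (Z.div_mod y (Z.of_nat Q) ltac:(lia)). lia. }
    rewrite E, H0. replace (Z.to_nat (Z.of_nat Q - 1)) with (Q - 1)%nat by lia.
    replace Q with (S (Q - 1)) in Hsum by lia. cbn [Zsum_1_to] in Hsum.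
    replace (Z.of_nat (S (Q - 1))) with (0 + Z.of_nat Q)%Z in Hsum by lia.
    rewrite Hper in Hsum. cbn [Z.to_nat Zsum_1_to]. lia.
  - assert (E : ((y - 1) mod Z.of_nat Q = y mod Z.of_nat Q - 1)%Z).
    { symmetry. apply Z.mod_unique with (q := (y / Z.of_nat Q)%Z); [lia|].
      pose proof (Z.div_mod y (Z.of_nat Q) ltac:(lia)). lia. }
    rewrite E. set (m := (y mod Z.of_nat Q)%Z) in *.
    replace (Z.to_nat m) with (S (Z.to_nat (m - 1))) by lia. cbn [Zsum_1_to].
    replace (Z.of_nat (S (Z.to_nat (m - 1)))) with m by lia. lia.
Qed.

Lemma per_prim_bound y : Rabs (per_prim y) <= INR Q.
Proof.
  unfold per_prim. pose proof (Z.mod_pos_bound y (Z.of_nat Q) ltac:(lia)) as B1.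
  assert (H : forall n, (Z.abs (Zsum_1_to f n) <= Z.of_nat n)%Z).
  { induction n as [|n IH]; cbn [Zsum_1_to]; [lia|]. destruct (Hf (Z.of_nat (S n))); lia. }
  rewrite <- abs_IZR, INR_IZR_INZ. apply IZR_le.
  specialize (H (Z.to_nat (y mod Z.of_nat Q))). lia.
Qed.

Lemma env_eps_pm lam rho y : env_eps f lam rho y = 1%Z \/ env_eps f lam rho y = (-1)%Z.
Proof. unfold env_eps. destruct (lam y); [|apply Hf]. destruct (rho y); cbn; auto. Qed.

(** The randomised lines change [f] by a finitely supported [d], whose partial sums [G] are bounded
    by the sum of [|d|]. Adding [G] to the periodic primitive gives a bounded stream function. *)
Lemma recurrent_of_finite_perturbation lam rho (K : nat) :
  (forall y, (Z.of_nat K < Z.abs y)%Z -> lam y = false) -> recurrent (env_eps f lam rho).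
Proof.
  intros HK. set (eps := env_eps f lam rho).
  set (d := fun y => IZR (eps y) - IZR (f y)).
  set (G := fun y => zs K (fun x => d x * (if Z.leb x y then 1 else 0))).
  apply recurrent_of_bounded_stream with (Phi := fun y => per_prim y + G y)
    (C := INR Q + zs K (fun x => Rabs (d x))).
  - intros y. apply env_eps_pm.
  - intros y.
    assert (E : G y - G (y - 1)%Z = d y).
    { unfold G, zs. rewrite <- lsum_minus.
      transitivity (lsum (zl K) (fun x => if Z.eqb x y then d x else 0)).
      - apply lsum_ext. intros x _.
        destruct (Z.eqb_spec x y), (Z.leb_spec x y), (Z.leb_spec x (y - 1)); try lia; cbv iota; lra.
      - destruct (Z.le_gt_cases (Z.abs y) (Z.of_nat K)) as [Hy|Hy].
        + apply zs_pick. lia.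
        + unfold d, eps, env_eps. rewrite (HK y Hy). rewrite Rminus_diag.
          transitivity (lsum (zl K) (fun _ => 0)); [|apply lsum_zero].
          apply lsum_ext. intros x Hx. apply in_zl in Hx. destruct (Z.eqb_spec x y); [lia|easy]. }
    pose proof (per_prim_diff y). unfold d in E. lra.
  - intros y. eapply Rle_trans; [apply Rabs_triang|].
    apply Rplus_le_compat; [apply per_prim_bound|].
    eapply Rle_trans; [apply lsum_abs|]. apply lsum_le. intros x _.
    rewrite Rabs_mult. destruct (Z.leb x y); [rewrite Rabs_R1|rewrite Rabs_R0];
      pose proof (Rabs_pos (d x)); lra.
Qed.

Lemma pow2_Z_nat k : Z.of_nat (2 ^ k) = (2 ^ Z.of_nat k)%Z.
Proof. rewrite Nat2Z.inj_pow. easy. Qed.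

Lemma recurrence_part (p : Z -> R) (c beta : R) :
  (forall y, 0 <= p y <= 1) -> 0 < c ->
  (exists Y0 : Z, forall y : Z, (Y0 <= Z.abs y)%Z -> p y = c * Rpower (IZR (Z.abs y)) (- beta)) ->
  1 < beta -> almost_surely p (fun lam rho => recurrent (env_eps f lam rho)).
Proof.
  intros Hp Hc [Y0 Hd] Hbeta.
  pose proof (decay_dyadic_bounds p c beta Y0 Hc Hd) as Hk1.
  set (b := 2 * Rpower 2 (- beta)).
  assert (Hr0 : 0 < Rpower 2 (- beta)) by apply exp_pos.
  assert (Hb : 0 <= b < 1).
  { split; [unfold b; lra|]. unfold b.
    replace (2 * Rpower 2 (- beta)) with (Rpower 2 (1 - beta)).
    - apply Rlt_le_trans with (Rpower 2 0); [apply Rpower_lt; lra|]. rewrite Rpower_O; lra.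
    - unfold Rminus. rewrite Rpower_plus, Rpower_1; lra. }
  (* The window of radius [2^(k+1)] has [4 * 2^k + 1 <= 5 * 2^k] sites, and each site of block [k]
     has [lam = true] with probability at most a constant times [2^(- beta k)]. So the expected
     number of such sites in the block is at most [A * b^k]. *)
  set (A := 5 * (c * Rpower 2 (Rabs beta))).
  assert (HA : 0 < A).
  { unfold A. assert (0 < Rpower 2 (Rabs beta)) by apply exp_pos. nra. }
  set (blk := fun k y => (Z.leb (2 ^ Z.of_nat k) (Z.abs y))).
  apply borel_cantelli with
    (E := fun k lam _ => exists y, (2 ^ Z.of_nat k <= Z.abs y <= 2 ^ Z.of_nat (S k))%Z /\ lam y = true)
    (N := fun k => (2 ^ S k)%nat)
    (g := fun k a _ => lsum (zl (2 ^ S k)) (fun y => if (blk k y && a y)%bool then 1 else 0))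
    (q := fun k => A * b ^ k) (k1 := Z.to_nat Y0) (B := A / (1 - b)).
  - easy.
  - intros k a r a' r' Hag [y [Hy Hl]]. exists y. split; [easy|].
    rewrite <- Hl. symmetry. apply Hag. apply in_zl. rewrite pow2_Z_nat. lia.
  - intros k a r. apply lsum_nonneg. intros y _. destruct (_ && _)%bool; lra.
  - intros k a r [y [Hy Hl]].
    apply Rle_trans with (if (blk k y && a y)%bool then 1 else 0).
    + unfold blk. rewrite Hl. destruct (Z.leb_spec (2 ^ Z.of_nat k) (Z.abs y)); cbn; [lra|lia].
    + apply (lsum_in _ (fun y => if (blk k y && a y)%bool then 1 else 0)).
      * intros z _. destruct (_ && _)%bool; lra.
      * apply in_zl. rewrite pow2_Z_nat. lia.
  - intros k Hk. rewrite expect_lsum by easy.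
    apply Rle_trans with (lsum (zl (2 ^ S k)) (fun _ => c * Rpower 2 (Rabs beta) * Rpower 2 (- beta) ^ k)).
    + apply lsum_le. intros y Hy.
      rewrite (marginal p _ y (fun v _ => if (blk k y && v)%bool then 1 else 0)) by (easy || apply nodup_zl).
      unfold mean1, weight, blk. apply in_zl in Hy. rewrite pow2_Z_nat in Hy.
      destruct (Z.leb_spec (2 ^ Z.of_nat k) (Z.abs y)) as [Hly|Hly]; cbn [andb].
      * pose proof (Hk1 k y Hk ltac:(lia)). lra.
      * assert (0 < c * Rpower 2 (Rabs beta) * Rpower 2 (- beta) ^ k); [|lra].
        apply Rmult_lt_0_compat; [apply Rmult_lt_0_compat; [easy|apply exp_pos]|].
        apply pow_lt, exp_pos.
    + rewrite lsum_const, length_zl. unfold A, b. rewrite Rpow_mult_distr.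
      rewrite plus_INR, mult_INR, pow_INR. cbn [pow]. change (INR 2) with 2. change (INR 1) with 1.
      assert (H1 : 1 <= 2 ^ k) by (apply pow_R1_Rle; lra).
      assert (H2 : 0 < Rpower 2 (- beta) ^ k) by (apply pow_lt, exp_pos).
      assert (H3 : 0 < c * Rpower 2 (Rabs beta)) by (apply Rmult_lt_0_compat; [easy|apply exp_pos]).
      set (t := 2 ^ k) in *. set (r := Rpower 2 (- beta) ^ k) in *. set (w := c * Rpower 2 (Rabs beta)) in *.
      assert (0 < w * r) by (apply Rmult_lt_0_compat; lra). nra.
  - intros k. apply Rmult_le_pos; [lra|]. apply pow_le; lra.
  - intros n. apply geom_bound; lra.
  - intros lam rho k0 Hk0. apply recurrent_of_finite_perturbation with (K := (2 ^ k0)%nat).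
    intros y Hy. rewrite pow2_Z_nat in Hy.
    destruct (lam y) eqn:E; [|easy]. exfalso.
    set (k := Z.log2 (Z.abs y)).
    assert (Hkk : (2 ^ k <= Z.abs y < 2 ^ Z.succ k)%Z) by (apply Z.log2_spec; lia).
    assert (Hk : (Z.of_nat k0 <= k)%Z) by (apply Z.log2_le_pow2; lia).
    apply (Hk0 (Z.to_nat k)); [lia|]. exists y. rewrite Nat2Z.inj_succ, Z2Nat.id by lia.
    split; [lia|easy].
Qed.
End Periodic.

(** * A Fourier mode of the walk *)

(** Inserting an indicator and swapping the two sums compares sums over lists that carry the same
    sites in different orders, so that windows [zl] and intervals [zr] can be mixed. *)
Lemma lsum_pick_decomp (l k : list Z) g : NoDup k -> incl l k ->
  lsum k (fun y => lsum l (fun z => if Z.eqb y z then g y else 0)) = lsum l g.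
Proof.
  intros Hk Hi. rewrite lsum_swap. apply lsum_ext. intros z Hz. apply lsum_pick; auto.
Qed.

Lemma lsum_pick_sym (l : list Z) y (v : R) : NoDup l ->
  lsum l (fun z => if Z.eqb y z then v else 0) = if in_dec Z.eq_dec y l then v else 0.
Proof.
  intros Hl. destruct in_dec as [Hy|Hy].
  - transitivity (lsum l (fun z => if Z.eqb z y then v else 0)).
    + apply lsum_ext. intros z _. now rewrite Z.eqb_sym.
    + apply (lsum_pick l y (fun _ => v) Hl Hy).
  - transitivity (lsum l (fun _ => 0)); [|apply lsum_zero]. apply lsum_ext. intros z Hz.
    destruct (Z.eqb_spec y z); [congruence|easy].
Qed.

Lemma lsum_restrict (l k : list Z) g : NoDup l -> NoDup k -> incl l k ->
  (forall y, In y k -> ~ In y l -> g y = 0) -> lsum k g = lsum l g.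
Proof.
  intros Hl Hk Hi H0. rewrite <- (lsum_pick_decomp l k g Hk Hi). apply lsum_ext.
  intros y Hy. rewrite lsum_pick_sym by easy. destruct in_dec; auto.
Qed.

Lemma lsum_incl (l k : list Z) g : NoDup l -> NoDup k -> incl l k ->
  (forall y, 0 <= g y) -> lsum l g <= lsum k g.
Proof.
  intros Hl Hk Hi H0. rewrite <- (lsum_pick_decomp l k g Hk Hi). apply lsum_le.
  intros y Hy. rewrite lsum_pick_sym by easy. specialize (H0 y). destruct in_dec; lra.
Qed.

Definition zr (a : Z) (n : nat) : list Z := map (fun i => (a + Z.of_nat i)%Z) (seq 0 n).

Lemma zr_S a n : zr a (S n) = zr a n ++ [(a + Z.of_nat n)%Z].
Proof. unfold zr. now rewrite seq_S, map_app. Qed.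

Lemma in_zr a n y : In y (zr a n) <-> (a <= y < a + Z.of_nat n)%Z.
Proof.
  induction n as [|n IH]; [simpl; lia|].
  rewrite zr_S, in_app_iff, IH. simpl In. lia.
Qed.

Lemma nodup_zr a n : NoDup (zr a n).
Proof.
  apply FinFun.Injective_map_NoDup; [|apply seq_NoDup]. intros i j H. lia.
Qed.

Lemma length_zr a n : length (zr a n) = n.
Proof. unfold zr. now rewrite length_map, length_seq. Qed.

Lemma zr_incl_zl a n L : (- Z.of_nat L <= a)%Z -> (a + Z.of_nat n <= Z.of_nat L + 1)%Z ->
  incl (zr a n) (zl L).
Proof. intros H1 H2 y Hy. apply in_zr in Hy. apply in_zl. lia. Qed.

Lemma zr_tele a n h :
  lsum (zr a n) (fun y => h (y + 1)%Z - h y) = h (a + Z.of_nat n)%Z - h a.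
Proof.
  induction n as [|n IH]; [cbn; rewrite Z.add_0_r; lra|].
  rewrite zr_S, lsum_app, IH. cbn [lsum fold_right].
  replace (a + Z.of_nat n + 1)%Z with (a + Z.of_nat (S n))%Z by lia. lra.
Qed.

Lemma zr_variation a n h y : (a <= y <= a + Z.of_nat n)%Z ->
  Rabs (h y - h a) <= lsum (zr a n) (fun z => Rabs (h (z + 1)%Z - h z)).
Proof.
  intros Hy. replace (h y) with (h (a + Z.of_nat (Z.to_nat (y - a)))%Z) by (f_equal; lia).
  rewrite <- zr_tele. eapply Rle_trans; [apply lsum_abs|].
  apply lsum_incl; try apply nodup_zr.
  - intros z Hz. apply in_zr in Hz. apply in_zr. lia.
  - intros; apply Rabs_pos.
Qed.

Lemma zs_tele0 L F G h : (forall y, F y = G y + (h (y + 1)%Z - h y)) ->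
  (forall y, (Z.of_nat L <= Z.abs y)%Z -> h y = 0) -> zs L F = zs L G.
Proof.
  intros HF Hh. unfold zs. rewrite (lsum_ext _ F _ (fun y _ => HF y)), lsum_plus.
  fold (zs L (fun y => h (y + 1)%Z - h y)). rewrite zs_tele, !Hh by lia. lra.
Qed.

Section Mode.

Variables (eps : Z -> Z) (cs sn s eta rho : R) (A B r1 r2 : Z -> R) (L : nat).
Hypothesis Hcs : cs <= 1.
Hypothesis Hs : 1/2 <= s < 1.
Hypothesis HA : forall y, (Z.of_nat L <= Z.abs y + 1)%Z -> A y = 0.
Hypothesis HB : forall y, (Z.of_nat L <= Z.abs y + 1)%Z -> B y = 0.
Hypothesis HeqA : forall y, A y - s / 3 * (A (y + 1)%Z + A (y - 1)%Z + cs * A y + IZR (eps y) * sn * B y)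
  = (if Z.eqb y 0 then 1 else 0) - r1 y.
Hypothesis HeqB : forall y, B y - s / 3 * (B (y + 1)%Z + B (y - 1)%Z + cs * B y - IZR (eps y) * sn * A y)
  = - r2 y.
Hypothesis Heta : 0 <= eta <= 1.
Hypothesis Hr : zs L (fun y => (r1 y)^2 + (r2 y)^2) <= 2 * (1 - s) * eta.

Let q : R := zs L (fun y => (A y)^2 + (B y)^2).
Let D : R := zs L (fun y => (A (y + 1)%Z - A y)^2 + (B (y + 1)%Z - B y)^2).
Let E : R := A 0%Z + eta.

(** In this section [A] and [B] stand for the real and imaginary parts of the truncated Green
    function at one frequency, and [r1], [r2] for its truncation remainder. Pairing the two
    equations with [A] and [B] cancels the terms with [eps], so the energy does not see the
    environment. Half of the killing term [(1 - s) * q] is spent on the remainder by Young's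
    inequality, which leaves [eta]. *)
Lemma mode_energy : (1 - s) / 2 * q + s / 3 * (D + (1 - cs) * q) <= E.
Proof.
  assert (E1 : zs L (fun y => A y * ((if Z.eqb y 0 then 1 else 0) - r1 y) + B y * (- r2 y))
    = (1 - s) * q + s / 3 * (D + (1 - cs) * q)).
  { transitivity (zs L (fun y => (1 - s) * ((A y)^2 + (B y)^2)
      + s / 3 * (((A (y + 1)%Z - A y)^2 + (B (y + 1)%Z - B y)^2) + (1 - cs) * ((A y)^2 + (B y)^2)))).
    - apply zs_tele0 with (h := fun y => s / 3 * (A y * A (y - 1)%Z - (A y)^2 + B y * B (y - 1)%Z - (B y)^2)).
      + intros y. rewrite <- HeqA, <- HeqB. replace (y + 1 - 1)%Z with y by lia. field.
      + intros y Hy. rewrite (HA y), (HB y) by lia. lra.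
    - unfold q, D, zs. now rewrite <- !lsum_scal, <- lsum_plus, <- !lsum_scal, <- lsum_plus. }
  assert (E2 : zs L (fun y => A y * ((if Z.eqb y 0 then 1 else 0) - r1 y) + B y * (- r2 y))
    <= A 0%Z + (1 - s) / 2 * q + / (2 * (1 - s)) * (2 * (1 - s) * eta)).
  { apply Rle_trans with (zs L (fun y => (if Z.eqb y 0 then A y else 0)
       + (1 - s) / 2 * ((A y)^2 + (B y)^2) + / (2 * (1 - s)) * ((r1 y)^2 + (r2 y)^2))).
    - apply lsum_le. intros y _.
      assert (Hyoung : forall a r, - (a * r) <= (1 - s) / 2 * a^2 + / (2 * (1 - s)) * r^2).
      { intros a r. assert (0 <= (1 - s) / 2 * (a + r / (1 - s))^2)
          by (apply Rmult_le_pos; [lra|apply pow2_ge_0]).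
        replace ((1 - s) / 2 * (a + r / (1 - s))^2)
          with ((1 - s) / 2 * a^2 + / (2 * (1 - s)) * r^2 + a * r) in H by (field; lra). lra. }
      pose proof (Hyoung (A y) (r1 y)). pose proof (Hyoung (B y) (r2 y)).
      destruct (Z.eqb y 0); lra.
    - set (F := fun y => (A y)^2 + (B y)^2). set (G := fun y => (r1 y)^2 + (r2 y)^2).
      assert (E3 : zs L (fun y => (if Z.eqb y 0 then A y else 0) + (1 - s) / 2 * F y + / (2 * (1 - s)) * G y)
        = A 0%Z + (1 - s) / 2 * q + / (2 * (1 - s)) * zs L G).
      { unfold zs. rewrite !lsum_plus, !lsum_scal. f_equal. f_equal. apply (zs_pick L 0 A). lia. }
      refine (Rle_trans _ _ _ (Req_le _ _ E3) _).
      apply Rplus_le_compat_l, Rmult_le_compat_l; [|easy].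
      left. apply Rinv_0_lt_compat. lra. }
  replace (/ (2 * (1 - s)) * (2 * (1 - s) * eta)) with eta in E2 by (field; lra).
  unfold E. lra.
Qed.

Lemma q_nonneg : 0 <= q.
Proof. apply lsum_nonneg. intros y _. pose proof (pow2_ge_0 (A y)). pose proof (pow2_ge_0 (B y)). lra. Qed.

Lemma D_nonneg : 0 <= D.
Proof.
  apply lsum_nonneg. intros y _. pose proof (pow2_ge_0 (A (y + 1)%Z - A y)).
  pose proof (pow2_ge_0 (B (y + 1)%Z - B y)). lra.
Qed.

Lemma mode_bounds : D <= 6 * E /\ (1 - s) * q <= 2 * E /\ (1 - cs) * q <= 6 * E /\ 0 <= E.
Proof.
  pose proof mode_energy as H. pose proof q_nonneg. pose proof D_nonneg.
  assert (0 <= (1 - s) * q) by (apply Rmult_le_pos; lra).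
  assert (0 <= (1 - cs) * q) by (apply Rmult_le_pos; lra).
  assert (1/6 * (D + (1 - cs) * q) <= s / 3 * (D + (1 - cs) * q)) by (apply Rmult_le_compat_r; lra).
  repeat split; lra.
Qed.

Lemma grad_sum a n (F : Z -> R) : (F = A \/ F = B) -> incl (zr a n) (zl L) ->
  (lsum (zr a n) (fun y => Rabs (F (y + 1)%Z - F y)))^2 <= INR n * (6 * E).
Proof.
  intros HF Hi. eapply Rle_trans; [apply cauchy_schwarz_one|]. rewrite length_zr.
  apply Rmult_le_compat_l; [apply pos_INR|].
  apply Rle_trans with D; [|apply mode_bounds].
  eapply Rle_trans; [apply lsum_incl; [apply nodup_zr|apply nodup_zl|exact Hi|intros; apply pow2_ge_0]|].
  apply lsum_le. intros y _. rewrite pow2_abs.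
  pose proof (pow2_ge_0 (A (y + 1)%Z - A y)). pose proof (pow2_ge_0 (B (y + 1)%Z - B y)).
  destruct HF as [-> | ->]; lra.
Qed.

Lemma value_sum a n (F : Z -> R) : (F = A \/ F = B) -> incl (zr a n) (zl L) ->
  (lsum (zr a n) (fun y => Rabs (F y)))^2 <= INR n * q.
Proof.
  intros HF Hi. eapply Rle_trans; [apply cauchy_schwarz_one|]. rewrite length_zr.
  apply Rmult_le_compat_l; [apply pos_INR|].
  eapply Rle_trans; [apply lsum_incl; [apply nodup_zr|apply nodup_zl|exact Hi|intros; apply pow2_ge_0]|].
  apply lsum_le. intros y _. rewrite pow2_abs.
  pose proof (pow2_ge_0 (A y)). pose proof (pow2_ge_0 (B y)).
  destruct HF as [-> | ->]; lra.
Qed.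

(** One-dimensional diffusive bound, applied at frequency 0. On [n] sites the size of [A] is
    controlled by [q] and its oscillation by [D]. Both are bounded through [E], which is at most
    [2 * A 0] once [A 0 > 1], so one factor [A 0] cancels. *)
Lemma mode_bound_small_freq n : (1 <= n <= L)%nat -> 1 - s = / (INR n)^2 -> A 0%Z <= 32 * INR n.
Proof.
  intros Hn Hsn.
  assert (Hn1 : 1 <= INR n) by (change 1 with (INR 1); apply le_INR; lia).
  destruct (Rle_dec (A 0%Z) 1) as [H1|H1]; [lra|].
  assert (Hi : incl (zr 0 n) (zl L)) by (apply zr_incl_zl; lia).
  pose proof (grad_sum 0 n A (or_introl eq_refl) Hi) as HV.
  pose proof (value_sum 0 n A (or_introl eq_refl) Hi) as HS.
  destruct mode_bounds as [_ [Hq [_ HE]]].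
  set (V := lsum (zr 0 n) (fun y => Rabs (A (y + 1)%Z - A y))) in *.
  set (S := lsum (zr 0 n) (fun y => Rabs (A y))) in *.
  assert (HS0 : 0 <= S) by (apply lsum_nonneg; intros; apply Rabs_pos).
  assert (HV0 : 0 <= V) by (apply lsum_nonneg; intros; apply Rabs_pos).
  assert (HSV : INR n * A 0%Z <= S + INR n * V).
  { rewrite <- (length_zr 0 n) at 1 2. rewrite <- !lsum_const. unfold S. rewrite <- lsum_plus.
    apply lsum_le. intros y Hy. apply in_zr in Hy.
    pose proof (zr_variation 0 n A y ltac:(lia)) as Hv. fold V in Hv.
    pose proof (Rle_abs (A y)). pose proof (Rle_abs (- (A y - A 0%Z))). rewrite Rabs_Ropp in *. lra. }
  assert (HqE : q <= 2 * E * (INR n)^2).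
  { rewrite Hsn in Hq. apply Rmult_le_reg_l with (/ (INR n)^2).
    - apply Rinv_0_lt_compat. nra.
    - replace (/ INR n ^ 2 * (2 * E * INR n ^ 2)) with (2 * E) by (field; lra). lra. }
  assert (HE2 : E <= 2 * A 0%Z) by (unfold E; lra).
  set (x := INR n) in *. set (a := A 0%Z) in *.
  assert ((x * a)^2 <= 2 * S^2 + 2 * x^2 * V^2).
  { assert ((x * a)^2 <= (S + x * V)^2) by (apply pow_incr; nra).
    pose proof (pow2_ge_0 (S - x * V)). nra. }
  assert (S^2 <= x * (2 * E * x^2)) by (eapply Rle_trans; [exact HS|]; apply Rmult_le_compat_l; lra).
  assert (x^2 * V^2 <= x^2 * (x * (6 * E))) by (apply Rmult_le_compat_l; [nra|lra]).
  assert (x^2 * a^2 <= x^2 * (32 * x * a)).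
  { assert (x^3 * E <= x^3 * (2 * a)) by (apply Rmult_le_compat_l; [apply pow_le; lra|lra]). nra. }
  assert (a^2 <= 32 * x * a) by (apply Rmult_le_reg_l with (x^2); nra).
  apply Rmult_le_reg_r with a; lra.
Qed.

Lemma mode_bound_large_freq kap : 0 < kap -> kap <= 1 - cs -> A 0%Z <= 1 + 12 / kap.
Proof.
  intros Hk Hkc. assert (0 < 12 / kap) by (apply Rdiv_lt_0_compat; lra).
  destruct (Rle_dec (A 0%Z) 1) as [H1|H1]; [lra|].
  destruct mode_bounds as [_ [_ [Hq HE]]].
  assert (HA2 : (A 0%Z)^2 <= q).
  { apply Rle_trans with ((A 0%Z)^2 + (B 0%Z)^2); [pose proof (pow2_ge_0 (B 0%Z)); lra|].
    apply (lsum_in (zl L) (fun y => (A y)^2 + (B y)^2)); [|apply in_zl; lia].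
    intros y _. pose proof (pow2_ge_0 (A y)). pose proof (pow2_ge_0 (B y)). lra. }
  assert (kap * (A 0%Z)^2 <= 12 * A 0%Z).
  { apply Rle_trans with ((1 - cs) * q); [apply Rmult_le_compat; nra|unfold E in Hq; lra]. }
  assert (A 0%Z <= 12 / kap); [|lra].
  apply Rmult_le_reg_l with kap; [easy|]. replace (kap * (12 / kap)) with 12 by (field; lra).
  apply Rmult_le_reg_r with (A 0%Z); lra.
Qed.

Lemma zs_block_abs (l : nat) g G : (2 * l <= L + 1)%nat ->
  (forall y, (y < Z.of_nat l \/ 2 * Z.of_nat l <= y)%Z -> g y = 0) ->
  (forall y, (Z.of_nat l <= y < 2 * Z.of_nat l)%Z -> Rabs (g y) <= G y) ->
  Rabs (zs L g) <= lsum (zr (Z.of_nat l) l) G.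
Proof.
  intros Hl H0 HG. unfold zs.
  rewrite (lsum_restrict (zr (Z.of_nat l) l) (zl L)).
  - eapply Rle_trans; [apply lsum_abs|]. apply lsum_le. intros y Hy. apply in_zr in Hy. apply HG. lia.
  - apply nodup_zr.
  - apply nodup_zl.
  - apply zr_incl_zl; lia.
  - intros y _ Hy. apply H0. rewrite in_zr in Hy. lia.
Qed.

(** The imaginary equation is tested against [b]; its environment term is [sn] times the sum of
    [eps * b * A]. Freezing [A] at its value at the origin turns this into a term of size at least
    [sn * W * A 0]. Every other term, including the error of freezing, has a square controlled by
    [E <= 2 * A 0]. Squaring and cancelling one factor [A 0] gives the bound. *)
Lemma mode_bound_block (l : nat) (b Phi : Z -> R) (M W : R) :
  (1 <= l)%nat -> (2 * l + 2 <= L)%nat ->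
  (forall y, 0 <= b y <= 1) ->
  (forall y, (y <= Z.of_nat l \/ 2 * Z.of_nat l <= y)%Z -> b y = 0) ->
  (forall y, Rabs (b (y + 1)%Z - b y) <= 2 / INR l) ->
  (forall y, (Z.of_nat l < y < 2 * Z.of_nat l)%Z -> Phi y - Phi (y - 1)%Z = IZR (eps y)) ->
  (forall y, (Z.of_nat l <= y < 2 * Z.of_nat l)%Z -> Rabs (Phi y) <= M) -> 0 <= M ->
  0 <= W -> W <= Rabs (zs L (fun y => b y * IZR (eps y))) ->
  1 - s <= / (INR l)^2 -> 1 - cs <= / (INR l)^2 -> 0 <= sn ->
  (forall y, Rabs (r2 y) <= rho) -> rho <= / (INR l)^2 -> 1 < A 0%Z ->
  sn^2 * W^2 * A 0%Z <= 10 * (138 / INR l + 108 * (sn^2 * M^2 * INR l)).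
Proof.
  intros Hl HlL Hb01 Hb0 Hbl HPhi HM HM0 HW0 HW Hs2 Hcs2 Hsn Hr2 Hrho HA1.
  assert (Hx : 1 <= INR l) by (change 1 with (INR 1); now apply le_INR).
  set (x := INR l) in *. set (a := A 0%Z) in *.
  set (blk := zr (Z.of_nat l) l).
  assert (Hib : incl blk (zl L)) by (apply zr_incl_zl; lia).
  set (X1 := lsum blk (fun y => Rabs (B y))).
  set (X2 := lsum blk (fun y => Rabs (B (y + 1)%Z - B y))).
  (* The oscillation is taken from 0 on because [A] is compared with its value at the origin, which
     lies outside the block. *)
  set (V := lsum (zr 0 (2 * l)) (fun y => Rabs (A (y + 1)%Z - A y))).
  destruct mode_bounds as [_ [Hq1 [Hq2 HE]]].
  assert (HX1 : X1^2 <= x * q) by (apply value_sum; auto).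
  assert (HX2 : X2^2 <= x * (6 * E)) by (apply grad_sum; auto).
  assert (HV : V^2 <= 2 * x * (6 * E)).
  { replace (2 * x) with (INR (2 * l)) by (rewrite mult_INR; reflexivity).
    apply grad_sum; [auto|apply zr_incl_zl; lia]. }
  assert (PX1 : 0 <= X1) by (apply lsum_nonneg; intros; apply Rabs_pos).
  assert (PX2 : 0 <= X2) by (apply lsum_nonneg; intros; apply Rabs_pos).
  assert (PV : 0 <= V) by (apply lsum_nonneg; intros; apply Rabs_pos).
  assert (HE2 : 1 <= E <= 2 * a) by (unfold E; fold a; lra).
  assert (Hosc : forall y, (0 <= y <= 2 * Z.of_nat l)%Z -> Rabs (A y - a) <= V)
    by (intros y Hy; apply zr_variation; lia).
  set (T := zs L (fun y => IZR (eps y) * (b y * A y))).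
  assert (Heq : - zs L (fun y => b y * r2 y) = (1 - s) * zs L (fun y => b y * B y)
     + s / 3 * (zs L (fun y => (b (y + 1)%Z - b y) * (B (y + 1)%Z - B y))
        + (1 - cs) * zs L (fun y => b y * B y) + sn * T)).
  { transitivity (zs L (fun y => b y * (- r2 y))).
    - unfold zs. rewrite <- (Rmult_1_l (lsum (zl L) (fun y => b y * r2 y))), Ropp_mult_distr_l, <- lsum_scal.
      apply lsum_ext. intros; lra.
    - transitivity (zs L (fun y => (1 - s) * (b y * B y) + s / 3 * ((b (y + 1)%Z - b y) * (B (y + 1)%Z - B y)
        + (1 - cs) * (b y * B y) + sn * (IZR (eps y) * (b y * A y))))).
      + apply zs_tele0 with (h := fun y => s / 3 * (b y * B (y - 1)%Z - b y * B y)).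
        * intros y. rewrite <- HeqB. replace (y + 1 - 1)%Z with y by lia. field.
        * intros y Hy. rewrite Hb0 by lia. lra.
      + unfold T, zs. now rewrite <- !lsum_scal, <- !lsum_plus, <- lsum_scal, <- lsum_plus. }
  assert (B1 : Rabs (zs L (fun y => b y * r2 y)) <= x * rho).
  { unfold x. rewrite <- (length_zr (Z.of_nat l) l), <- lsum_const. apply zs_block_abs; [lia| |].
    - intros y Hy. rewrite Hb0 by lia. lra.
    - intros y Hy. rewrite Rabs_mult. specialize (Hb01 y). rewrite (Rabs_pos_eq (b y)) by lra.
      specialize (Hr2 y). pose proof (Rabs_pos (r2 y)). nra. }
  assert (B2 : Rabs (zs L (fun y => b y * B y)) <= X1).
  { apply zs_block_abs; [lia| |].
    - intros y Hy. rewrite Hb0 by lia. lra.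
    - intros y Hy. rewrite Rabs_mult. specialize (Hb01 y). rewrite (Rabs_pos_eq (b y)) by lra.
      pose proof (Rabs_pos (B y)). nra. }
  assert (B3 : Rabs (zs L (fun y => (b (y + 1)%Z - b y) * (B (y + 1)%Z - B y))) <= 2 / x * X2).
  { unfold X2. rewrite <- lsum_scal. apply zs_block_abs; [lia| |].
    - intros y Hy. rewrite !Hb0 by lia. lra.
    - intros y Hy. rewrite Rabs_mult. apply Rmult_le_compat_r; [apply Rabs_pos|apply Hbl]. }
  (* Error of freezing [A]. It is the primitive [Phi] that is controlled, not the number of lines,
     so one sums by parts and the difference falls on [b * (A - a)]: the slope of [b] costs
     [2 * M * V] and the increments of [A] another [M * V]. *)
  assert (B4 : Rabs (T - a * zs L (fun y => b y * IZR (eps y))) <= 3 * M * V).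
  { replace (T - a * zs L (fun y => b y * IZR (eps y)))
      with (zs L (fun y => IZR (eps y) * (b y * (A y - a)))).
    2:{ unfold T, zs. rewrite <- lsum_scal, <- lsum_minus. apply lsum_ext. intros; lra. }
    rewrite (zs_tele0 L _ (fun y => - Phi y * (b (y + 1)%Z * (A (y + 1)%Z - a) - b y * (A y - a)))
      (fun y => Phi (y - 1)%Z * (b y * (A y - a)))).
    2:{ intros y. replace (y + 1 - 1)%Z with y by lia.
        destruct (Z.le_gt_cases y (Z.of_nat l)) as [H1|H1]; [rewrite (Hb0 y) by lia; ring|].
        destruct (Z.le_gt_cases (2 * Z.of_nat l) y) as [H2|H2]; [rewrite (Hb0 y) by lia; ring|].
        rewrite <- HPhi by lia. ring. }
    2:{ intros y Hy. rewrite Hb0 by lia. ring. }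
    apply Rle_trans with (lsum blk (fun y => M * (2 / x * V) + M * Rabs (A (y + 1)%Z - A y))).
    - apply zs_block_abs; [lia| |].
      + intros y Hy. rewrite (Hb0 y), (Hb0 (y + 1)%Z) by lia. ring.
      + intros y Hy. rewrite Rabs_mult, Rabs_Ropp. rewrite <- Rmult_plus_distr_l.
        apply Rmult_le_compat; [apply Rabs_pos|apply Rabs_pos|now apply HM|].
        replace (b (y + 1)%Z * (A (y + 1)%Z - a) - b y * (A y - a))
          with ((b (y + 1)%Z - b y) * (A (y + 1)%Z - a) + b y * (A (y + 1)%Z - A y)) by ring.
        eapply Rle_trans; [apply Rabs_triang|]. rewrite !Rabs_mult.
        apply Rplus_le_compat.
        * apply Rmult_le_compat; [apply Rabs_pos|apply Rabs_pos|apply Hbl|apply Hosc; lia].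
        * specialize (Hb01 y). rewrite (Rabs_pos_eq (b y)) by lra.
          pose proof (Rabs_pos (A (y + 1)%Z - A y)). nra.
    - rewrite lsum_plus, lsum_const, lsum_scal. unfold blk at 1. rewrite length_zr. fold x.
      replace (x * (M * (2 / x * V))) with (2 * (M * V)) by (field; lra).
      assert (lsum blk (fun y => Rabs (A (y + 1)%Z - A y)) <= V).
      { apply lsum_incl; try apply nodup_zr; [|intros; apply Rabs_pos].
        intros y Hy. apply in_zr in Hy. apply in_zr. lia. }
      assert (M * lsum blk (fun y => Rabs (A (y + 1)%Z - A y)) <= M * V) by now apply Rmult_le_compat_l.
      lra. }
  (* The factor 6 bounds [3 / s], as [s >= 1/2]. The squares of the first four terms add up to
     [36 + 72 + 24 + 6 = 138] times [E / x], and the last one gives the 108; having five terms and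
     [E <= 2 * a] accounts for the factor 10. *)
  set (t1 := 6 * (x * rho)). set (t2 := 6 * ((1 - s) * X1)). set (t3 := 2 / x * X2).
  set (t4 := (1 - cs) * X1). set (t5 := sn * (3 * M * V)).
  assert (Hmain : sn * (a * W) <= t1 + t2 + t3 + t4 + t5).
  { assert (F1 : Rabs (sn * T) <= t1 + t2 + t3 + t4).
    { replace (sn * T) with (3 / s * (- zs L (fun y => b y * r2 y)) - 3 / s * ((1 - s) * zs L (fun y => b y * B y))
         - zs L (fun y => (b (y + 1)%Z - b y) * (B (y + 1)%Z - B y))
         - (1 - cs) * zs L (fun y => b y * B y)).
      2:{ rewrite Heq. field. lra. }
      assert (H3s : 0 <= 3 / s <= 6).
      { split; [apply Rle_mult_inv_pos; lra|].
        apply Rmult_le_reg_r with s; [lra|]. replace (3 / s * s) with 3 by (field; lra). lra. }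
      set (z1 := zs L (fun y => b y * r2 y)) in *. set (z2 := zs L (fun y => b y * B y)) in *.
      set (z3 := zs L (fun y => (b (y + 1)%Z - b y) * (B (y + 1)%Z - B y))) in *.
      assert (G1 : Rabs (3 / s * - z1) <= t1).
      { rewrite Rabs_mult, Rabs_Ropp, (Rabs_pos_eq (3 / s)) by lra. unfold t1.
        apply Rmult_le_compat; try apply Rabs_pos; lra. }
      assert (G2 : Rabs (3 / s * ((1 - s) * z2)) <= t2).
      { rewrite !Rabs_mult, (Rabs_pos_eq (3 / s)), (Rabs_pos_eq (1 - s)) by lra. unfold t2.
        apply Rmult_le_compat; try lra.
        - apply Rmult_le_pos; [lra|apply Rabs_pos].
        - apply Rmult_le_compat_l; lra. }
      assert (G4 : Rabs ((1 - cs) * z2) <= t4).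
      { rewrite Rabs_mult, (Rabs_pos_eq (1 - cs)) by lra. unfold t4. apply Rmult_le_compat_l; lra. }
      fold t3 in B3.
      set (w1 := 3 / s * - z1) in *. set (w2 := 3 / s * ((1 - s) * z2)) in *. set (w4 := (1 - cs) * z2) in *.
      revert G1 G2 G4 B3. clear. unfold Rabs. repeat destruct Rcase_abs; lra. }
    assert (F2 : Rabs (sn * (a * zs L (fun y => b y * IZR (eps y)))) <= Rabs (sn * T) + t5).
    { set (z := zs L (fun y => b y * IZR (eps y))) in *.
      replace (sn * (a * z)) with (sn * T + - (sn * (T - a * z))) by ring.
      eapply Rle_trans; [apply Rabs_triang|]. apply Rplus_le_compat_l.
      rewrite Rabs_Ropp, Rabs_mult, (Rabs_pos_eq sn) by lra. unfold t5. apply Rmult_le_compat_l; lra. }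
    apply Rle_trans with (Rabs (sn * (a * zs L (fun y => b y * IZR (eps y))))); [|lra].
    rewrite !Rabs_mult, (Rabs_pos_eq sn), (Rabs_pos_eq a) by lra.
    apply Rmult_le_compat_l; [lra|]. apply Rmult_le_compat_l; lra. }
  assert (Hix : / x^2 * x = / x) by (field; lra).
  assert (Hixp : 0 < / x <= 1).
  { split; [apply Rinv_0_lt_compat; lra|]. rewrite <- Rinv_1. apply Rinv_le_contravar; lra. }
  assert (Hrho0 : 0 <= rho) by (specialize (Hr2 0%Z); pose proof (Rabs_pos (r2 0%Z)); lra).
  (* The remainder carries no factor [E] by itself; [1 <= E] supplies it. *)
  assert (S1 : t1^2 <= 36 * (E / x)).
  { unfold t1. assert (x * rho <= / x).
    { rewrite <- Hix, (Rmult_comm _ x). apply Rmult_le_compat_l; lra. }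
    assert (0 <= x * rho) by (apply Rmult_le_pos; lra).
    assert ((x * rho)^2 <= / x * 1) by (simpl; rewrite Rmult_1_r; apply Rmult_le_compat; lra).
    assert (/ x * 1 <= / x * E) by (apply Rmult_le_compat_l; lra).
    unfold Rdiv. nra. }
  assert (S2 : t2^2 <= 72 * (E / x)).
  { unfold t2. assert (((1 - s) * X1)^2 <= 2 * (E / x)); [|nra].
    apply Rle_trans with ((1 - s) * (x * (2 * E))).
    - rewrite Rpow_mult_distr. replace ((1 - s)^2 * X1^2) with ((1 - s) * ((1 - s) * X1^2)) by ring.
      apply Rmult_le_compat_l; [lra|].
      apply Rle_trans with ((1 - s) * (x * q)); [apply Rmult_le_compat_l; lra|].
      replace ((1 - s) * (x * q)) with (x * ((1 - s) * q)) by ring. apply Rmult_le_compat_l; lra.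
    - replace (2 * (E / x)) with (/ x^2 * (x * (2 * E))) by (field; lra).
      apply Rmult_le_compat_r; [|lra]. apply Rmult_le_pos; lra. }
  assert (S3 : t3^2 <= 24 * (E / x)).
  { unfold t3. rewrite Rpow_mult_distr.
    replace (24 * (E / x)) with ((2 / x)^2 * (x * (6 * E))) by (field; lra).
    apply Rmult_le_compat_l; [apply pow2_ge_0|lra]. }
  assert (S4 : t4^2 <= 6 * (E / x)).
  { unfold t4. apply Rle_trans with ((1 - cs) * (x * (6 * E))).
    - rewrite Rpow_mult_distr. replace ((1 - cs)^2 * X1^2) with ((1 - cs) * ((1 - cs) * X1^2)) by ring.
      apply Rmult_le_compat_l; [lra|].
      apply Rle_trans with ((1 - cs) * (x * q)); [apply Rmult_le_compat_l; lra|].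
      replace ((1 - cs) * (x * q)) with (x * ((1 - cs) * q)) by ring. apply Rmult_le_compat_l; lra.
    - replace (6 * (E / x)) with (/ x^2 * (x * (6 * E))) by (field; lra).
      apply Rmult_le_compat_r; [|lra]. apply Rmult_le_pos; lra. }
  assert (S5 : t5^2 <= 108 * (sn^2 * M^2 * x) * E).
  { unfold t5. replace ((sn * (3 * M * V))^2) with (9 * (sn^2 * M^2) * V^2) by ring.
    replace (108 * (sn^2 * M^2 * x) * E) with (9 * (sn^2 * M^2) * (2 * x * (6 * E))) by ring.
    apply Rmult_le_compat_l; [|lra].
    pose proof (pow2_ge_0 sn). pose proof (pow2_ge_0 M). assert (0 <= sn^2 * M^2) by (apply Rmult_le_pos; lra). lra. }
  assert (Hsq : (sn * (a * W))^2 <= 5 * (t1^2 + t2^2 + t3^2 + t4^2 + t5^2)).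
  { apply Rle_trans with ((t1 + t2 + t3 + t4 + t5)^2).
    - apply pow_incr. split; [|exact Hmain]. apply Rmult_le_pos; [lra|]. apply Rmult_le_pos; lra.
    - pose proof (pow2_ge_0 (t1 - t2)). pose proof (pow2_ge_0 (t1 - t3)). pose proof (pow2_ge_0 (t1 - t4)).
      pose proof (pow2_ge_0 (t1 - t5)). pose proof (pow2_ge_0 (t2 - t3)). pose proof (pow2_ge_0 (t2 - t4)).
      pose proof (pow2_ge_0 (t2 - t5)). pose proof (pow2_ge_0 (t3 - t4)). pose proof (pow2_ge_0 (t3 - t5)).
      pose proof (pow2_ge_0 (t4 - t5)). lra. }
  set (K := 138 / x + 108 * (sn^2 * M^2 * x)).
  assert (HK : 0 <= K).
  { unfold K. pose proof (pow2_ge_0 sn). pose proof (pow2_ge_0 M).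
    assert (0 <= sn^2 * M^2) by (apply Rmult_le_pos; lra).
    assert (0 <= sn^2 * M^2 * x) by (apply Rmult_le_pos; lra). unfold Rdiv. lra. }
  assert (Hfin : (sn * (a * W))^2 <= 5 * (K * (2 * a))).
  { apply Rle_trans with (5 * (K * E)).
    - apply Rle_trans with (1 := Hsq). unfold K, Rdiv in *. lra.
    - apply Rmult_le_compat_l; [lra|]. apply Rmult_le_compat_l; lra. }
  apply Rmult_le_reg_r with a; [lra|]. fold K. nra.
Qed.

End Mode.

(** * Elementary trigonometric bounds *)

Lemma cos_ge_half x : Rabs x <= 1 -> 1/2 <= cos x.
Proof.
  intros Hx. assert (HP : 1 <= PI / 3) by (pose proof PI2_3_2; unfold PI2 in *; lra).
  assert (Hcos : forall z, 0 <= z <= 1 -> 1/2 <= cos z).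
  { intros z Hz. rewrite <- cos_PI3. apply cos_decr_1; lra. }
  unfold Rabs in Hx. destruct Rcase_abs; [rewrite <- cos_neg|]; apply Hcos; lra.
Qed.

Lemma sin_bounds x : 0 <= x <= 1 -> x / 2 <= sin x <= x.
Proof.
  intros Hx. split.
  - destruct (Req_dec x 0) as [->|Hx0]; [rewrite sin_0; lra|].
    destruct (MVT_cor2 sin cos 0 x) as [c [Hc1 Hc2]]; [lra|intros; apply derivable_pt_lim_sin|].
    rewrite sin_0 in Hc1. pose proof (cos_ge_half c ltac:(rewrite Rabs_pos_eq; lra)). nra.
  - destruct (Req_dec x 0) as [->|Hx0]; [rewrite sin_0; lra|].
    left. apply sin_lt_x. lra.
Qed.

Lemma one_minus_cos x : 0 <= x <= 1 -> 1 - cos x <= x^2.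
Proof.
  intros Hx. pose proof (cos_2a_sin (x / 2)) as E. replace (2 * (x / 2)) with x in E by lra.
  pose proof (sin_bounds (x / 2) ltac:(lra)). rewrite E. nra.
Qed.

(** * Fourier decomposition in the horizontal direction *)

(* Real and imaginary parts of the sum over [x] of [exp (i th x)] times the probability of going
   from [(x, y)] to the origin in [n] steps. *)
Fixpoint fourier (eps : Z -> Z) (th : R) (n : nat) (y : Z) : R * R :=
  match n with
  | O => (if Z.eqb y 0 then 1 else 0, 0)
  | S m =>
    let a := fourier eps th m in
    (1/3 * (fst (a (y + 1)%Z) + fst (a (y - 1)%Z)
        + cos th * fst (a y) + IZR (eps y) * sin th * snd (a y)),
     1/3 * (snd (a (y + 1)%Z) + snd (a (y - 1)%Z)
        + cos th * snd (a y) - IZR (eps y) * sin th * fst (a y)))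
  end.

Definition green_re eps th s m y := sum_f_R0 (fun n => s ^ n * fst (fourier eps th n y)) m.
Definition green_im eps th s m y := sum_f_R0 (fun n => s ^ n * snd (fourier eps th n y)) m.

Section Fourier.
Variable eps : Z -> Z.
Hypothesis Heps : forall y, eps y = 1%Z \/ eps y = (-1)%Z.

Lemma fourier_supp th n y : (Z.of_nat n < Z.abs y)%Z -> fourier eps th n y = (0, 0).
Proof.
  revert y. induction n as [|n IH]; intros y Hy; cbn [fourier].
  - destruct (Z.eqb_spec y 0); [lia|easy].
  - rewrite !IH by lia. cbn [fst snd]. f_equal; lra.
Qed.

Lemma green_supp th s m y : (Z.of_nat m < Z.abs y)%Z ->
  green_re eps th s m y = 0 /\ green_im eps th s m y = 0.
Proof.
  intros Hy. unfold green_re, green_im.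
  split; (rewrite <- (sum_eq (fun _ => 0)); [rewrite sum_cte; lra|]);
    intros i Hi; rewrite fourier_supp by lia; cbn; lra.
Qed.

Lemma green_re_eq th s m y :
  green_re eps th s m y - s / 3 * (green_re eps th s m (y + 1)%Z + green_re eps th s m (y - 1)%Z
    + cos th * green_re eps th s m y + IZR (eps y) * sin th * green_im eps th s m y)
  = (if Z.eqb y 0 then 1 else 0) - s ^ S m * fst (fourier eps th (S m) y).
Proof.
  induction m as [|m IH].
  - unfold green_re, green_im. simpl. lra.
  - unfold green_re, green_im in *. cbn [sum_f_R0].
    set (G := sum_f_R0) in *. cbn [fourier fst snd pow] in *. lra.
Qed.

Lemma green_im_eq th s m y :
  green_im eps th s m y - s / 3 * (green_im eps th s m (y + 1)%Z + green_im eps th s m (y - 1)%Z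
    + cos th * green_im eps th s m y - IZR (eps y) * sin th * green_re eps th s m y)
  = - (s ^ S m * snd (fourier eps th (S m) y)).
Proof.
  induction m as [|m IH].
  - unfold green_re, green_im. simpl. lra.
  - unfold green_re, green_im in *. cbn [sum_f_R0].
    set (G := sum_f_R0) in *. cbn [fourier fst snd pow] in *. lra.
Qed.

Definition norm2 (z : R * R) : R := (fst z)^2 + (snd z)^2.

Lemma norm2_nonneg z : 0 <= norm2 z.
Proof. unfold norm2. pose proof (pow2_ge_0 (fst z)). pose proof (pow2_ge_0 (snd z)). lra. Qed.

(** A horizontal step multiplies the mode by a complex number of modulus 1, which preserves [norm2];
    the rest is convexity of the square for an average of three terms. *)
Lemma fourier_contract th n y :
  norm2 (fourier eps th (S n) y)
  <= 1/3 * (norm2 (fourier eps th n (y + 1)%Z) + norm2 (fourier eps th n (y - 1)%Z)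
            + norm2 (fourier eps th n y)).
Proof.
  cbn [fourier]. unfold norm2. cbn [fst snd].
  destruct (fourier eps th n (y + 1)%Z) as [a1 b1]. destruct (fourier eps th n (y - 1)%Z) as [a2 b2].
  destruct (fourier eps th n y) as [a b]. cbn [fst snd].
  pose proof (sin2_cos2 th) as H. unfold Rsqr in H.
  set (c := cos th) in *. set (d := sin th) in *.
  assert (He : IZR (eps y) * IZR (eps y) = 1) by (destruct (Heps y) as [-> | ->]; lra).
  set (e := IZR (eps y)) in *.
  set (x := c * a + e * d * b). set (z := c * b - e * d * a).
  assert (Hr : x^2 + z^2 = a^2 + b^2).
  { unfold x, z. replace ((c * a + e * d * b)^2 + (c * b - e * d * a)^2)
      with ((c * c + (e * e) * (d * d)) * (a^2 + b^2)) by ring.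
    rewrite He. replace (c * c + 1 * (d * d)) with 1 by lra. ring. }
  rewrite <- Hr.
  replace (1 / 3 * (b1 + b2 + c * b - e * d * a)) with (1/3 * (b1 + b2 + z)) by (unfold z; ring).
  replace (1 / 3 * (a1 + a2 + c * a + e * d * b)) with (1/3 * (a1 + a2 + x)) by (unfold x; ring).
  pose proof (pow2_ge_0 (a1 - a2)). pose proof (pow2_ge_0 (a1 - x)). pose proof (pow2_ge_0 (a2 - x)).
  pose proof (pow2_ge_0 (b1 - b2)). pose proof (pow2_ge_0 (b1 - z)). pose proof (pow2_ge_0 (b2 - z)).
  lra.
Qed.

Lemma fourier_l2 th n L : (n + 1 <= L)%nat -> zs L (fun y => norm2 (fourier eps th n y)) <= 1.
Proof.
  revert L. induction n as [|n IH]; intros L HL.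
  - right. rewrite <- (zs_pick L 0 (fun _ => 1)) by lia. apply lsum_ext. intros y _.
    cbn [fourier]. unfold norm2. cbn [fst snd]. destruct (Z.eqb y 0); lra.
  - eapply Rle_trans; [|apply (IH L); lia].
    set (F := fun y => norm2 (fourier eps th n y)).
    assert (HF : forall y, (Z.of_nat L <= Z.abs y + 1)%Z -> F y = 0).
    { intros y Hy. unfold F. rewrite fourier_supp by lia. unfold norm2; cbn; lra. }
    apply Rle_trans with (zs L (fun y => 1/3 * (F (y + 1)%Z + F (y - 1)%Z + F y))).
    + apply lsum_le. intros y _. apply fourier_contract.
    + right. apply zs_tele0 with (h := fun y => 1/3 * (F y - F (y - 1)%Z)).
      * intros y. replace (y + 1 - 1)%Z with y by lia. lra.
      * intros y Hy. rewrite !HF by lia. lra.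
Qed.

Lemma fourier_le_one th n y : norm2 (fourier eps th n y) <= 1.
Proof.
  set (L := (n + 1 + Z.to_nat (Z.abs y))%nat).
  eapply Rle_trans; [|apply (fourier_l2 th n L); unfold L; lia].
  apply (lsum_in (zl L) (fun y => norm2 (fourier eps th n y))).
  - intros; apply norm2_nonneg.
  - apply in_zl. unfold L. lia.
Qed.

Lemma dirichlet_sin phi J :
  sin (phi / 2) * (1 + 2 * lsum (seq 1 J) (fun j => cos (INR j * phi))) = sin ((INR J + /2) * phi).
Proof.
  induction J as [|J IH].
  - cbn. replace ((0 + /2) * phi) with (phi / 2) by lra. lra.
  - rewrite seq_S, lsum_app. cbn [lsum fold_right]. replace (1 + J)%nat with (S J) by lia.
    rewrite Rplus_0_r.
    transitivity (sin ((INR J + /2) * phi) + 2 * sin (phi / 2) * cos (INR (S J) * phi)); [lra|].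
    replace ((INR J + /2) * phi) with (INR (S J) * phi - phi / 2) by (rewrite S_INR; lra).
    replace ((INR (S J) + /2) * phi) with (INR (S J) * phi + phi / 2) by lra.
    rewrite sin_minus, sin_plus. ring.
Qed.

(** For [1 <= j <= J], the nontrivial characters of the cycle of length [2 * J + 1], one from each
    conjugate pair. *)
Definition freq (J j : nat) : R := 2 * PI * INR j / (2 * INR J + 1).

(** At these frequencies the Dirichlet kernel is [2 * J + 1] times the indicator of the multiples of
    [2 * J + 1]. Indeed [sin (phi / 2)] times the kernel is the sine of [PI * x], which is 0, so
    either the kernel vanishes or every cosine is 1. *)
Lemma dirichlet_nonneg J x :
  0 <= 1 + 2 * lsum (seq 1 J) (fun j => cos (freq J j * IZR x)).
Proof.
  set (phi := 2 * PI * IZR x / (2 * INR J + 1)). pose proof (pos_INR J) as HJ.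
  assert (E : lsum (seq 1 J) (fun j => cos (freq J j * IZR x)) = lsum (seq 1 J) (fun j => cos (INR j * phi))).
  { apply lsum_ext. intros j _. f_equal. unfold freq, phi. field. lra. }
  rewrite E. pose proof (dirichlet_sin phi J) as H.
  assert (Hs : sin ((INR J + /2) * phi) = 0).
  { apply sin_eq_0_1. exists x. unfold phi. field. lra. }
  rewrite Hs in H. apply Rmult_integral in H. destruct H as [H|H]; [|lra].
  destruct (sin_eq_0_0 _ H) as [k Hk].
  rewrite (lsum_ext _ _ (fun _ => 1)).
  - rewrite lsum_const. pose proof (pos_INR (length (seq 1 J))). lra.
  - intros j _. replace (INR j * phi) with (2 * (INR j * IZR k * PI)) by (rewrite Rmult_assoc, <- Hk; lra).
    rewrite cos_2a_sin.
    assert (H0 : sin (INR j * IZR k * PI) = 0).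
    { apply sin_eq_0_1. exists (Z.of_nat j * k)%Z. rewrite mult_IZR, <- INR_IZR_INZ. easy. }
    rewrite H0. lra.
Qed.

(** Real part of [exp (- i th x)] times the Fourier mode, that is, one frequency of the inverse
    transform. It obeys the same first-step equation as [hit_prob]. *)
Definition wave th n x y : R :=
  cos (th * IZR x) * fst (fourier eps th n y) + sin (th * IZR x) * snd (fourier eps th n y).

Lemma wave_S th n x y :
  wave th (S n) x y = 1/3 * (wave th n x (y + 1)%Z + wave th n x (y - 1)%Z + wave th n (x + eps y)%Z y).
Proof.
  unfold wave. cbn [fourier fst snd].
  replace (th * IZR (x + eps y)) with (th * IZR x + th * IZR (eps y)) by (rewrite plus_IZR; ring).
  rewrite cos_plus, sin_plus.
  destruct (Heps y) as [-> | ->].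
  - rewrite Rmult_1_r. ring.
  - replace (th * -1) with (- th) by ring. rewrite cos_neg, sin_neg. ring.
Qed.

(** The right side is the hitting probability of the walk with [x] taken modulo [2 * J + 1], a sum
    over translates of the target. It starts above [hit_prob] because the kernel is nonnegative, and
    both sides follow the same recursion with nonnegative coefficients. *)
Lemma hit_prob_fourier J n x y :
  hit_prob eps n x y
  <= / (2 * INR J + 1) * (wave 0 n x y + 2 * lsum (seq 1 J) (fun j => wave (freq J j) n x y)).
Proof.
  pose proof (pos_INR J) as HJ. assert (HJ1 : 0 < / (2 * INR J + 1)) by (apply Rinv_0_lt_compat; lra).
  revert x y. induction n as [|n IH]; intros x y.
  - unfold hit_prob, wave. cbn [step_prob fourier fst snd].
    rewrite Rmult_0_l, cos_0.
    set (d := if Z.eqb y 0 then 1 else 0).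
    rewrite (lsum_ext _ _ (fun j => d * cos (freq J j * IZR x))) by (intros; lra).
    rewrite lsum_scal.
    replace (/ (2 * INR J + 1) * (1 * d + sin 0 * 0 + 2 * (d * lsum (seq 1 J) (fun j => cos (freq J j * IZR x)))))
      with (d * (/ (2 * INR J + 1) * (1 + 2 * lsum (seq 1 J) (fun j => cos (freq J j * IZR x))))) by ring.
    pose proof (dirichlet_nonneg J x) as HD.
    assert (H0 : 0 <= / (2 * INR J + 1) * (1 + 2 * lsum (seq 1 J) (fun j => cos (freq J j * IZR x))))
      by (apply Rmult_le_pos; lra).
    unfold d. destruct (Z.eqb_spec x 0) as [Hx|Hx], (Z.eqb_spec y 0) as [Hy|Hy]; cbn [andb]; try lra.
    rewrite Hx. rewrite (lsum_ext _ _ (fun _ => 1)) by (intros; rewrite Rmult_0_r; apply cos_0).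
    rewrite lsum_const, length_seq. right. field. lra.
  - rewrite hit_prob_S. unfold walk_op.
    pose proof (IH x (y + 1)%Z) as H1. pose proof (IH x (y - 1)%Z) as H2. pose proof (IH (x + eps y)%Z y) as H3.
    rewrite wave_S. rewrite (lsum_ext _ _ (fun j => 1/3 * (wave (freq J j) n x (y + 1)%Z
      + wave (freq J j) n x (y - 1)%Z + wave (freq J j) n (x + eps y)%Z y))) by (intros; apply wave_S).
    rewrite lsum_scal, !lsum_plus. lra.
Qed.

Lemma wave_origin th n : wave th n 0 0 = fst (fourier eps th n 0).
Proof.
  unfold wave. replace (th * IZR 0) with 0 by ring. rewrite cos_0, sin_0. ring.
Qed.

Lemma return_sum_fourier J s m : 0 <= s ->
  sum_f_R0 (fun n => s ^ n * return_prob eps n) m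
  <= / (2 * INR J + 1) * (green_re eps 0 s m 0 + 2 * lsum (seq 1 J) (fun j => green_re eps (freq J j) s m 0)).
Proof.
  intros Hs.
  assert (Hn : forall n, s ^ n * return_prob eps n <= / (2 * INR J + 1) *
    (s ^ n * fst (fourier eps 0 n 0) + 2 * lsum (seq 1 J) (fun j => s ^ n * fst (fourier eps (freq J j) n 0)))).
  { intros n. pose proof (hit_prob_fourier J n 0 0) as H. rewrite wave_origin in H.
    rewrite (lsum_ext _ _ (fun j => fst (fourier eps (freq J j) n 0))) in H by (intros; apply wave_origin).
    rewrite lsum_scal. apply (Rmult_le_compat_l (s ^ n)) in H; [|now apply pow_le].
    eapply Rle_trans; [exact H|]. right. ring. }
  induction m as [|m IH]; unfold green_re in *; cbn [sum_f_R0].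
  - apply Hn.
  - rewrite lsum_plus.
    eapply Rle_trans; [apply Rplus_le_compat; [exact IH|exact (Hn (S m))]|]. right. ring.
Qed.

End Fourier.

(** * Transience from well-behaved dyadic blocks *)

(** For [d > 0], Bernoulli's inequality with [c = b^(1/d)] gives [k * (c - 1) <= c^k], which is
    raised to the power [d]. *)
Lemma pow_le_exp_growth (d : nat) b : 1 < b -> exists K, 0 <= K /\ forall k, INR k ^ d <= K * b ^ k.
Proof.
  intros Hb. destruct d as [|d].
  { exists 1. split; [lra|]. intros k. rewrite Rmult_1_l. apply pow_R1_Rle. lra. }
  set (c := Rpower b (/ INR (S d))).
  assert (Hd : 0 < INR (S d)) by (apply lt_0_INR; lia).
  assert (Hc1 : 1 < c).
  { unfold c. apply Rle_lt_trans with (Rpower b 0); [rewrite Rpower_O; lra|].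
    apply Rpower_lt; [easy|]. now apply Rinv_0_lt_compat. }
  assert (Hcb : c ^ S d = b).
  { unfold c. rewrite <- Rpower_pow by apply exp_pos. rewrite Rpower_mult.
    replace (/ INR (S d) * INR (S d)) with 1 by (field; lra). apply Rpower_1. lra. }
  exists ((/ (c - 1)) ^ S d). split.
  - apply pow_le. left. apply Rinv_0_lt_compat. lra.
  - intros k. rewrite <- Hcb, <- pow_mult, Nat.mul_comm, pow_mult, <- Rpow_mult_distr.
    apply pow_incr. split; [apply pos_INR|].
    pose proof (poly k (c - 1) ltac:(lra)) as Hp. replace (1 + (c - 1)) with c in Hp by lra.
    apply Rmult_le_reg_l with (c - 1); [lra|].
    rewrite <- Rmult_assoc, Rinv_r, Rmult_1_l by lra. lra.
Qed.

Definition tent (k : nat) (y : Z) : R := Rmax 0 (1 - Rabs (IZR y - 3/2 * 2 ^ k) * (2 / 2 ^ k)).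

Definition block_sum (eps : Z -> Z) (k : nat) (y : Z) : R :=
  zs (2 ^ S k) (fun x => (if (Z.ltb (2 ^ Z.of_nat k) x && Z.leb x y)%bool then 1 else 0) * IZR (eps x)).

Definition tent_sum (eps : Z -> Z) (k : nat) : R :=
  zs (2 ^ S k) (fun x => tent k x * IZR (eps x)).

(** [g ^ k] is the order of the standard deviation of a block sum. The factor [C1 * INR k] lets an
    exponential moment beat the union over the [2^k] endpoints [y]; the factor [INR k ^ 3] makes the
    failure probability of the lower bound of order [k^(-2)]. *)
Definition good_block (g C1 : R) (eps : Z -> Z) (k : nat) : Prop :=
  (forall y, (2 ^ Z.of_nat k <= y < 2 ^ Z.of_nat (S k))%Z -> Rabs (block_sum eps k y) <= C1 * INR k * g ^ k)
  /\ g ^ k / INR k ^ 3 <= Rabs (tent_sum eps k).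

Lemma tent_range k y : 0 <= tent k y <= 1.
Proof.
  unfold tent. split; [apply Rmax_l|]. apply Rmax_lub; [lra|].
  assert (0 < 2 ^ k) by (apply pow_lt; lra).
  assert (0 <= Rabs (IZR y - 3/2 * 2 ^ k) * (2 / 2 ^ k)); [|lra].
  apply Rmult_le_pos; [apply Rabs_pos|]. apply Rle_mult_inv_pos; lra.
Qed.

Lemma tent_supp k y : (y <= 2 ^ Z.of_nat k \/ 2 * 2 ^ Z.of_nat k <= y)%Z -> tent k y = 0.
Proof.
  intros Hy. unfold tent. rewrite Rmax_left; [easy|].
  assert (H : 0 < 2 ^ k) by (apply pow_lt; lra).
  assert (HI : IZR y <= 2 ^ k \/ 2 * 2 ^ k <= IZR y).
  { rewrite pow_IZR. destruct Hy; [left|right; rewrite <- mult_IZR]; apply IZR_le; lia. }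
  assert (1 / 2 * 2 ^ k <= Rabs (IZR y - 3/2 * 2 ^ k)) by (unfold Rabs; destruct Rcase_abs; lra).
  assert (1 <= Rabs (IZR y - 3/2 * 2 ^ k) * (2 / 2 ^ k)); [|lra].
  replace 1 with (1/2 * 2 ^ k * (2 / 2 ^ k)) at 1 by (field; lra).
  apply Rmult_le_compat_r; [apply Rle_mult_inv_pos; lra|easy].
Qed.

Lemma tent_lip k y : Rabs (tent k (y + 1)%Z - tent k y) <= 2 / 2 ^ k.
Proof.
  assert (H : 0 < 2 ^ k) by (apply pow_lt; lra).
  assert (Hi : 0 < 2 / 2 ^ k) by (apply Rdiv_lt_0_compat; lra).
  unfold tent. rewrite plus_IZR. set (w := IZR y - 3/2 * 2 ^ k).
  replace (IZR y + 1 - 3/2 * 2 ^ k) with (w + 1) by (unfold w; ring).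
  set (c := 2 / 2 ^ k) in *.
  assert (Ha : Rabs (Rabs (w + 1) - Rabs w) <= 1) by (unfold Rabs; repeat destruct Rcase_abs; lra).
  assert (Hb : Rabs (Rabs (w + 1) * c - Rabs w * c) <= c).
  { replace (Rabs (w + 1) * c - Rabs w * c) with ((Rabs (w + 1) - Rabs w) * c) by ring.
    rewrite Rabs_mult, (Rabs_pos_eq c) by lra. nra. }
  set (p := Rabs (w + 1) * c) in *. set (q := Rabs w * c) in *.
  unfold Rmax. destruct (Rle_dec 0 (1 - p)), (Rle_dec 0 (1 - q));
    revert Hb; unfold Rabs; repeat destruct Rcase_abs; lra.
Qed.

Lemma block_sum_diff eps k y : (2 ^ Z.of_nat k < y < 2 ^ Z.of_nat (S k))%Z ->
  block_sum eps k y - block_sum eps k (y - 1)%Z = IZR (eps y).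
Proof.
  intros Hy. unfold block_sum, zs. rewrite <- lsum_minus.
  transitivity (zs (2 ^ S k) (fun x => if Z.eqb x y then IZR (eps x) else 0)).
  - apply lsum_ext. intros x _.
    destruct (Z.ltb_spec (2 ^ Z.of_nat k) x), (Z.leb_spec x y), (Z.leb_spec x (y - 1)), (Z.eqb_spec x y);
      cbn [andb]; try lia; lra.
  - apply (zs_pick _ y (fun x => IZR (eps x))). rewrite pow2_Z_nat. lia.
Qed.

Section Trans.
Variables (eps : Z -> Z) (g C1 : R).
Hypothesis Heps : forall y, eps y = 1%Z \/ eps y = (-1)%Z.
Hypothesis Hg : 1 < g.
Hypothesis HC1 : 0 <= C1.

Variables (s : R) (m : nat).
Hypothesis Hs : 1/2 <= s < 1.
Hypothesis Hm : s ^ S m <= 1 - s.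

Lemma remainder_bounds th : let r1 := fun y => s ^ S m * fst (fourier eps th (S m) y) in
  let r2 := fun y => s ^ S m * snd (fourier eps th (S m) y) in
  (forall L, (m + 2 <= L)%nat -> zs L (fun y => (r1 y)^2 + (r2 y)^2) <= 2 * (1 - s) * 1)
  /\ forall y, Rabs (r2 y) <= s ^ S m.
Proof.
  intros r1 r2. pose proof (pow_le_one s (S m) ltac:(lra)) as Hp. split.
  - intros L HL. apply Rle_trans with ((s ^ S m)^2 * zs L (fun y => norm2 (fourier eps th (S m) y))).
    + right. unfold zs. rewrite <- lsum_scal. apply lsum_ext. intros y _. unfold r1, r2, norm2. ring.
    + pose proof (fourier_l2 eps Heps th (S m) L ltac:(lia)).
      assert (0 <= zs L (fun y => norm2 (fourier eps th (S m) y)))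
        by (apply lsum_nonneg; intros; apply norm2_nonneg). nra.
  - intros y. unfold r2. rewrite Rabs_mult, (Rabs_pos_eq (s ^ S m)) by lra.
    pose proof (fourier_le_one eps Heps th (S m) y) as H1. unfold norm2 in H1.
    pose proof (pow2_ge_0 (fst (fourier eps th (S m) y))).
    assert (Rabs (snd (fourier eps th (S m) y)) <= 1) by (apply Rabs_le; split; nra).
    pose proof (Rabs_pos (snd (fourier eps th (S m) y))). nra.
Qed.

Lemma green_small_freq n : (1 <= n)%nat -> 1 - s = / (INR n)^2 -> green_re eps 0 s m 0 <= 32 * INR n.
Proof.
  intros Hn Hsn.
  apply mode_bound_small_freq with (eps := eps) (cs := cos 0) (sn := sin 0) (s := s) (eta := 1)
    (B := green_im eps 0 s m) (r1 := fun y => s ^ S m * fst (fourier eps 0 (S m) y))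
    (r2 := fun y => s ^ S m * snd (fourier eps 0 (S m) y)) (L := (m + n + 3)%nat); try lia; try easy.
  - apply COS_bound.
  - intros y Hy. apply (green_supp eps 0 s m y). lia.
  - intros y Hy. apply (green_supp eps 0 s m y). lia.
  - intros y. apply green_re_eq.
  - intros y. apply green_im_eq.
  - lra.
  - apply (remainder_bounds 0). lia.
Qed.

Lemma green_large_freq th kap : 0 < kap -> kap <= 1 - cos th -> green_re eps th s m 0 <= 1 + 12 / kap.
Proof.
  intros Hk Hkc.
  apply mode_bound_large_freq with (eps := eps) (cs := cos th) (sn := sin th) (s := s) (eta := 1)
    (B := green_im eps th s m) (r1 := fun y => s ^ S m * fst (fourier eps th (S m) y))
    (r2 := fun y => s ^ S m * snd (fourier eps th (S m) y)) (L := (m + 3)%nat); try lia; try easy.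
  - apply COS_bound.
  - intros y Hy. apply (green_supp eps th s m y). lia.
  - intros y Hy. apply (green_supp eps th s m y). lia.
  - intros y. apply green_re_eq.
  - intros y. apply green_im_eq.
  - lra.
  - apply (remainder_bounds th). lia.
Qed.

Definition dyadic_const : R := 160 * g^2 * (138 + 108 * C1^2) * 4.

(** Here [sin th] is of order [2^(-k) g^(-k)], so [sn * W] is at least of order [2^(-k) k^(-3)] and
    [sn * M] at most of order [2^(-k) k]. The block bound then reads
    [4^(-k) k^(-6) A 0 <= const * k^2 2^(-k)], whence [k^8 2^k]. Its condition on [cs] holds because
    [1 - cos th <= th^2 <= 4^(-k)]. *)
Lemma green_dyadic k th : (1 <= k)%nat -> good_block g C1 eps k ->
  (/ (2 * g)) ^ S k <= th <= (/ (2 * g)) ^ k -> 1 - s <= / (2 ^ k)^2 ->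
  green_re eps th s m 0 <= 1 + dyadic_const * (INR k ^ 8 * 2 ^ k).
Proof.
  intros Hk [HM HW] Hth Hsk.
  assert (HK0 : 0 <= dyadic_const).
  { unfold dyadic_const. pose proof (pow2_ge_0 g). pose proof (pow2_ge_0 C1).
    apply Rmult_le_pos; [apply Rmult_le_pos|]; lra. }
  assert (Hk1 : 1 <= INR k) by (change 1 with (INR 1); now apply le_INR).
  assert (H2k : 1 <= 2 ^ k) by (apply pow_R1_Rle; lra).
  assert (Hgk : 1 <= g ^ k) by (apply pow_R1_Rle; lra).
  assert (Hk8 : 1 <= INR k ^ 8) by (apply pow_R1_Rle; lra).
  destruct (Rle_dec (green_re eps th s m 0) 1) as [H1|H1].
  { assert (0 <= dyadic_const * (INR k ^ 8 * 2 ^ k)); [|lra]. apply Rmult_le_pos; [easy|nra]. }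
  assert (Hthk : (/ (2 * g)) ^ k = / (2 ^ k * g ^ k)) by (rewrite pow_inv, Rpow_mult_distr; reflexivity).
  assert (HthSk : (/ (2 * g)) ^ S k = / (2 * g) * / (2 ^ k * g ^ k)) by (cbn [pow]; rewrite Hthk; reflexivity).
  rewrite Hthk, HthSk in Hth.
  assert (Hxg : 0 < / (2 ^ k * g ^ k)) by (apply Rinv_0_lt_compat; nra).
  assert (Hth2 : / (2 ^ k * g ^ k) <= / 2 ^ k) by (apply Rinv_le_contravar; nra).
  assert (H2ki : 0 < / 2 ^ k <= 1).
  { split; [apply Rinv_0_lt_compat; lra|]. rewrite <- Rinv_1. apply Rinv_le_contravar; lra. }
  assert (H2gi : 0 < / (2 * g)) by (apply Rinv_0_lt_compat; lra).
  assert (Hth01 : 0 <= th <= 1) by (split; [|lra]; assert (0 < / (2 * g) * / (2 ^ k * g ^ k)) by (now apply Rmult_lt_0_compat); lra).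
  pose proof (sin_bounds th Hth01) as Hsin. pose proof (one_minus_cos th Hth01) as Hcos.
  assert (Hx : INR (2 ^ k) = 2 ^ k) by (rewrite pow_INR; reflexivity).
  assert (HZ : Z.of_nat (2 ^ k) = (2 ^ Z.of_nat k)%Z) by apply pow2_Z_nat.
  assert (H2Z : (2 ^ Z.of_nat (S k) = 2 * 2 ^ Z.of_nat k)%Z) by (rewrite Nat2Z.inj_succ, Z.pow_succ_r; lia).
  destruct (remainder_bounds th) as [HR1 HR2].
  pose (M := C1 * INR k * g ^ k). pose (W := g ^ k / INR k ^ 3).
  assert (HMp : 0 <= M) by (unfold M; apply Rmult_le_pos; [apply Rmult_le_pos|]; lra).
  assert (Hk3 : 0 < INR k ^ 3) by (apply pow_lt; lra).
  assert (HWp : 0 <= W) by (unfold W; apply Rle_mult_inv_pos; lra).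
  assert (Hmain : (sin th)^2 * W^2 * green_re eps th s m 0
    <= 10 * (138 / INR (2 ^ k) + 108 * ((sin th)^2 * M^2 * INR (2 ^ k)))).
  { apply mode_bound_block with (eps := eps) (cs := cos th) (sn := sin th) (s := s) (eta := 1)
      (rho := s ^ S m)
      (B := green_im eps th s m) (r1 := fun y => s ^ S m * fst (fourier eps th (S m) y))
      (r2 := fun y => s ^ S m * snd (fourier eps th (S m) y)) (L := (m + 4 * 2 ^ k + 3)%nat)
      (b := tent k) (Phi := block_sum eps k); try lia; try easy; try lra.
    - apply COS_bound.
    - intros y Hy. apply (green_supp eps th s m y). lia.
    - intros y Hy. apply (green_supp eps th s m y). lia.
    - intros y. apply green_re_eq.
    - intros y. apply green_im_eq.
    - apply HR1. lia.
    - apply tent_range.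
    - intros y Hy. apply tent_supp. lia.
    - intros y. rewrite Hx. apply tent_lip.
    - intros y Hy. apply block_sum_diff. lia.
    - intros y Hy. apply HM. lia.
    - eapply Rle_trans; [exact HW|]. right. unfold tent_sum. f_equal. symmetry. apply zs_extend.
      + cbn [Nat.pow]. lia.
      + intros y Hy. rewrite pow2_Z_nat in Hy. rewrite tent_supp by lia. ring.
    - rewrite Hx. exact Hsk.
    - rewrite Hx. eapply Rle_trans; [exact Hcos|].
      rewrite <- pow_inv. apply pow_incr. lra.
    - rewrite Hx. lra. }
  rewrite Hx in Hmain.
  set (a := green_re eps th s m 0) in *. set (x := 2 ^ k) in *. set (h := g ^ k) in *. set (n := INR k) in *.
  set (sn := sin th) in *.
  (* The 16 is the square of [2 * 2], from [th >= / (2 * g) * / (x * h)] and [sin th >= th / 2]. *)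
  assert (Hlow : / (16 * g^2 * x^2 * n^6) <= sn^2 * W^2).
  { replace (/ (16 * g^2 * x^2 * n^6)) with ((/ (2 * g) * / (x * h) / 2)^2 * (h / n^3)^2) by (field; lra).
    unfold W. apply Rmult_le_compat_r; [apply pow2_ge_0|]. apply pow_incr. split; [|lra].
    assert (0 < / (2 * g) * / (x * h)) by (now apply Rmult_lt_0_compat). lra. }
  assert (Hup : sn^2 * M^2 * x <= C1^2 * n^2 / x).
  { replace (C1^2 * n^2 / x) with ((/ (x * h))^2 * M^2 * x) by (unfold M; fold h n; field; lra).
    apply Rmult_le_compat_r; [lra|]. apply Rmult_le_compat_r; [apply pow2_ge_0|].
    apply pow_incr. lra. }
  assert (Hfin : / (16 * g^2 * x^2 * n^6) * a <= 10 * (138 + 108 * C1^2) * n^2 / x).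
  { apply Rle_trans with (sn^2 * W^2 * a); [apply Rmult_le_compat_r; lra|].
    apply Rle_trans with (1 := Hmain).
    apply Rle_trans with (10 * (138 / x + 108 * (C1^2 * n^2 / x))); [lra|].
    unfold Rdiv. assert (0 < / x) by (apply Rinv_0_lt_compat; lra).
    assert (1 <= n^2) by (apply pow_R1_Rle; lra).
    assert (138 * / x <= 138 * (n^2 * / x)).
    { apply Rmult_le_compat_l; [lra|]. rewrite <- (Rmult_1_l (/ x)) at 1. apply Rmult_le_compat_r; lra. }
    lra. }
  assert (Hpos : 0 < 16 * g^2 * x^2 * n^6).
  { repeat apply Rmult_lt_0_compat; try apply pow_lt; lra. }
  apply (Rmult_le_compat_l (16 * g^2 * x^2 * n^6)) in Hfin; [|lra].
  rewrite <- Rmult_assoc, Rinv_r, Rmult_1_l in Hfin by lra.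
  replace (16 * g ^ 2 * x ^ 2 * n ^ 6 * (10 * (138 + 108 * C1 ^ 2) * n ^ 2 / x))
    with (160 * g^2 * (138 + 108 * C1^2) * (n^8 * x)) in Hfin by (field; lra).
  unfold dyadic_const.
  assert (0 <= 160 * g^2 * (138 + 108 * C1^2) * (n^8 * x)); [|lra].
  unfold dyadic_const in HK0. apply Rmult_le_pos; [lra|nra].
Qed.

End Trans.

Lemma lsum_geom A b n : 0 <= A -> 0 <= b < 1 -> lsum (seq 0 n) (fun k => A * b ^ k) <= A / (1 - b).
Proof.
  intros HA Hb. assert (E : lsum (seq 0 n) (fun k => A * b ^ k) = A * (1 - b ^ n) / (1 - b)).
  { induction n as [|n IH]; [cbn; field; lra|].
    rewrite seq_S, lsum_app, IH. cbn [lsum fold_right]. rewrite Nat.add_0_l. cbn [pow]. field. lra. }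
  rewrite E. apply Rmult_le_compat_r; [left; apply Rinv_0_lt_compat; lra|].
  pose proof (pow_le b n ltac:(lra)). nra.
Qed.

Lemma bernoulli_le x n : 0 <= x <= 1 -> 1 - INR n * x <= (1 - x) ^ n.
Proof.
  intros Hx. induction n as [|n IH]; [simpl; lra|].
  rewrite S_INR. cbn [pow].
  assert ((1 - x) * (1 - INR n * x) <= (1 - x) * (1 - x) ^ n) by (apply Rmult_le_compat_l; lra).
  assert (0 <= INR n * (x * x)) by (apply Rmult_le_pos; [apply pos_INR|nra]). lra.
Qed.

(** The bound by [INR J] is proved alongside: if [S J] is counted, the count is at most [INR (S J)],
    which is itself at most [X / c]. *)
Lemma count_multiples c X J : 0 < c -> 0 <= X ->
  lsum (seq 1 J) (fun j => if Rle_dec (c * INR j) X then 1 else 0) <= X / c.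
Proof.
  intros Hc HX.
  assert (H : lsum (seq 1 J) (fun j => if Rle_dec (c * INR j) X then 1 else 0) <= X / c
     /\ lsum (seq 1 J) (fun j => if Rle_dec (c * INR j) X then 1 else 0) <= INR J); [|easy].
  induction J as [|J [IH1 IH2]].
  - cbn. split; [apply Rle_mult_inv_pos; lra|lra].
  - rewrite seq_S, lsum_app. cbn [lsum fold_right]. replace (1 + J)%nat with (S J) by lia.
    destruct (Rle_dec (c * INR (S J)) X) as [H|H].
    + assert (INR (S J) <= X / c).
      { apply Rmult_le_reg_l with c; [easy|]. replace (c * (X / c)) with X by (field; lra). easy. }
      rewrite S_INR in *. lra.
    + rewrite S_INR. lra.
Qed.

Lemma geometric_scale r th : 0 < r < 1 -> 0 < th <= 1 -> exists k, r ^ S k <= th <= r ^ k.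
Proof.
  intros Hr Hth.
  destruct (pow_lt_1_zero r) with (y := th) as [N HN]; [rewrite Rabs_pos_eq; lra|lra|].
  specialize (HN N (Nat.le_refl N)). rewrite Rabs_pos_eq in HN by (apply pow_le; lra).
  induction N as [|N IH]; [simpl in HN; lra|].
  destruct (Rlt_dec (r ^ N) th) as [H|H]; [auto|]. exists N. lra.
Qed.

Lemma pow_decr r n k : 0 <= r <= 1 -> (n <= k)%nat -> r ^ k <= r ^ n.
Proof.
  intros Hr Hnk. replace k with (n + (k - n))%nat by lia. rewrite pow_add.
  pose proof (pow_le_one r (k - n) Hr). pose proof (pow_le_one r n Hr). nra.
Qed.

(** The lower end limits the scales that occur: a frequency between [/ J] and [(2 g)^(-k)] forces
    [2^k <= J], so the killing rate [/ J^2] is at most [4^(-k)]. *)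
Lemma freq_range J j : (1 <= j <= J)%nat -> / INR J <= freq J j <= PI.
Proof.
  intros Hj. unfold freq. assert (1 <= INR j) by (apply (le_INR 1); lia).
  assert (INR j <= INR J) by (apply le_INR; lia).
  assert (HP : 3 < PI) by (pose proof PI2_3_2; lra).
  split.
  - apply Rmult_le_reg_l with (INR J * (2 * INR J + 1)); [nra|].
    replace (INR J * (2 * INR J + 1) * / INR J) with (2 * INR J + 1) by (field; lra).
    replace (INR J * (2 * INR J + 1) * (2 * PI * INR j / (2 * INR J + 1)))
      with (2 * PI * (INR j * INR J)) by (field; lra).
    assert (INR J <= INR j * INR J) by nra.
    assert (3 * (INR j * INR J) <= PI * (INR j * INR J)) by (apply Rmult_le_compat_r; lra). lra.
  - apply Rmult_le_reg_r with (2 * INR J + 1); [lra|].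
    replace (2 * PI * INR j / (2 * INR J + 1) * (2 * INR J + 1)) with (2 * PI * INR j) by (field; lra).
    nra.
Qed.

Lemma transient_of_bounded eps B :
  (forall n, sum_f_R0 (return_prob eps) n <= B) -> transient eps.
Proof.
  intros HB. destruct (growing_cv (sum_f_R0 (return_prob eps))) as [l Hl].
  - intros n. apply return_sum_mono. lia.
  - exists B. intros x [n ->]. apply HB.
  - now exists l.
Qed.

(** Half of the gain, [sqrt g], is spent on the power [k^8]; the other half gives a geometric
    series. *)
Lemma dyadic_weights_summable g K : 1 < g -> 0 <= K -> exists T, forall n,
  lsum (seq 0 n) (fun k => (1 + K * (INR k ^ 8 * 2 ^ k)) * (/ (2 * g)) ^ k) <= T.
Proof.
  intros Hg HK. set (h := sqrt g).
  assert (Hh : 1 < h) by (pose proof (sqrt_lt_1 1 g ltac:(lra) ltac:(lra) Hg) as H; rewrite sqrt_1 in H; easy).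
  assert (Hhg : h * h = g) by (apply sqrt_sqrt; lra).
  destruct (pow_le_exp_growth 8 h Hh) as [P [HP HPk]].
  exists ((1 + K * P) / (1 - / h)). intros n.
  assert (Hhi : 0 < / h < 1).
  { split; [apply Rinv_0_lt_compat; lra|]. rewrite <- Rinv_1. apply Rinv_lt_contravar; lra. }
  assert (HKP : 0 <= K * P) by now apply Rmult_le_pos.
  eapply Rle_trans; [|apply (lsum_geom (1 + K * P) (/ h) n); lra].
  apply lsum_le. intros k _. specialize (HPk k).
  assert (Hhk : 1 <= h ^ k) by (apply pow_R1_Rle; lra).
  assert (H2k : 1 <= 2 ^ k) by (apply pow_R1_Rle; lra).
  rewrite !pow_inv, !Rpow_mult_distr. rewrite <- Hhg, Rpow_mult_distr.
  set (x := 2 ^ k) in *. set (y := h ^ k) in *. set (z := INR k ^ 8) in *.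
  assert (Hxy : 0 < x * (y * y)) by nra.
  apply Rmult_le_reg_r with (x * (y * y)); [easy|].
  rewrite Rmult_assoc, Rinv_l, Rmult_1_r by lra.
  replace ((1 + K * P) * / y * (x * (y * y))) with ((1 + K * P) * (x * y)) by (field; lra).
  assert (K * (z * x) <= K * (P * y * x)).
  { apply Rmult_le_compat_l; [easy|]. apply Rmult_le_compat_r; lra. }
  nra.
Qed.

(** The Fourier average splits in three. The zero frequency contributes a constant, since its Green
    function is [O(J)] against the weight [/ (2 * J + 1)]. Frequencies above [th0] are bounded
    uniformly. Those at a scale [k >= k0] have proportion at most [r^k], which balances their weight
    [w k]. *)
Lemma transient_of_good_blocks eps g C1 k0 :
  (forall y, eps y = 1%Z \/ eps y = (-1)%Z) -> 1 < g -> 0 <= C1 -> (1 <= k0)%nat ->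
  (forall k, (k0 <= k)%nat -> good_block g C1 eps k) -> transient eps.
Proof.
  intros Heps Hg HC1 Hk0 Hgood.
  set (r := / (2 * g)).
  assert (Hr : 0 < r < 1/2).
  { unfold r. split; [apply Rinv_0_lt_compat; lra|]. replace (1/2) with (/2) by lra.
    apply Rinv_lt_contravar; lra. }
  set (th0 := r ^ k0).
  assert (Hth0 : 0 < th0 <= 1).
  { split; [apply pow_lt; lra|]. apply pow_le_one; lra. }
  assert (HP : 3 < PI) by (pose proof PI2_3_2; unfold PI2 in *; lra).
  set (kap := 1 - cos th0).
  assert (Hkap : 0 < kap).
  { unfold kap. pose proof (cos_decreasing_1 0 th0 ltac:(lra) ltac:(lra) ltac:(lra) ltac:(lra) ltac:(lra)) as H.
    rewrite cos_0 in H. lra. }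
  set (Cb := 1 + 12 / kap).
  assert (HCb : 0 < Cb) by (unfold Cb; assert (0 < 12 / kap) by (apply Rdiv_lt_0_compat; lra); lra).
  set (K0 := dyadic_const g C1).
  assert (HK0 : 0 <= K0).
  { unfold K0, dyadic_const. pose proof (pow2_ge_0 g). pose proof (pow2_ge_0 C1).
    apply Rmult_le_pos; [apply Rmult_le_pos|]; lra. }
  destruct (dyadic_weights_summable g K0 Hg HK0) as [T HT]. fold r in HT.
  set (w := fun k => 1 + K0 * (INR k ^ 8 * 2 ^ k)).
  assert (Hw : forall k, 0 <= w k).
  { intros k. unfold w. assert (0 <= K0 * (INR k ^ 8 * 2 ^ k)); [|lra].
    apply Rmult_le_pos; [easy|]. apply Rmult_le_pos; apply pow_le; [apply pos_INR|lra]. }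
  apply transient_of_bounded with (B := 2 * (32 + Cb + T)). intros I0.
  (* [J] exceeds the horizon [I0], so with [1 - s = / J^2] Bernoulli's inequality gives
     [s ^ n >= 1/2] for all [n <= I0]: removing the discount costs only a factor 2. *)
  set (J := (2 * I0 + 2)%nat).
  assert (HJ : 2 <= INR J) by (change 2 with (INR 2); apply le_INR; unfold J; lia).
  set (s := 1 - / (INR J)^2).
  assert (HJ2 : 0 < / (INR J)^2 <= 1/4).
  { split; [apply Rinv_0_lt_compat; nra|]. replace (1/4) with (/4) by lra. apply Rinv_le_contravar; nra. }
  assert (Hs : 1/2 <= s < 1) by (unfold s; lra).
  assert (Hs1 : 1 - s = / (INR J)^2) by (unfold s; lra).
  destruct (pow_lt_1_zero s) with (y := 1 - s) as [N HN]; [rewrite Rabs_pos_eq; lra|lra|].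
  set (m := (N + I0)%nat).
  assert (Hm : s ^ S m <= 1 - s).
  { specialize (HN (S m) ltac:(unfold m; lia)). rewrite Rabs_pos_eq in HN; [lra|]. apply pow_le; lra. }
  assert (Hhalf : sum_f_R0 (return_prob eps) I0 <= 2 * sum_f_R0 (fun n => s ^ n * return_prob eps n) m).
  { apply Rle_trans with (2 * sum_f_R0 (fun n => s ^ n * return_prob eps n) I0).
    - rewrite scal_sum. apply sum_Rle. intros n Hn. pose proof (return_prob_nonneg eps n).
      assert (1/2 <= s ^ n).
      { unfold s. eapply Rle_trans; [|apply bernoulli_le; lra].
        assert (HnJ : INR n <= INR J) by (apply le_INR; unfold J; lia).
        assert (INR n * / INR J ^ 2 <= INR J * / INR J ^ 2) by (apply Rmult_le_compat_r; lra).
        replace (INR J * / INR J ^ 2) with (/ INR J) in H0 by (field; lra).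
        assert (/ INR J <= / 2) by (apply Rinv_le_contravar; lra). lra. }
      nra.
    - apply Rmult_le_compat_l; [lra|].
      assert (Hle : (I0 <= m)%nat) by (unfold m; lia). clearbody m. clear Hm. induction Hle as [|m Hle IH]; [lra|].
      cbn [sum_f_R0]. pose proof (return_prob_nonneg eps (S m)). pose proof (pow_le s (S m) ltac:(lra)).
      assert (0 <= s ^ S m * return_prob eps (S m)) by (now apply Rmult_le_pos). lra. }
  eapply Rle_trans; [exact Hhalf|]. apply Rmult_le_compat_l; [lra|].
  eapply Rle_trans; [apply (return_sum_fourier eps Heps J s m); lra|].
  assert (HG0 : green_re eps 0 s m 0 <= 32 * INR J).
  { apply green_small_freq; try easy. unfold J; lia. }
  (* Only the upper end of the scale is kept. This overcounts frequencies, harmlessly since all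
     weights are nonnegative, and reduces the count to multiples of a constant below a threshold. *)
  set (ind := fun (k j : nat) => if Rle_dec (freq J j) (r ^ k) then 1 else 0).
  assert (HGj : forall j, (1 <= j <= J)%nat -> green_re eps (freq J j) s m 0
     <= Cb + lsum (seq 0 (S J)) (fun k => w k * ind k j)).
  { intros j Hj. pose proof (freq_range J j Hj) as Hfr.
    assert (Hpos : forall k, 0 <= w k * ind k j).
    { intros k. apply Rmult_le_pos; [apply Hw|]. unfold ind. destruct Rle_dec; lra. }
    destruct (Rle_dec th0 (freq J j)) as [Hbig|Hsmall].
    - assert (0 <= lsum (seq 0 (S J)) (fun k => w k * ind k j)) by (apply lsum_nonneg; intros; apply Hpos).
      assert (green_re eps (freq J j) s m 0 <= Cb); [|lra].
      apply green_large_freq; try easy.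
      assert (cos (freq J j) <= cos th0) by (apply cos_decr_1; lra). unfold kap. lra.
    - assert (HJi : 0 < / INR J) by (apply Rinv_0_lt_compat; lra).
      destruct (geometric_scale r (freq J j) ltac:(lra) ltac:(lra)) as [k Hk].
      assert (Hk0k : (k0 <= k)%nat).
      { apply Nat.nlt_ge. intro Hlt. apply Hsmall. unfold th0.
        apply Rle_trans with (r ^ S k); [apply pow_decr; [lra|lia]|apply Hk]. }
      assert (H2k : 0 < 2 ^ k) by (apply pow_lt; lra).
      assert (H2J : 2 ^ k <= INR J).
      { apply Rnot_lt_le. intro Hlt. apply Rinv_lt_contravar in Hlt; [|nra].
        assert (r ^ k <= / 2 ^ k) by (rewrite <- pow_inv; apply pow_incr; lra). lra. }
      assert (HkJ : (k <= J)%nat).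
      { apply INR_le. apply Rle_trans with (2 ^ k); [|easy].
        pose proof (poly k 1 ltac:(lra)) as Hp. replace (1 + 1) with 2 in Hp by lra. lra. }
      assert (Hgr : green_re eps (freq J j) s m 0 <= w k).
      { apply green_dyadic; try easy; [lia|now apply Hgood|].
        rewrite Hs1. apply Rinv_le_contravar; [nra|]. apply pow_incr. lra. }
      assert (w k * ind k j <= lsum (seq 0 (S J)) (fun k => w k * ind k j)).
      { apply (lsum_in _ (fun k => w k * ind k j)); [intros; apply Hpos|]. apply in_seq. lia. }
      unfold ind in H at 1. destruct Rle_dec as [|Hn]; [lra|]. exfalso. apply Hn, Hk. }
  assert (HJ3 : 0 < / (2 * INR J + 1)) by (apply Rinv_0_lt_compat; lra).
  assert (Hcount : forall k, 2 * / (2 * INR J + 1) * lsum (seq 1 J) (fun j => ind k j) <= r ^ k).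
  { intros k. assert (Hrk : 0 <= r ^ k) by (apply pow_le; lra).
    set (c := 2 * PI * / (2 * INR J + 1)).
    assert (Hc : 0 < c) by (unfold c; nra).
    pose proof (count_multiples c (r ^ k) J Hc Hrk) as H.
    assert (E : lsum (seq 1 J) (fun j => ind k j) = lsum (seq 1 J) (fun j => if Rle_dec (c * INR j) (r ^ k) then 1 else 0)).
    { apply lsum_ext. intros j _. unfold ind.
      replace (freq J j) with (c * INR j) by (unfold freq, c; field; lra). easy. }
    rewrite E. apply Rle_trans with (2 * / (2 * INR J + 1) * (r ^ k / c)).
    - apply Rmult_le_compat_l; lra.
    - replace (2 * / (2 * INR J + 1) * (r ^ k / c)) with (r ^ k * / PI) by (unfold c; field; lra).
      assert (/ PI <= 1) by (rewrite <- Rinv_1; apply Rinv_le_contravar; lra). nra. }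
  apply Rle_trans with (/ (2 * INR J + 1) * (32 * INR J + 2 * lsum (seq 1 J) (fun j =>
      Cb + lsum (seq 0 (S J)) (fun k => w k * ind k j)))).
  { apply Rmult_le_compat_l; [lra|]. apply Rplus_le_compat; [easy|]. apply Rmult_le_compat_l; [lra|].
    apply lsum_le. intros j Hj. apply in_seq in Hj. apply HGj. lia. }
  rewrite lsum_plus, lsum_const, length_seq, lsum_swap.
  assert (HS : 2 * / (2 * INR J + 1) * lsum (seq 0 (S J)) (fun k => lsum (seq 1 J) (fun j => w k * ind k j)) <= T).
  { eapply Rle_trans; [|apply (HT (S J))]. rewrite <- lsum_scal. apply lsum_le. intros k _.
    rewrite (lsum_scal _ (w k) (ind k)). specialize (Hcount k). specialize (Hw k).
    change (fun j => ind k j) with (ind k) in Hcount.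
    apply (Rmult_le_compat_l (w k)) in Hcount; [|easy]. unfold w in *. lra. }
  assert (HJr : / (2 * INR J + 1) * INR J <= /2).
  { apply Rmult_le_reg_l with (2 * INR J + 1); [lra|].
    replace ((2 * INR J + 1) * (/ (2 * INR J + 1) * INR J)) with (INR J) by (field; lra). lra. }
  set (z := lsum (seq 0 (S J)) (fun k => lsum (seq 1 J) (fun j => w k * ind k j))) in *.
  replace (/ (2 * INR J + 1) * (32 * INR J + 2 * (INR J * Cb + z)))
    with (32 * (/ (2 * INR J + 1) * INR J) + 2 * Cb * (/ (2 * INR J + 1) * INR J) + 2 * / (2 * INR J + 1) * z) by ring.
  assert (2 * Cb * (/ (2 * INR J + 1) * INR J) <= 2 * Cb * /2) by (apply Rmult_le_compat_l; lra).
  lra.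
Qed.

(** * Moments of signed sums in the random environment *)

(** Both signs follow from [1 + x <= exp x]: for [x <= 0] through [(1 - x) * exp x <= 1], for
    [x > 0] through [(1 - x / 2)^2 * exp x <= 1]. *)
Lemma exp_le_quadratic x : Rabs x <= 1/4 -> exp x <= 1 + x + x^2.
Proof.
  intros Hx.
  assert (H : -1/4 <= x <= 1/4) by (revert Hx; unfold Rabs; destruct Rcase_abs; lra).
  destruct (Rle_dec x 0) as [H0|H0].
  - pose proof (exp_ineq1_le (- x)) as H1. pose proof (exp_pos x) as He.
    assert (H2 : exp (- x) * exp x = 1) by (rewrite <- exp_plus; replace (- x + x) with 0 by ring; apply exp_0).
    assert (H3 : (1 + - x) * exp x <= 1) by (rewrite <- H2; apply Rmult_le_compat_r; lra).
    assert (1 <= (1 - x) * (1 + x + x^2)) by nra.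
    apply Rmult_le_reg_l with (1 - x); lra.
  - pose proof (exp_ineq1_le (- (x / 2))) as H1. pose proof (exp_pos (x / 2)) as He.
    assert (H2 : exp (- (x / 2)) * exp (x / 2) = 1)
      by (rewrite <- exp_plus; replace (- (x / 2) + x / 2) with 0 by ring; apply exp_0).
    assert (H3 : (1 - x / 2) * exp (x / 2) <= 1) by (rewrite <- H2; apply Rmult_le_compat_r; lra).
    assert (H4 : exp x = exp (x / 2) * exp (x / 2)) by (rewrite <- exp_plus; f_equal; lra).
    assert (H5 : (1 - x / 2)^2 * exp x <= 1).
    { rewrite H4. replace ((1 - x/2)^2 * (exp (x/2) * exp (x/2))) with (((1 - x/2) * exp (x/2))^2) by ring.
      apply pow_le_one. split; [apply Rmult_le_pos; lra|easy]. }
    assert (H6 : 1 <= (1 - x / 2)^2 * (1 + x + x^2)).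
    { replace ((1 - x / 2)^2 * (1 + x + x^2)) with (1 + x^2 / 4 * (1 - 3 * x + x^2)) by field.
      assert (0 <= x^2 / 4 * (1 - 3 * x + x^2)) by (apply Rmult_le_pos; nra). lra. }
    apply Rmult_le_reg_l with ((1 - x / 2)^2); [apply pow_lt; lra|lra].
Qed.

Section Moments.
Variables (f : Z -> Z) (p : Z -> R).
Hypothesis Hf : forall y, f y = 1%Z \/ f y = (-1)%Z.
Hypothesis Hp : forall y, 0 <= p y <= 1.

Definition signed_sum (l : list Z) (b : Z -> R) (a r : Z -> bool) : R :=
  lsum l (fun x => b x * IZR (env_eps f a r x)).

Lemma signed_sum_upd l b y a r v w : ~ In y l ->
  signed_sum l b (upd a y v) (upd r y w) = signed_sum l b a r.
Proof.
  intros Hy. apply lsum_ext. intros x Hx. unfold env_eps.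
  rewrite !upd_other by (intro; congruence). easy.
Qed.

Lemma signed_sum_cons y l b a r :
  signed_sum (y :: l) b a r = b y * IZR (if a y then sgn (r y) else f y) + signed_sum l b a r.
Proof. reflexivity. Qed.

(** Factoring [exp t], with [t = b y * f y], out of each site leaves a correction proportional to
    [p y]. So the quadratic term carries [p]: lines that keep their periodic direction do not
    fluctuate. The bound 1/8 makes [|2 t| <= 1/4]. *)
Lemma exp_moment l b : NoDup l -> (forall x, Rabs (b x) <= 1/8) ->
  expect p l (fun a r => exp (signed_sum l b a r))
  <= exp (lsum l (fun x => b x * (IZR (f x) * (1 - p x)) + 2 * p x * (b x)^2)).
Proof.
  intros Hd Hb. induction l as [|y l IH].
  - unfold signed_sum. cbn. rewrite exp_0. lra.
  - inversion_clear Hd as [|? ? Hy Hl].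
    rewrite (expect_ext p Hp _ _ (fun a r => exp (b y * IZR (if a y then sgn (r y) else f y)) * exp (signed_sum l b a r)))
      by (intros; rewrite signed_sum_cons; apply exp_plus).
    rewrite (expect_indep p Hp y l (fun v w => exp (b y * IZR (if v then sgn w else f y))))
      by (intros; now rewrite signed_sum_upd).
    rewrite lsum_cons, exp_plus.
    apply Rmult_le_compat; [| |clear IH|now apply IH].
    + unfold mean1, weight. specialize (Hp y).
      pose proof (exp_pos (b y * IZR (sgn true))). pose proof (exp_pos (b y * IZR (sgn false))).
      pose proof (exp_pos (b y * IZR (f y))).
      apply Rplus_le_le_0_compat; apply Rmult_le_pos; lra.
    + rewrite <- (expect_const p Hp l 0). apply expect_le; [easy|]. intros. left. apply exp_pos.
    + set (t := b y * IZR (f y)).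
      assert (Hm : mean1 p y (fun v w => exp (b y * IZR (if v then sgn w else f y)))
        = exp t * (1 + p y / 2 * (exp (- 2 * t) - 1))).
      { unfold mean1, weight. cbn [sgn].
        assert (He : exp t * exp (- 2 * t) = exp (- t)) by (rewrite <- exp_plus; f_equal; ring).
        replace (exp t * (1 + p y / 2 * (exp (-2 * t) - 1)))
          with (exp t * (1 - p y / 2) + p y / 2 * (exp t * exp (-2 * t))) by ring.
        rewrite He. fold t. unfold t. destruct (Hf y) as [-> | ->].
        - replace (b y * -1) with (- (b y * 1)) by ring. lra.
        - replace (- (b y * -1)) with (b y * 1) by ring. lra. }
      rewrite Hm.
      assert (Ht : Rabs (- 2 * t) <= 1/4).
      { unfold t. rewrite !Rabs_mult. specialize (Hb y).
        replace (Rabs (-2)) with 2 by (unfold Rabs; destruct Rcase_abs; lra).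
        destruct (Hf y) as [-> | ->]; [rewrite Rabs_R1; lra|].
        replace (Rabs (-1)) with 1 by (unfold Rabs; destruct Rcase_abs; lra). lra. }
      pose proof (exp_le_quadratic _ Ht) as Hq. specialize (Hp y).
      replace (b y * (IZR (f y) * (1 - p y)) + 2 * p y * (b y)^2)
        with (t + p y / 2 * (-2 * t + (-2 * t)^2)).
      2:{ unfold t. destruct (Hf y) as [-> | ->]; field. }
      rewrite exp_plus. apply Rmult_le_compat_l; [left; apply exp_pos|].
      eapply Rle_trans; [|apply exp_ineq1_le].
      apply Rplus_le_compat_l, Rmult_le_compat_l; lra.
Qed.

(** The squared modulus of the characteristic function is a product over sites. One factor, at
    [b x], is [cos^2 + (1 - p)^2 sin^2], which is at most [1 - p sin^2] and hence at most
    [exp (- p sin^2)]. *)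
Lemma char_bound l b : NoDup l ->
  (expect p l (fun a r => cos (signed_sum l b a r)))^2
  + (expect p l (fun a r => sin (signed_sum l b a r)))^2
  <= exp (- lsum l (fun x => p x * (sin (b x))^2)).
Proof.
  intros Hd. induction l as [|y l IH].
  - unfold signed_sum. cbn. rewrite cos_0, sin_0, Ropp_0, exp_0. lra.
  - inversion_clear Hd as [|? ? Hy Hl]. specialize (IH Hl).
    set (u := fun v w : bool => b y * IZR (if v then sgn w else f y)).
    set (Cl := expect p l (fun a r => cos (signed_sum l b a r))) in *.
    set (Sl := expect p l (fun a r => sin (signed_sum l b a r))) in *.
    set (c1 := mean1 p y (fun v w => cos (u v w))). set (s1 := mean1 p y (fun v w => sin (u v w))).
    assert (EC : expect p (y :: l) (fun a r => cos (signed_sum (y :: l) b a r)) = c1 * Cl + - 1 * (s1 * Sl)).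
    { rewrite (expect_ext p Hp _ _ (fun a r => cos (u (a y) (r y)) * cos (signed_sum l b a r)
        + -1 * (sin (u (a y) (r y)) * sin (signed_sum l b a r))))
        by (intros; rewrite signed_sum_cons, cos_plus; unfold u; ring).
      rewrite (expect_plus p Hp), (expect_scal p Hp).
      rewrite (expect_indep p Hp y l (fun v w => cos (u v w))) by (intros; now rewrite signed_sum_upd).
      rewrite (expect_indep p Hp y l (fun v w => sin (u v w))) by (intros; now rewrite signed_sum_upd).
      reflexivity. }
    assert (ES : expect p (y :: l) (fun a r => sin (signed_sum (y :: l) b a r)) = s1 * Cl + c1 * Sl).
    { rewrite (expect_ext p Hp _ _ (fun a r => sin (u (a y) (r y)) * cos (signed_sum l b a r)
        + cos (u (a y) (r y)) * sin (signed_sum l b a r)))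
        by (intros; rewrite signed_sum_cons, sin_plus; unfold u; ring).
      rewrite (expect_plus p Hp).
      rewrite (expect_indep p Hp y l (fun v w => sin (u v w))) by (intros; now rewrite signed_sum_upd).
      rewrite (expect_indep p Hp y l (fun v w => cos (u v w))) by (intros; now rewrite signed_sum_upd).
      reflexivity. }
    rewrite EC, ES, lsum_cons.
    replace ((c1 * Cl + -1 * (s1 * Sl))^2 + (s1 * Cl + c1 * Sl)^2)
      with ((c1^2 + s1^2) * (Cl^2 + Sl^2)) by ring.
    rewrite Ropp_plus_distr, exp_plus.
    apply Rmult_le_compat; [| | |exact IH].
    + pose proof (pow2_ge_0 c1). pose proof (pow2_ge_0 s1). lra.
    + pose proof (pow2_ge_0 Cl). pose proof (pow2_ge_0 Sl). lra.
    + assert (Hc1 : c1 = cos (b y)).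
      { unfold c1, u, mean1, weight. cbn [sgn].
        destruct (Hf y) as [-> | ->]; replace (b y * -1) with (- b y) by ring;
          rewrite Rmult_1_r, ?cos_neg; lra. }
      assert (Hs1 : s1^2 = ((1 - p y) * sin (b y))^2).
      { unfold s1, u, mean1, weight. cbn [sgn].
        destruct (Hf y) as [-> | ->]; replace (b y * -1) with (- b y) by ring;
          rewrite Rmult_1_r, ?sin_neg; field. }
      rewrite Hs1, Hc1. specialize (Hp y).
      eapply Rle_trans; [|apply exp_ineq1_le].
      pose proof (sin2_cos2 (b y)) as H. unfold Rsqr in H.
      set (sb := sin (b y)) in *. set (cb := cos (b y)) in *.
      replace (cb^2) with (1 - sb^2) by lra.
      assert (0 <= p y * (1 - p y) * sb^2).
      { apply Rmult_le_pos; [apply Rmult_le_pos; lra|apply pow2_ge_0]. }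
      lra.
Qed.

Lemma expect_cos_bound l b V : NoDup l -> V <= lsum l (fun x => p x * (sin (b x))^2) ->
  Rabs (expect p l (fun a r => cos (signed_sum l b a r))) <= exp (- (V / 2)).
Proof.
  intros Hd HV. pose proof (char_bound l b Hd) as H.
  set (X := expect p l (fun a r => cos (signed_sum l b a r))) in *.
  pose proof (pow2_ge_0 (expect p l (fun a r => sin (signed_sum l b a r)))) as H1.
  apply Rsqr_incr_0_var; [|left; apply exp_pos].
  unfold Rsqr. rewrite <- exp_plus.
  replace (Rabs X * Rabs X) with (X^2) by (rewrite <- pow2_abs; ring).
  apply Rle_trans with (exp (- lsum l (fun x => p x * (sin (b x))^2))); [lra|].
  destruct (Rle_lt_or_eq_dec _ _ HV) as [Hlt|Heq].
  - left. apply exp_increasing. lra.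
  - right. f_equal. lra.
Qed.

End Moments.

(** * Anticoncentration by the Fejer kernel *)

Lemma lsum_mult {T U} (l : list T) (k : list U) g h :
  lsum l g * lsum k h = lsum l (fun x => lsum k (fun y => g x * h y)).
Proof.
  rewrite Rmult_comm, <- lsum_scal. apply lsum_ext. intros x _. rewrite lsum_scal. ring.
Qed.

Lemma fejer_expand K z :
  (lsum (seq 0 K) (fun d => cos (INR d * z)))^2 + (lsum (seq 0 K) (fun d => sin (INR d * z)))^2
  = lsum (seq 0 K) (fun d => lsum (seq 0 K) (fun d' => cos ((INR d - INR d') * z))).
Proof.
  replace (lsum (seq 0 K) (fun d => cos (INR d * z)) ^ 2) with
    (lsum (seq 0 K) (fun d => cos (INR d * z)) * lsum (seq 0 K) (fun d => cos (INR d * z))) by ring.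
  replace (lsum (seq 0 K) (fun d => sin (INR d * z)) ^ 2) with
    (lsum (seq 0 K) (fun d => sin (INR d * z)) * lsum (seq 0 K) (fun d => sin (INR d * z))) by ring.
  rewrite !lsum_mult, <- lsum_plus. apply lsum_ext. intros d _.
  rewrite <- lsum_plus. apply lsum_ext. intros d' _.
  rewrite Rmult_minus_distr_r, cos_minus. ring.
Qed.

(** The double sum is the squared modulus of the sum of the [exp (i d z)]. If [K * |z| <= 1] every
    [cos (d z)] is at least 1/2, so it is at least [K^2 / 4]. The kernel thus majorises the
    indicator of small [z], while its mean involves only characteristic functions. *)
Lemma fejer_lower K z : (1 <= K)%nat -> INR K * Rabs z <= 1 ->
  1 <= 4 / (INR K)^2 * lsum (seq 0 K) (fun d => lsum (seq 0 K) (fun d' => cos ((INR d - INR d') * z))).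
Proof.
  intros HK Hz. assert (HK1 : 1 <= INR K) by (apply (le_INR 1); lia).
  rewrite <- fejer_expand.
  assert (H : INR K / 2 <= lsum (seq 0 K) (fun d => cos (INR d * z))).
  { rewrite <- (length_seq K 0) at 1. unfold Rdiv. rewrite <- (lsum_const (seq 0 K)).
    apply lsum_le. intros d Hd. apply in_seq in Hd. replace (/2) with (1/2) by lra.
    apply cos_ge_half. rewrite Rabs_mult, (Rabs_pos_eq (INR d)) by apply pos_INR.
    eapply Rle_trans; [|exact Hz]. apply Rmult_le_compat_r; [apply Rabs_pos|]. apply le_INR. lia. }
  set (X := lsum (seq 0 K) (fun d => cos (INR d * z))) in *.
  pose proof (pow2_ge_0 (lsum (seq 0 K) (fun d => sin (INR d * z)))).
  assert (0 < 4 / INR K ^ 2) by (apply Rdiv_lt_0_compat; [lra|apply pow_lt; lra]).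
  apply Rle_trans with (4 / INR K ^ 2 * (INR K / 2)^2); [right; field; lra|].
  apply Rmult_le_compat_l; [lra|].
  assert ((INR K / 2)^2 <= X^2) by (apply pow_incr; lra). lra.
Qed.

Lemma off_diagonal_sum K d o : 0 <= o ->
  lsum (seq 0 K) (fun d' => if Nat.eqb d d' then 1 else o) <= 1 + INR K * o.
Proof.
  intros Ho.
  assert (H : lsum (seq 0 K) (fun d' => if Nat.eqb d d' then 1 else o)
    <= (if Nat.ltb d K then 1 else 0) + INR K * o).
  { induction K as [|K IH]; [simpl; lra|].
    rewrite seq_S, lsum_app, S_INR. cbn [lsum fold_right]. rewrite Nat.add_0_l.
    destruct (Nat.eqb_spec d K), (Nat.ltb_spec d (S K)), (Nat.ltb_spec d K); try lia; lra. }
  destruct (Nat.ltb d K); lra.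
Qed.

(** * Blocks are eventually good when [beta < 1] *)

(** Abel summation with the primitive [F]: the two boundary terms cost at most [2 * C], and the
    total variation of the monotone [w] at most [C]. *)
Lemma abel_bound (F w : Z -> R) (h : Z -> R) (C : R) (a : Z) (n : nat) :
  (forall y, F y - F (y - 1)%Z = h y) -> (forall y, Rabs (F y) <= C) ->
  (forall y, 0 <= w y <= 1) -> (forall y, (a <= y)%Z -> w y <= w (y + 1)%Z) ->
  Rabs (lsum (zr (a + 1) n) (fun x => h x * w x)) <= 3 * C.
Proof.
  intros HF HC Hw Hm.
  assert (HC0 : 0 <= C) by (specialize (HC 0%Z); pose proof (Rabs_pos (F 0%Z)); lra).
  assert (H : Rabs (lsum (zr (a + 1) n) (fun x => h x * w x)
      - F (a + Z.of_nat n)%Z * w (a + Z.of_nat n)%Z) <= C + C * (w (a + Z.of_nat n)%Z - w a)).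
  { induction n as [|n IH].
    - cbn [zr seq map lsum fold_right]. rewrite Z.add_0_r, Rminus_0_l, Rabs_Ropp, Rabs_mult, (Rabs_pos_eq (w a)) by apply Hw.
      specialize (HC a). specialize (Hw a). pose proof (Rabs_pos (F a)). nra.
    - rewrite zr_S, lsum_app. cbn [lsum fold_right].
      replace (a + 1 + Z.of_nat n)%Z with (a + Z.of_nat n + 1)%Z by lia.
      replace (a + Z.of_nat (S n))%Z with (a + Z.of_nat n + 1)%Z by lia.
      set (y := (a + Z.of_nat n)%Z) in *. rewrite <- (HF (y + 1)%Z).
      replace (y + 1 - 1)%Z with y by lia.
      set (L := lsum (zr (a + 1) n) (fun x => h x * w x)) in *.
      replace (L + ((F (y + 1)%Z - F y) * w (y + 1)%Z + 0) - F (y + 1)%Z * w (y + 1)%Z)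
        with (L - F y * w y + - (F y * (w (y + 1)%Z - w y))) by ring.
      eapply Rle_trans; [apply Rabs_triang|].
      assert (Hd : 0 <= w (y + 1)%Z - w y) by (specialize (Hm y ltac:(unfold y; lia)); lra).
      rewrite Rabs_Ropp, Rabs_mult, (Rabs_pos_eq (w (y + 1)%Z - w y)) by easy.
      specialize (HC y). pose proof (Rabs_pos (F y)).
      assert (Rabs (F y) * (w (y + 1)%Z - w y) <= C * (w (y + 1)%Z - w y)) by (apply Rmult_le_compat_r; easy).
      lra. }
  set (b := (a + Z.of_nat n)%Z) in *. set (L := lsum (zr (a + 1) n) (fun x => h x * w x)) in *.
  assert (H1 : Rabs (F b * w b) <= C).
  { rewrite Rabs_mult, (Rabs_pos_eq (w b)) by apply Hw. specialize (HC b). specialize (Hw b).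
    pose proof (Rabs_pos (F b)). nra. }
  replace L with (L - F b * w b + F b * w b) by ring.
  eapply Rle_trans; [apply Rabs_triang|].
  assert (C * (w b - w a) <= C * 1); [|lra].
  apply Rmult_le_compat_l; [easy|]. pose proof (Hw b). pose proof (Hw a). lra.
Qed.

Definition block_ind (k : nat) (y x : Z) : R :=
  if (Z.ltb (2 ^ Z.of_nat k) x && Z.leb x y)%bool then 1 else 0.

Lemma block_ind_sum k n h : (n <= 2 ^ k)%nat ->
  lsum (zl (2 ^ S k)) (fun x => block_ind k (2 ^ Z.of_nat k + Z.of_nat n) x * h x)
  = lsum (zr (2 ^ Z.of_nat k + 1) n) h.
Proof.
  intros Hn. pose proof (pow2_Z_nat k) as Hz.
  rewrite (lsum_restrict (zr (2 ^ Z.of_nat k + 1) n) (zl (2 ^ S k))).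
  - apply lsum_ext. intros x Hx. apply in_zr in Hx. unfold block_ind.
    destruct (Z.ltb_spec (2 ^ Z.of_nat k) x), (Z.leb_spec x (2 ^ Z.of_nat k + Z.of_nat n)); try lia.
    cbn [andb]. ring.
  - apply nodup_zr.
  - apply nodup_zl.
  - apply zr_incl_zl; cbn [Nat.pow]; lia.
  - intros x _ Hx. rewrite in_zr in Hx. unfold block_ind.
    destruct (Z.ltb_spec (2 ^ Z.of_nat k) x), (Z.leb_spec x (2 ^ Z.of_nat k + Z.of_nat n)); cbn [andb]; lia || ring.
Qed.

Lemma sum_inv_sq_bound n : sum_f_R0 (fun k => / (INR k + 1)^2) n <= 2.
Proof.
  assert (H : sum_f_R0 (fun k => / (INR k + 1)^2) n <= 2 - / (INR n + 1)).
  { induction n as [|n IH]; [simpl; field_simplify; lra|].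
    cbn [sum_f_R0]. rewrite S_INR. pose proof (pos_INR n). set (t := INR n + 1) in *.
    assert (/ (t + 1)^2 <= / t - / (t + 1)); [|lra].
    replace (/ t - / (t + 1)) with (/ (t * (t + 1))) by (field; unfold t; lra).
    apply Rinv_le_contravar; unfold t in *; nra. }
  pose proof (pos_INR n). assert (0 < / (INR n + 1)) by (apply Rinv_0_lt_compat; lra). lra.
Qed.

Lemma exp_dyadic_decay k : exp (- (2 * INR k)) * 2 ^ k <= (1/2) ^ k.
Proof.
  induction k as [|k IH].
  - cbn. rewrite Rmult_0_r, Ropp_0, exp_0. lra.
  - rewrite S_INR. replace (- (2 * (INR k + 1))) with (- (2 * INR k) + -1 + -1) by ring.
    rewrite !exp_plus. cbn [pow].
    assert (He : 0 < exp (-1) <= 1/2).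
    { split; [apply exp_pos|]. pose proof (exp_ineq1_le 1) as H1.
      assert (H2 : exp 1 * exp (-1) = 1) by (rewrite <- exp_plus; replace (1 + -1) with 0 by ring; apply exp_0).
      pose proof (exp_pos (-1)). nra. }
    assert (0 < exp (- (2 * INR k)) * 2 ^ k) by (apply Rmult_lt_0_compat; [apply exp_pos|apply pow_lt; lra]).
    assert (exp (-1) * exp (-1) <= 1/4) by nra.
    set (z := exp (- (2 * INR k)) * 2 ^ k) in *.
    replace (exp (- (2 * INR k)) * exp (-1) * exp (-1) * (2 * 2 ^ k)) with (2 * (exp (-1) * exp (-1)) * z) by (unfold z; ring).
    assert (2 * (exp (-1) * exp (-1)) * z <= 1/2 * z) by (apply Rmult_le_compat_r; lra). lra.
Qed.

Section Blocks.
Variables (Q : nat) (f : Z -> Z) (p : Z -> R) (c beta : R) (Y0 : Z).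
Hypothesis HQ2 : (2 <= Q)%nat.
Hypothesis Hf : forall y, f y = 1%Z \/ f y = (-1)%Z.
Hypothesis Hper : forall y, f (y + Z.of_nat Q)%Z = f y.
Hypothesis Hsum : Zsum_1_to f Q = 0%Z.
Hypothesis Hp : forall y, 0 <= p y <= 1.
Hypothesis Hc : 0 < c.
Hypothesis Hdecay : forall y : Z, (Y0 <= Z.abs y)%Z -> p y = c * Rpower (IZR (Z.abs y)) (- beta).
Hypothesis Hbeta : beta < 1.

Let rb : R := Rpower 2 (- beta).
Let g : R := Rpower 2 ((1 - beta) / 2).
Let cl : R := c * Rpower 2 (- Rabs beta).
Let cu : R := c * Rpower 2 (Rabs beta).

Lemma rb_pos : 0 < rb. Proof. apply exp_pos. Qed.
Lemma cl_pos : 0 < cl. Proof. apply Rmult_lt_0_compat; [easy|apply exp_pos]. Qed.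
Lemma cu_pos : 0 < cu. Proof. apply Rmult_lt_0_compat; [easy|apply exp_pos]. Qed.

Lemma g_gt_1 : 1 < g.
Proof.
  unfold g. apply Rle_lt_trans with (Rpower 2 0); [rewrite Rpower_O; lra|]. apply Rpower_lt; lra.
Qed.

Lemma g_sq k : g ^ k * g ^ k = 2 ^ k * rb ^ k.
Proof.
  rewrite <- !Rpow_mult_distr. f_equal. unfold g, rb.
  replace (2 * Rpower 2 (- beta)) with (Rpower 2 1 * Rpower 2 (- beta)) by (rewrite Rpower_1; lra).
  rewrite <- !Rpower_plus. f_equal. lra.
Qed.

(** A negative [beta] would make [p] exceed 1 far out. The sign is used for the monotonicity of
    [p]. *)
Lemma beta_nonneg : 0 <= beta.
Proof.
  set (k1 := Z.to_nat Y0). pose proof (decay_dyadic_bounds p c beta Y0 Hc Hdecay) as Hk1. fold k1 in Hk1.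
  apply Rnot_lt_le. intro Hb. pose proof cl_pos as Hcl. pose proof rb_pos as Hrb.
  assert (Hrb1 : 1 < rb).
  { unfold rb. apply Rle_lt_trans with (Rpower 2 0); [rewrite Rpower_O; lra|]. apply Rpower_lt; lra. }
  destruct (Pow_x_infinity rb ltac:(rewrite Rabs_pos_eq; lra) (2 / cl)) as [N HN].
  specialize (HN (N + k1)%nat ltac:(lia)). rewrite Rabs_pos_eq in HN by (apply pow_le; lra).
  pose proof (Hk1 (N + k1)%nat (2 ^ Z.of_nat (N + k1))%Z ltac:(lia)
    ltac:(rewrite Z.abs_eq by lia; rewrite Nat2Z.inj_succ, Z.pow_succ_r by lia; lia)) as [H _].
  specialize (Hp (2 ^ Z.of_nat (N + k1))%Z). fold cl rb in H.
  assert (cl * (2 / cl) <= cl * rb ^ (N + k1)) by (apply Rmult_le_compat_l; lra).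
  replace (cl * (2 / cl)) with 2 in H0 by (field; lra). lra.
Qed.

Lemma p_decreasing y : (Y0 <= y)%Z -> (1 <= y)%Z -> p (y + 1)%Z <= p y.
Proof.
  intros HY H1. rewrite !Hdecay by lia. apply Rmult_le_compat_l; [lra|].
  rewrite !Z.abs_eq by lia. pose proof beta_nonneg as Hb.
  assert (H : 0 < IZR y) by (apply IZR_lt; lia).
  assert (Hln : ln (IZR y) <= ln (IZR (y + 1))) by (left; apply ln_increasing; [easy|apply IZR_lt; lia]).
  unfold Rpower.
  assert (Hle : - beta * ln (IZR (y + 1)) <= - beta * ln (IZR y)) by nra.
  destruct Hle as [Hle|Hle]; [left; now apply exp_increasing|rewrite Hle; lra].
Qed.

(** Chernoff majorant of the event that some block sum exceeds [2 * k * g^k] in modulus. The factor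
    [exp (- 2 k)] outweighs the [2^k] endpoints [y]. *)
Definition sum_weight (k : nat) (a r : Z -> bool) : R :=
  lsum (zr (2 ^ Z.of_nat k) (2 ^ k)) (fun y => exp (- (2 * INR k)) *
    (exp (/ g ^ k * block_sum (env_eps f a r) k y) + exp (- / g ^ k * block_sum (env_eps f a r) k y))).

(** Fejer majorant of the event that the tent sum is below [g^k / k^3]: [k^2] terms with step
    [k / g^k] resolve exactly this size. The factor [k] in the step makes the off-diagonal
    characteristic functions as small as [exp (- const * k^2)]. *)
Definition tent_weight (k : nat) (a r : Z -> bool) : R :=
  4 / (INR (k * k))^2 * lsum (seq 0 (k * k)) (fun d => lsum (seq 0 (k * k)) (fun d' =>
    cos ((INR d - INR d') * (INR k / g ^ k * tent_sum (env_eps f a r) k)))).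

Lemma bad_block_weight k a r : (1 <= k)%nat -> ~ good_block g 2 (env_eps f a r) k ->
  1 <= sum_weight k a r + tent_weight k a r.
Proof.
  intros Hk Hbad. pose proof g_gt_1 as Hg. assert (Hgk : 1 <= g ^ k) by (apply pow_R1_Rle; lra).
  assert (Hk1 : 1 <= INR k) by (apply (le_INR 1); lia).
  assert (HN : 0 < INR (k * k)) by (rewrite mult_INR; nra).
  assert (Ht0 : 0 <= tent_weight k a r).
  { unfold tent_weight. rewrite <- fejer_expand. apply Rmult_le_pos.
    - apply Rle_mult_inv_pos; [lra|apply pow_lt; lra].
    - set (X := lsum _ _). set (Y := lsum _ (fun d => sin _)). pose proof (pow2_ge_0 X). pose proof (pow2_ge_0 Y). lra. }
  assert (Hterm : forall y, 0 <= exp (- (2 * INR k)) *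
    (exp (/ g ^ k * block_sum (env_eps f a r) k y) + exp (- / g ^ k * block_sum (env_eps f a r) k y))).
  { intros y. apply Rmult_le_pos; [left; apply exp_pos|].
    pose proof (exp_pos (/ g ^ k * block_sum (env_eps f a r) k y)).
    pose proof (exp_pos (- / g ^ k * block_sum (env_eps f a r) k y)). lra. }
  assert (Hs0 : 0 <= sum_weight k a r) by (apply lsum_nonneg; intros; apply Hterm).
  apply not_and_or in Hbad. destruct Hbad as [Hbad|Hbad].
  - apply not_all_ex_not in Hbad. destruct Hbad as [y Hy].
    apply imply_to_and in Hy. destruct Hy as [Hy Hy2]. apply Rnot_le_lt in Hy2.
    assert (Hin : In y (zr (2 ^ Z.of_nat k) (2 ^ k))).
    { apply in_zr. rewrite pow2_Z_nat. rewrite Nat2Z.inj_succ, Z.pow_succ_r in Hy by lia. lia. }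
    pose proof (lsum_in _ _ y (fun y _ => Hterm y) Hin) as H. cbv beta in H.
    change (lsum _ _) with (sum_weight k a r) in H.
    set (S := block_sum (env_eps f a r) k y) in *.
    assert (HS : 2 * INR k <= / g ^ k * Rabs S).
    { replace (2 * INR k) with (/ g ^ k * (2 * INR k * g ^ k)) by (field; lra).
      apply Rmult_le_compat_l; [left; apply Rinv_0_lt_compat; lra|lra]. }
    assert (He : 1 <= exp (- (2 * INR k)) * exp (/ g ^ k * Rabs S)).
    { rewrite <- exp_plus. pose proof (exp_ineq1_le (- (2 * INR k) + / g ^ k * Rabs S)). lra. }
    assert (Ha : exp (/ g ^ k * Rabs S) <= exp (/ g ^ k * S) + exp (- / g ^ k * S)).
    { pose proof (exp_pos (/ g ^ k * S)). pose proof (exp_pos (- / g ^ k * S)).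
      unfold Rabs. destruct Rcase_abs; [replace (/ g ^ k * - S) with (- / g ^ k * S) by ring|]; lra. }
    pose proof (exp_pos (- (2 * INR k))).
    apply (Rmult_le_compat_l (exp (- (2 * INR k)))) in Ha; [|lra].
    pose proof (Rle_trans _ _ _ (Rle_trans _ _ _ He Ha) H). lra.
  - apply Rnot_le_lt in Hbad.
    assert (1 <= tent_weight k a r); [|lra].
    apply fejer_lower; [nia|]. rewrite mult_INR.
    set (S := tent_sum (env_eps f a r) k) in *. set (n := INR k) in *. set (h := g ^ k) in *.
    rewrite Rabs_mult, (Rabs_pos_eq (n / h)) by (apply Rle_mult_inv_pos; lra).
    apply Rle_trans with (n * n * (n / h * (h / n ^ 3))).
    + apply Rmult_le_compat_l; [nra|]. apply Rmult_le_compat_l; [apply Rle_mult_inv_pos; lra|lra].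
    + right. field. lra.
Qed.

Lemma weights_nonneg k a r : 0 <= sum_weight k a r + tent_weight k a r.
Proof.
  apply Rplus_le_le_0_compat.
  - apply lsum_nonneg. intros y _. apply Rmult_le_pos; [left; apply exp_pos|].
    apply Rplus_le_le_0_compat; left; apply exp_pos.
  - unfold tent_weight. rewrite <- fejer_expand. apply Rmult_le_pos.
    + unfold Rdiv. apply Rmult_le_pos; [lra|].
      destruct (Req_dec (INR (k * k)) 0) as [->|H]; [rewrite pow_i, Rinv_0 by lia; apply Rle_refl|].
      left. apply Rinv_0_lt_compat. pose proof (pos_INR (k * k)). apply pow_lt. lra.
    + set (X := lsum _ _). set (Y := lsum _ (fun d => sin _)). pose proof (pow2_ge_0 X). pose proof (pow2_ge_0 Y). lra.
Qed.

(** The mean of [eps] at [x] is [f x * (1 - p x)]. The drift of a block stays bounded because [f]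
    has a bounded primitive and [1 - p] is nondecreasing on the block. *)
Lemma block_mean_bound k n : (Z.to_nat Y0 <= k)%nat -> (n <= 2 ^ k)%nat ->
  Rabs (lsum (zr (2 ^ Z.of_nat k + 1) n) (fun x => IZR (f x) * (1 - p x))) <= 3 * INR Q.
Proof.
  intros Hk Hn.
  assert (Hk2 : (Z.of_nat k < 2 ^ Z.of_nat k)%Z) by (apply Z.pow_gt_lin_r; lia).
  apply abel_bound with (F := per_prim Q f) (w := fun x => 1 - p x).
  - intros y. now apply per_prim_diff.
  - intros y. now apply per_prim_bound.
  - intros y. specialize (Hp y). lra.
  - intros y Hy. pose proof (p_decreasing y ltac:(lia) ltac:(lia)). lra.
Qed.

(** The drift enters with [|t| <= 1/8] and costs at most [3 * INR Q]. The variance term is [2 t^2]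
    times a sum of [p] that is at most [cu * g^(2k)], so [t] of size [g^(-k)] keeps it below
    [2 * cu]. *)
Lemma block_exp_moment k y t : (Z.to_nat Y0 <= k)%nat -> 8 <= g ^ k ->
  (2 ^ Z.of_nat k <= y < 2 * 2 ^ Z.of_nat k)%Z -> (t = / g ^ k \/ t = - / g ^ k) ->
  expect p (zl (2 ^ S k)) (fun a r => exp (t * block_sum (env_eps f a r) k y))
  <= exp (3 * INR Q + 2 * cu).
Proof.
  intros Hk Hgk Hy Ht.
  set (n := Z.to_nat (y - 2 ^ Z.of_nat k)). pose proof (pow2_Z_nat k) as Hz.
  assert (Hn : (n <= 2 ^ k)%nat) by (unfold n; lia).
  assert (Hyn : y = (2 ^ Z.of_nat k + Z.of_nat n)%Z) by (unfold n; lia).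
  set (l := zl (2 ^ S k)). set (x := / g ^ k) in *.
  assert (Hx : 0 < x <= 1/8).
  { unfold x. split; [apply Rinv_0_lt_compat; lra|]. replace (1/8) with (/8) by lra. apply Rinv_le_contravar; lra. }
  assert (Hxt : Rabs t = x).
  { destruct Ht as [-> | ->]; [|rewrite Rabs_Ropp]; apply Rabs_pos_eq; lra. }
  assert (Hx2 : t^2 = x^2) by (rewrite <- pow2_abs, Hxt; ring).
  rewrite (expect_ext p Hp _ _ (fun a r => exp (signed_sum f l (fun z => t * block_ind k y z) a r))).
  2:{ intros a r. f_equal. unfold signed_sum, block_sum, zs. rewrite <- lsum_scal.
      apply lsum_ext. intros z _. unfold block_ind. ring. }
  eapply Rle_trans; [apply exp_moment; [exact Hf|exact Hp|apply nodup_zl|]|].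
  { intros z. rewrite Rabs_mult, Hxt. unfold block_ind.
    destruct (_ && _)%bool; [rewrite Rabs_R1|rewrite Rabs_R0]; lra. }
  assert (E : lsum l (fun z => t * block_ind k y z * (IZR (f z) * (1 - p z)) + 2 * p z * (t * block_ind k y z)^2)
    = t * lsum (zr (2 ^ Z.of_nat k + 1) n) (fun z => IZR (f z) * (1 - p z))
      + 2 * x^2 * lsum (zr (2 ^ Z.of_nat k + 1) n) p).
  { rewrite <- !(block_ind_sum k n) by easy. rewrite <- Hyn. fold l.
    rewrite <- !lsum_scal, <- lsum_plus. apply lsum_ext. intros z _.
    rewrite <- Hx2. unfold block_ind. destruct (_ && _)%bool; ring. }
  cbv beta. rewrite E.
  assert (B1 : t * lsum (zr (2 ^ Z.of_nat k + 1) n) (fun z => IZR (f z) * (1 - p z)) <= 3 * INR Q).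
  { eapply Rle_trans; [apply Rle_abs|]. rewrite Rabs_mult, Hxt.
    pose proof (block_mean_bound k n Hk Hn) as H. pose proof (Rabs_pos (lsum (zr (2 ^ Z.of_nat k + 1) n) (fun z => IZR (f z) * (1 - p z)))).
    nra. }
  assert (B2 : lsum (zr (2 ^ Z.of_nat k + 1) n) p <= cu * (g ^ k * g ^ k)).
  { apply Rle_trans with (lsum (zr (2 ^ Z.of_nat k + 1) n) (fun _ => cu * rb ^ k)).
    - apply lsum_le. intros z Hzin. apply in_zr in Hzin.
      apply (decay_dyadic_bounds p c beta Y0 Hc Hdecay k z Hk).
      rewrite Nat2Z.inj_succ, Z.pow_succ_r by lia. lia.
    - rewrite lsum_const, length_zr, g_sq.
      assert (HnR : INR n <= 2 ^ k) by (replace (2 ^ k) with (INR (2 ^ k)) by (rewrite pow_INR; easy); now apply le_INR).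
      assert (0 < cu * rb ^ k) by (apply Rmult_lt_0_compat; [apply cu_pos|apply pow_lt, rb_pos]).
      replace (cu * (2 ^ k * rb ^ k)) with (2 ^ k * (cu * rb ^ k)) by ring.
      apply Rmult_le_compat_r; lra. }
  assert (B3 : 2 * x^2 * lsum (zr (2 ^ Z.of_nat k + 1) n) p <= 2 * cu).
  { apply Rle_trans with (2 * x^2 * (cu * (g ^ k * g ^ k))).
    - apply Rmult_le_compat_l; [|easy]. pose proof (pow2_ge_0 x). lra.
    - right. unfold x. field. lra. }
  assert (B4 : forall u v, u <= v -> exp u <= exp v).
  { intros u v [H|H]; [left; now apply exp_increasing|rewrite H; apply Rle_refl]. }
  apply B4. lra.
Qed.

Lemma sum_weight_mean k : (Z.to_nat Y0 <= k)%nat -> 8 <= g ^ k ->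
  expect p (zl (2 ^ S k)) (sum_weight k) <= 2 * exp (3 * INR Q + 2 * cu) * (1/2) ^ k.
Proof.
  intros Hk Hgk. unfold sum_weight. rewrite (expect_lsum p Hp).
  set (M := exp (3 * INR Q + 2 * cu)).
  apply Rle_trans with (lsum (zr (2 ^ Z.of_nat k) (2 ^ k)) (fun _ => exp (- (2 * INR k)) * (2 * M))).
  - apply lsum_le. intros y Hy. apply in_zr in Hy. rewrite pow2_Z_nat in Hy.
    rewrite (expect_scal p Hp), (expect_plus p Hp).
    apply Rmult_le_compat_l; [left; apply exp_pos|].
    pose proof (block_exp_moment k y (/ g ^ k) Hk Hgk ltac:(lia) (or_introl eq_refl)).
    pose proof (block_exp_moment k y (- / g ^ k) Hk Hgk ltac:(lia) (or_intror eq_refl)).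
    unfold M. lra.
  - rewrite lsum_const, length_zr, pow_INR. change (INR 2) with 2.
    pose proof (exp_dyadic_decay k). assert (0 < M) by apply exp_pos.
    replace (2 ^ k * (exp (- (2 * INR k)) * (2 * M))) with (2 * M * (exp (- (2 * INR k)) * 2 ^ k)) by ring.
    apply Rmult_le_compat_l; lra.
Qed.

Lemma tent_variance k : (Z.to_nat Y0 <= k)%nat -> (2 <= k)%nat ->
  cl / 8 * (g ^ k * g ^ k) <= lsum (zl (2 ^ S k)) (fun x => p x * (tent k x)^2).
Proof.
  intros Hk Hk2. destruct k as [|[|j]]; try lia. set (k := S (S j)) in *.
  set (q := (2 ^ j)%nat). assert (Hq : Z.of_nat q = (2 ^ Z.of_nat j)%Z) by apply pow2_Z_nat.
  assert (H4 : (2 ^ Z.of_nat k = 4 * Z.of_nat q)%Z).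
  { unfold k. rewrite !Nat2Z.inj_succ, !Z.pow_succ_r by lia. lia. }
  assert (Hq0 : (1 <= q)%nat) by (assert (q <> 0)%nat by (apply Nat.pow_nonzero; lia); lia).
  assert (Hq1 : 1 <= INR q) by (apply (le_INR 1); lia).
  assert (H4R : 2 ^ k = 4 * INR q) by (unfold k, q; rewrite pow_INR; change (INR 2) with 2; cbn [pow]; ring).
  (* With [2^k = 4 q] the tent has its peak at [6 q] and is at least 1/2 on [[5 q, 7 q)]: these are
     [2 q] sites, each contributing at least [cl * rb^k / 4]. *)
  apply Rle_trans with (lsum (zr (5 * Z.of_nat q) (2 * q)) (fun x => p x * (tent k x)^2)).
  - apply Rle_trans with (lsum (zr (5 * Z.of_nat q) (2 * q)) (fun _ => cl * rb ^ k * /4)).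
    + rewrite lsum_const, length_zr, g_sq, H4R, mult_INR. change (INR 2) with 2. right. field.
    + apply lsum_le. intros x Hx. apply in_zr in Hx.
      assert (Hpx : cl * rb ^ k <= p x).
      { apply (decay_dyadic_bounds p c beta Y0 Hc Hdecay k x Hk).
        rewrite Nat2Z.inj_succ, Z.pow_succ_r by lia. lia. }
      assert (Htent : 1/2 <= tent k x).
      { unfold tent. eapply Rle_trans; [|apply Rmax_r]. rewrite H4R.
        assert (Hxr : 5 * INR q <= IZR x <= 7 * INR q).
        { rewrite INR_IZR_INZ, <- !mult_IZR. split; apply IZR_le; lia. }
        assert (Ha : Rabs (IZR x - 3/2 * (4 * INR q)) <= INR q) by (apply Rabs_le; lra).
        assert (Rabs (IZR x - 3/2 * (4 * INR q)) * (2 / (4 * INR q)) <= INR q * (2 / (4 * INR q)))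
          by (apply Rmult_le_compat_r; [apply Rle_mult_inv_pos; lra|easy]).
        replace (INR q * (2 / (4 * INR q))) with (1/2) in H by (field; lra). lra. }
      assert (/4 <= (tent k x)^2) by nra.
      assert (0 < cl * rb ^ k) by (apply Rmult_lt_0_compat; [apply cl_pos|apply pow_lt, rb_pos]).
      apply Rmult_le_compat; lra.
  - apply lsum_incl; [apply nodup_zr|apply nodup_zl| |].
    + apply zr_incl_zl; rewrite ?pow2_Z_nat, ?Nat2Z.inj_succ, ?Z.pow_succ_r; lia.
    + intros x. apply Rmult_le_pos; [apply Hp|apply pow2_ge_0].
Qed.

Lemma sin_sq_lower z : Rabs z <= 1 -> z^2 / 4 <= (sin z)^2.
Proof.
  intros Hz. destruct (Rle_dec 0 z) as [H|H].
  - rewrite Rabs_pos_eq in Hz by easy. pose proof (sin_bounds z ltac:(lra)). nra.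
  - rewrite Rabs_left in Hz by lra. pose proof (sin_bounds (- z) ltac:(lra)) as Hs.
    rewrite sin_neg in Hs. nra.
Qed.

(** [INR k ^ 3 <= g ^ k] keeps the arguments of [sin] within [[-1, 1]], where [sin^2] is comparable
    to the square. As [|d - d'| >= 1], the variance of order [g^(2k)] of the tent sum yields an
    exponent of order [k^2]. *)
Lemma tent_char k d d' : (Z.to_nat Y0 <= k)%nat -> (2 <= k)%nat -> INR k ^ 3 <= g ^ k ->
  (d < k * k)%nat -> (d' < k * k)%nat -> d <> d' ->
  expect p (zl (2 ^ S k)) (fun a r =>
    cos ((INR d - INR d') * (INR k / g ^ k * tent_sum (env_eps f a r) k)))
  <= exp (- (cl / 64 * (INR k)^2)).
Proof.
  intros Hk Hk2 Hkg Hd Hd' Hne.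
  set (l := zl (2 ^ S k)). set (z := (INR d - INR d') * (INR k / g ^ k)).
  assert (Hk1 : 2 <= INR k) by (apply (le_INR 2); lia).
  assert (Hg : 8 <= g ^ k) by (assert (2^3 <= INR k ^ 3) by (apply pow_incr; lra); lra).
  assert (Hdd : 1 <= Rabs (INR d - INR d') <= INR k ^ 2).
  { rewrite !INR_IZR_INZ, <- minus_IZR, <- abs_IZR, pow_IZR. split; apply IZR_le; [lia|].
    change (Z.of_nat 2) with 2%Z. rewrite Z.pow_2_r. lia. }
  assert (Hu : 0 < INR k / g ^ k) by (apply Rdiv_lt_0_compat; lra).
  assert (Hz1 : Rabs z <= 1).
  { unfold z. rewrite Rabs_mult, (Rabs_pos_eq (INR k / g ^ k)) by lra.
    apply Rle_trans with (INR k ^ 2 * (INR k / g ^ k)); [apply Rmult_le_compat_r; lra|].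
    apply Rmult_le_reg_r with (g ^ k); [lra|].
    replace (INR k ^ 2 * (INR k / g ^ k) * g ^ k) with (INR k ^ 3) by (field; lra). lra. }
  assert (Hz2 : (INR k / g ^ k)^2 <= z^2).
  { unfold z. rewrite Rpow_mult_distr, <- (pow2_abs (INR d - INR d')).
    pose proof (pow2_ge_0 (INR k / g ^ k)). assert (1 <= Rabs (INR d - INR d') ^ 2) by (apply pow_R1_Rle; lra). nra. }
  rewrite (expect_ext p Hp _ _ (fun a r => cos (signed_sum f l (fun x => z * tent k x) a r))).
  2:{ intros a r. f_equal. unfold signed_sum, tent_sum, zs, z. rewrite <- !lsum_scal.
      apply lsum_ext. intros x _. ring. }
  eapply Rle_trans; [apply Rle_abs|].
  replace (- (cl / 64 * INR k ^ 2)) with (- (cl / 32 * INR k ^ 2 / 2)) by field.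
  apply expect_cos_bound; [exact Hf|exact Hp|apply nodup_zl|].
  apply Rle_trans with (z^2 / 4 * lsum l (fun x => p x * (tent k x)^2)).
  - apply Rle_trans with ((INR k / g ^ k)^2 / 4 * (cl / 8 * (g ^ k * g ^ k))).
    + right. field. lra.
    + apply Rmult_le_compat; [| |lra|now apply tent_variance].
      * pose proof (pow2_ge_0 (INR k / g ^ k)). lra.
      * pose proof cl_pos. apply Rmult_le_pos; [lra|]. nra.
  - rewrite <- lsum_scal. apply lsum_le. intros x _.
    pose proof (tent_range k x) as Htr.
    assert (Hzt : Rabs (z * tent k x) <= 1).
    { rewrite Rabs_mult, (Rabs_pos_eq (tent k x)) by lra. pose proof (Rabs_pos z). nra. }
    pose proof (sin_sq_lower _ Hzt) as Hs. rewrite Rpow_mult_distr in Hs.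
    replace (z ^ 2 / 4 * (p x * tent k x ^ 2)) with (p x * (z^2 * tent k x ^ 2 / 4)) by field.
    apply Rmult_le_compat_l; [apply Hp|easy].
Qed.

Lemma tent_weight_mean k : (Z.to_nat Y0 <= k)%nat -> (2 <= k)%nat -> INR k ^ 3 <= g ^ k ->
  128 / cl <= INR k -> expect p (zl (2 ^ S k)) (tent_weight k) <= 8 / (INR k)^2.
Proof.
  intros Hk Hk2 Hkg Hkc. unfold tent_weight.
  assert (Hk1 : 2 <= INR k) by (apply (le_INR 2); lia).
  set (K := (k * k)%nat). assert (HK : INR K = INR k ^ 2) by (unfold K; rewrite mult_INR; ring).
  assert (HKp : 4 <= INR K) by (rewrite HK; nra).
  rewrite (expect_scal p Hp), (expect_lsum p Hp).
  set (o := exp (- (cl / 64 * (INR k)^2))). assert (Ho : 0 < o) by apply exp_pos.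
  pose proof cl_pos as Hcl.
  assert (HKo : INR K * o <= 1).
  { unfold o. set (x := cl / 64 * INR k ^ 2).
    assert (Hx : 0 <= x) by (unfold x; apply Rmult_le_pos; nra).
    assert (He : x^2 / 4 <= exp x).
    { replace x with (x / 2 + x / 2) at 2 by lra. rewrite exp_plus.
      pose proof (exp_ineq1_le (x / 2)). nra. }
    (* Origin of the threshold [128 / cl]: [x^2 / 4] is [K * (cl * k)^2 / 16384], and
       [16384 = 128^2]. *)
    assert (HKx : INR K <= x^2 / 4).
    { rewrite HK. unfold x.
      assert (128 <= cl * INR k).
      { replace 128 with (cl * (128 / cl)) by (field; lra). apply Rmult_le_compat_l; lra. }
      replace ((cl / 64 * INR k ^ 2)^2 / 4) with ((cl * INR k)^2 / 16384 * INR k ^ 2) by field.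
      assert (1 <= (cl * INR k)^2 / 16384) by nra.
      assert (0 <= INR k ^ 2) by nra. nra. }
    assert (exp x * exp (- x) = 1) by (rewrite <- exp_plus; replace (x + - x) with 0 by ring; apply exp_0).
    rewrite <- H. apply Rmult_le_compat_r; [left; apply exp_pos|lra]. }
  (* Each row has one diagonal term, of mean at most 1, and the others contribute at most
     [K * o <= 1] together; the total is [4 / K^2 * 2 K = 8 / k^2]. *)
  apply Rle_trans with (4 / INR K ^ 2 * lsum (seq 0 K) (fun _ => 1 + INR K * o)).
  - apply Rmult_le_compat_l; [apply Rle_mult_inv_pos; [lra|apply pow_lt; lra]|].
    apply lsum_le. intros d Hd. apply in_seq in Hd.
    rewrite (expect_lsum p Hp).
    eapply Rle_trans; [|apply (off_diagonal_sum K d o); lra].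
    apply lsum_le. intros d' Hd'. apply in_seq in Hd'.
    destruct (Nat.eqb_spec d d') as [<-|Hne].
    + apply Rle_trans with (expect p (zl (2 ^ S k)) (fun _ _ => 1)).
      * apply expect_le; [easy|]. intros. apply COS_bound.
      * rewrite (expect_const p Hp). apply Rle_refl.
    + apply tent_char; try easy; unfold K in *; lia.
  - rewrite lsum_const, length_seq, <- HK.
    apply Rle_trans with (4 / INR K ^ 2 * (INR K * 2)).
    + apply Rmult_le_compat_l; [apply Rle_mult_inv_pos; [lra|apply pow_lt; lra]|].
      apply Rmult_le_compat_l; lra.
    + right. field. lra.
Qed.

Lemma good_block_local k a r a' r' :
  (forall y, In y (zl (2 ^ S k)) -> a y = a' y /\ r y = r' y) ->
  good_block g 2 (env_eps f a r) k -> good_block g 2 (env_eps f a' r') k.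
Proof.
  intros Hag [H1 H2].
  assert (He : forall y, In y (zl (2 ^ S k)) -> env_eps f a' r' y = env_eps f a r y).
  { intros y Hy. destruct (Hag y Hy) as [E1 E2]. unfold env_eps. now rewrite E1, E2. }
  split.
  - intros y Hy. specialize (H1 y Hy).
    replace (block_sum (env_eps f a' r') k y) with (block_sum (env_eps f a r) k y); [easy|].
    apply lsum_ext. intros x Hx. now rewrite He.
  - replace (tent_sum (env_eps f a' r') k) with (tent_sum (env_eps f a r) k); [easy|].
    apply lsum_ext. intros x Hx. now rewrite He.
Qed.

Lemma transience_part : almost_surely p (fun lam rho => transient (env_eps f lam rho)).
Proof.
  pose proof g_gt_1 as Hg. pose proof cl_pos as Hcl. pose proof cu_pos as Hcu.
  (* The fourth power is taken so that [k^4 <= P * g^k] and [k >= P] give [k^3 <= g^k] with constant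
     1. *)
  destruct (pow_le_exp_growth 4 g Hg) as [P [HP HPk]].
  destruct (INR_unbounded (128 / cl + P)) as [k2 Hk2].
  set (k1 := (k2 + Z.to_nat Y0 + 2)%nat).
  assert (Hk1 : forall k, (k1 <= k)%nat -> (Z.to_nat Y0 <= k)%nat /\ (2 <= k)%nat
    /\ INR k ^ 3 <= g ^ k /\ 128 / cl <= INR k /\ 8 <= g ^ k).
  { intros k Hk. assert (0 < 128 / cl) by (apply Rdiv_lt_0_compat; lra).
    assert (HkR : INR k2 <= INR k) by (apply le_INR; unfold k1 in Hk; lia).
    assert (Hk2' : 2 <= INR k) by (apply (le_INR 2); unfold k1 in Hk; lia).
    assert (H3 : INR k ^ 3 <= g ^ k).
    { specialize (HPk k). assert (0 < g ^ k) by (apply pow_lt; lra).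
      apply Rmult_le_reg_r with (INR k); [lra|].
      apply Rle_trans with (P * g ^ k); [lra|]. rewrite (Rmult_comm _ (INR k)). apply Rmult_le_compat_r; lra. }
    repeat split; [unfold k1 in Hk; lia|unfold k1 in Hk; lia|easy|lra|].
    assert (2^3 <= INR k ^ 3) by (apply pow_incr; lra). lra. }
  set (A := 2 * exp (3 * INR Q + 2 * cu)).
  assert (HA : 0 < A) by (unfold A; pose proof (exp_pos (3 * INR Q + 2 * cu)); lra).
  apply borel_cantelli with
    (E := fun k a r => (1 <= k)%nat /\ ~ good_block g 2 (env_eps f a r) k)
    (N := fun k => (2 ^ S k)%nat)
    (g := fun k a r => sum_weight k a r + tent_weight k a r)
    (* The bound [8 / k^2 = 32 / (2 k)^2] is relaxed to [32 / (k + 1)^2], which is also defined at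
       [k = 0]. *)
    (q := fun k => A * (1/2)^k + 32 * / (INR k + 1)^2) (k1 := k1) (B := A / (1 - 1/2) + 32 * 2).
  - exact Hp.
  - intros k a r a' r' Hag [Hk1' Hbad]. split; [easy|]. intro Hgood. apply Hbad.
    apply good_block_local with (a := a') (r := r'); [|easy].
    intros y Hy. destruct (Hag y Hy). auto.
  - apply weights_nonneg.
  - intros k a r [Hk Hbad]. now apply bad_block_weight.
  - intros k Hk. destruct (Hk1 k Hk) as [E1 [E2 [E3 [E4 E5]]]].
    rewrite (expect_plus p Hp). apply Rplus_le_compat; [now apply sum_weight_mean|].
    eapply Rle_trans; [now apply tent_weight_mean|].
    assert (Hk2' : 2 <= INR k) by (apply (le_INR 2); lia).
    replace (8 / INR k ^ 2) with (32 * / (2 * INR k)^2) by (field; lra).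
    apply Rmult_le_compat_l; [lra|]. apply Rinv_le_contravar; [apply pow_lt; lra|]. apply pow_incr. lra.
  - intros k. pose proof (pos_INR k).
    assert (0 < / (INR k + 1)^2) by (apply Rinv_0_lt_compat, pow_lt; lra).
    assert (0 < (1/2)^k) by (apply pow_lt; lra). nra.
  - intros n. rewrite sum_plus. apply Rplus_le_compat; [apply geom_bound; lra|].
    replace (sum_f_R0 (fun k => 32 * / (INR k + 1)^2) n) with (32 * sum_f_R0 (fun k => / (INR k + 1)^2) n)
      by (rewrite scal_sum; apply sum_eq; intros; ring).
    pose proof (sum_inv_sq_bound n). lra.
  - intros lam rho k0 Hk0.
    apply transient_of_good_blocks with (g := g) (C1 := 2) (k0 := S k0); [|easy|lra|lia|].
    + intros y. now apply env_eps_pm.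
    + intros k Hk. apply NNPP. intro Hbad. apply (Hk0 k); [lia|]. split; [lia|easy].
Qed.

End Blocks.

Theorem theorem2
  (Q : nat) (f : Z -> Z) (p : Z -> R) (c beta : R)
  (HQ2 : (2 <= Q)%nat) (HQeven : Nat.Even Q)
  (Hf : forall y, f y = 1%Z \/ f y = (-1)%Z)
  (Hper : forall y, f (y + Z.of_nat Q)%Z = f y)
  (Hsum : Zsum_1_to f Q = 0%Z)
  (Hp01 : forall y, 0 <= p y <= 1)
  (Hc : 0 < c)
  (Hdecay : exists Y0 : Z, forall y : Z, (Y0 <= Z.abs y)%Z ->
              p y = c * Rpower (IZR (Z.abs y)) (- beta)) :
  (beta < 1 -> almost_surely p (fun lam rho => transient (env_eps f lam rho))) /\
  (1 < beta -> almost_surely p (fun lam rho => recurrent (env_eps f lam rho))).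
Proof.
  split; intros Hb.
  - destruct Hdecay as [Y0 HY0].
    apply (transience_part Q f p c beta Y0); assumption.
  - apply (recurrence_part Q f HQ2 Hf Hper Hsum p c beta); assumption.
Qed.
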